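(* Let $V^h\subset H^1_0([0,L])$ be the space of continuous piecewise polynomials defined over $N$ cells of uniform width $\Delta y$ that partition $[0,L]$, of degree $m$ on all interior cells and degree $m+p$ on all boundary cells ($m\ge 1$, $p\ge 0$ integers). Let $u^h\in V^h$ be the solution of $a(u^h,\psi)=l(\psi)$ for all $\psi\in V^h$, and let $u$ be the solution of the weak problem $a(u,\psi)=l(\psi)$ for all $\psi\in H^1_0([0,L])$, with $u\in W^{m+p+1,\infty}([0,L])$. Let $$D=\frac{\sqrt{b^2+4\tilde c}}{2},\qquad \mathrm{Re}(D)\ge 1,\qquad \mathrm{Re}(D)\ge|\mathrm{Im}(D)|.$$ Assume that $n\le m+p$, where $n\ge 0$ is an integer. Then there exists a constant $C_5$ dependent on $m$, $n$, $p$, $b$, and $L$ (but independent of $u$, $D$, $\gamma$, $\alpha$, and $\Delta y$) such that, with $I_N=[L-\Delta y,L]$ the rightmost cell, $$\left\|\frac{d^n}{dy^n}(u-u^h)\right\|_{L^\infty(I_N)}\le C_5\left[|D|^{2m+p+3}\max\left(2,\frac{2}{|D|\Delta y}\right)\frac{\gamma^4}{\alpha^2}\,\|u^{(m+1)}\|_{L^\infty([0,L])}\,\Delta y^{2m+1}+|D|^2\frac{\gamma^2}{\alpha}\,\|u\|_{W^{m+p+1,\infty}(I_N)}\,\Delta y^{m+p-n+1}\right].$$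
   Context: $L>0$ and $b$ are real constants, and $\tilde c\in\mathbb{C}$ with $\mathrm{Re}(\tilde c)>0$. $H^1_0([0,L])$ is the Hilbert space of complex-valued functions on $[0,L]$ that are square-integrable together with their derivatives and vanish at $0$ and $L$. The forms are $$a(\phi,\psi)=\int_0^L\phi_y\bar\psi_y\,dy+b\int_0^L\phi_y\bar\psi\,dy+\tilde c\int_0^L\phi\bar\psi\,dy,\qquad l(\psi)=\int_0^L\tilde f\,\bar\psi\,dy,$$ where $\tilde f$ is a given complex-valued forcing function. This is the weak form of $-u_{yy}+bu_y+\tilde c u=\tilde f$ with homogeneous Dirichlet boundary conditions. The boundedness and coercivity constants of $a$ are $\gamma=1+|b|+|\tilde c|$ and $\alpha=\min(1,\mathrm{Re}(\tilde c))$. The boundary cells are $[0,\Delta y]$ and $[L-\Delta y,L]$; all other cells are interior cells. *)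

(* Defs.v *)
From mathcomp Require Import all_boot all_order all_algebra.
From mathcomp Require Import all_classical all_reals all_analysis.
From mathcomp.real_closed Require Import complex.

Set Implicit Arguments.
Unset Strict Implicit.
Unset Printing Implicit Defensive.
Import Order.TTheory GRing.Theory Num.Theory.
Import numFieldNormedType.Exports.

Local Open Scope classical_set_scope.
Local Open Scope ring_scope.
Local Open Scope complex_scope.

Section ComplexValuedFunctions.
Variable R : realType.
Local Notation mu := (@lebesgue_measure R).
Implicit Types (a b x y : R) (f g : R -> R[i]).

Definition modulus (z : R[i]) : R := ComplexField.Normc.normc z.

Definition cintegral a b f : R[i] :=
  (\int[mu]_(x in `[a, b]) complex.Re (f x)) +i* (\int[mu]_(x in `[a, b]) complex.Im (f x)).

(* Componentwise classical derivatives; at a point where the derivative does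
   not exist the value is arbitrary, which only ever matters on null sets. *)
Definition cderive (n : nat) f : R -> R[i] :=
  fun x => derive1n n (@complex.Re R \o f) x +i* derive1n n (@complex.Im R \o f) x.

Definition Lp (p : \bar R) a b f : Prop :=
  (@complex.Re R \o f) \_ `[a, b] \in Lfun mu p /\ (@complex.Im R \o f) \_ `[a, b] \in Lfun mu p.

Definition Linf_norm a b f : \bar R :=
  'N[mu]_+oo[EFin \o (fun x => modulus (f x)) \_ `[a, b]]%E.

(* (Local) absolute continuity on an interval I: f is the indefinite integral
   of its almost-everywhere derivative. *)
Definition abs_cont (I : set R) f : Prop :=
  forall x y, I x -> I y -> x <= y ->
    Lp 1%E x y (cderive 1 f) /\ f y - f x = cintegral x y (cderive 1 f).

(* H^1_0([0,L]), its elements being represented by absolutely continuous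
   functions so that boundary values are meaningful. *)
Definition H10 (L : R) f : Prop :=
  [/\ abs_cont `[0, L] f,
      Lp 2%:E 0 L f,
      Lp 2%:E 0 L (cderive 1 f),
      f 0 = 0 & f L = 0].

(* W^{k,oo}([a,b]); the derivatives of order < k are taken in the interior,
   since at the endpoints cderive would depend on values of f outside [a,b]. *)
Definition Wkinf (k : nat) a b f : Prop :=
  (forall j, (j < k)%N -> abs_cont `]a, b[ (cderive j f)) /\
  (forall j, (j <= k)%N -> Lp +oo%E a b (cderive j f)).

Definition Wkinf_norm (k : nat) a b f : \bar R :=
  \big[maxe/0%E]_(j < k.+1) Linf_norm a b (cderive j f).

Definition form_a (L b : R) (c : R[i]) (phi psi : R -> R[i]) : R[i] :=
  cintegral 0 L (fun y => cderive 1 phi y * (cderive 1 psi y)^*)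
  + b%:C * cintegral 0 L (fun y => cderive 1 phi y * (psi y)^*)
  + c * cintegral 0 L (fun y => phi y * (psi y)^*).

Definition form_l (L : R) (f psi : R -> R[i]) : R[i] :=
  cintegral 0 L (fun y => f y * (psi y)^*).

Definition bound_const (b : R) (c : R[i]) : R := 1 + `|b| + modulus c.

Definition coer_const (c : R[i]) : R := Num.min 1 (complex.Re c).

(* sqrtc is the principal square root (Re >= 0). *)
Definition Dconst (b : R) (c : R[i]) : R[i] :=
  sqrtc ((b ^+ 2)%:C + 4 * c) / 2.

Definition cell_width (L : R) (N : nat) : R := L / N%:R.

Definition cell_degree (N m p k : nat) : nat :=
  if (k == 0)%N || (k == N.-1) then (m + p)%N else m.

(* The polynomials agree with psi on the closed cells, hence at shared nodes,
   so psi is continuous; the k-th cell is [k dy, (k+1) dy], k < N. *)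
Definition Vh (L : R) (N m p : nat) (psi : R -> R[i]) : Prop :=
  H10 L psi /\
  forall k, (k < N)%N -> exists P : {poly R[i]},
    (size P <= (cell_degree N m p k).+1)%N /\
    forall y, k%:R * cell_width L N <= y <= k.+1%:R * cell_width L N ->
      psi y = P.[y%:C].

End ComplexValuedFunctions.

(* Main.v *)
From HB Require Import structures.
Require Import Defs.
From mathcomp Require Import all_boot all_order all_algebra.
From mathcomp Require Import all_classical all_reals all_analysis.
From mathcomp Require Import measurable_realfun ess_sup_inf.
From mathcomp.real_closed Require Import complex polyrcf.
From mathcomp Require Import ring lra zify.
Import Order.TTheory GRing.Theory Num.Theory.
Import numFieldNormedType.Exports.
Local Open Scope ring_scope.
Set Implicit Arguments.
Unset Strict Implicit.
Unset Printing Implicit Defensive.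

(** The problem is reduced to polynomials on the unit interval: on each cell a
    function of V^h is, in the local coordinate t in [0, 1], a polynomial of
    bounded degree, and constants then depend on that degree only.  Polynomials
    are measured by the seminorms tail n, which bound the derivatives of order
    at least n and can be compared with one another without losing powers of D.

    Interpolation.  Let E = u - u^h.  On a cell of degree d, a polynomial chi of
    degree d shares the end values of E and its moments up to order d - 2
    (interp_exists).  It is as close to E as a Taylor polynomial (interp_bound,
    taylor_approx, cell_near).  Integration by parts leaves a form that sees a
    function on a cell only through its end values and moments (form_a_cells),
    and its second-order part involves exactly the moments up to order d - 2.
    Galerkin orthogonality therefore becomes a discrete problem for chi whose
    load contains only the lower-order terms, applied to the moments nu of
    E - chi (cellgal_perturb, galerkin_cells).

    The last interior node.  The value of chi there is the load of the discrete
    Green function v of that node (green_exists).  The pole lies one cell away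
    from the boundary, so coercivity makes v of size h D^2 (green_estimate).  As
    nu vanishes up to order m - 2, only the tail of index m - 1 of v is seen.
    Testing with bubbles shows that v solves v'' = - h b v' + h^2 c v up to
    aliasing of its high coefficients, so that every index of the tail gains a
    factor D h (tail_recursion, tail_decay).  With nu of order h^(m+1) this
    produces the superconvergent order h^(2m+1) (nodal_estimate).

    The last cell.  Its degree is m + p, and chi is determined there by the nodal
    value and by a load of order h^(m+p+1).  The recursion on tails shows again
    that a derivative of the first part costs a factor D and not 1/h, except
    for the first one; this is the origin of max(2, 2/(D h))
    (boundary_cell_estimate).

    Adding the Taylor remainder (cell_error_deriv) leaves a count of powers
    (collect_powers): a surplus factor D^2 is absorbed by gamma, because
    D^2 = b^2/4 + c (kappa_bounds). *)

(** * Moment functionals and integration of polynomials over [0, 1] *)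

Section Moments.
Variable F : numFieldType.
Implicit Types (p q : {poly F}) (s : nat -> F).

Definition pairing s q : F := \sum_(i < size q) q`_i * s i.

Lemma pairing_widen s q n : (size q <= n)%N ->
  pairing s q = \sum_(i < n) q`_i * s i.
Proof.
move=> le_qn; rewrite /pairing (big_ord_widen n (fun i => q`_i * s i)) //.
rewrite big_mkcond /=; apply: eq_bigr => i _; case: ifPn => //.
by rewrite -leqNgt => /(nth_default 0) ->; rewrite mul0r.
Qed.

Lemma pairing_is_linear s : linear_for *%R (pairing s).
Proof.
move=> a p q; set n := maxn (size p) (size q).
have hp : (size p <= n)%N by rewrite leq_maxl.
have hq : (size q <= n)%N by rewrite leq_maxr.
have hpq : (size (a *: p + q)%R <= n)%N.
  by rewrite (leq_trans (size_polyD _ _))// geq_max hq andbT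
     (leq_trans (size_scale_leq _ _)).
rewrite (pairing_widen s hp) (pairing_widen s hq) (pairing_widen s hpq).
rewrite mulr_sumr -big_split /=; apply: eq_bigr => i _.
by rewrite coefD coefZ mulrDl mulrA.
Qed.

HB.instance Definition _ s :=
  GRing.isLinear.Build F {poly F} F *%R (pairing s) (pairing_is_linear s).

Lemma pairingXn s n : pairing s 'X^n = s n.
Proof.
rewrite (pairing_widen s (_ : (_ <= n.+1)%N)) ?size_polyXn //.
rewrite big_ord_recr /= coefXn eqxx mul1r big1 ?add0r // => i _.
by rewrite coefXn ltn_eqF ?mul0r.
Qed.

Lemma pairingDl s1 s2 q :
  pairing (fun i => s1 i + s2 i) q = pairing s1 q + pairing s2 q.
Proof. by rewrite -big_split; apply: eq_bigr => i _; rewrite mulrDr. Qed.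


Definition integ q : F := pairing (fun i => i.+1%:R^-1) q.

Lemma integ_is_linear : linear_for *%R integ.
Proof. exact: pairing_is_linear. Qed.

HB.instance Definition _ :=
  GRing.isLinear.Build F {poly F} F *%R integ integ_is_linear.

Lemma pairingD s p q : pairing s (p + q) = pairing s p + pairing s q.
Proof. exact: raddfD. Qed.
Lemma pairingZ s a p : pairing s (a *: p) = a * pairing s p.
Proof. exact: linearZ. Qed.
Lemma integD p q : integ (p + q) = integ p + integ q.
Proof. exact: raddfD. Qed.
Lemma integB p q : integ (p - q) = integ p - integ q.
Proof. exact: raddfB. Qed.
Lemma integZ a p : integ (a *: p) = a * integ p.
Proof. exact: linearZ. Qed.

Lemma integXn n : integ 'X^n = n.+1%:R^-1.
Proof. exact: pairingXn. Qed.

Lemma integ_deriv q : integ q^`() = q.[1] - q.[0].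
Proof.
rewrite /integ (pairing_widen _ (size_poly _ _)) horner_coef0 horner_coef.
have [->|q0] := eqVneq q 0; first by rewrite size_poly0 !big_ord0 coef0 subr0.
have -> : size q = (size q).-1.+1 by rewrite prednK ?size_poly_gt0.
rewrite /= big_ord_recl expr1n mulr1 addrC addKr.
by apply: eq_bigr => i _; rewrite coef_deriv expr1n mulr1 -[_ *+ _]mulr_natr mulfK // pnatr_eq0.
Qed.

Lemma integ_by_parts p q :
  integ (p^`() * q) = p.[1] * q.[1] - p.[0] * q.[0] - integ (p * q^`()).
Proof. by rewrite -!hornerM -integ_deriv derivM integD addrK. Qed.

Definition antideriv q : {poly F} :=
  \poly_(i < (size q).+1) (q`_i.-1 / i%:R).

Lemma antiderivK q : (antideriv q)^`() = q.
Proof.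
apply/polyP => i; rewrite coef_deriv coef_poly ltnS /=.
case: ltnP => h; last by rewrite mul0rn nth_default.
by rewrite -[LHS]mulr_natr mulfVK // pnatr_eq0.
Qed.

Lemma antideriv0 q : (antideriv q).[0] = 0.
Proof. by rewrite horner_coef0 coef_poly /= invr0 mulr0. Qed.

Lemma integE q : integ q = (antideriv q).[1].
Proof. by rewrite -{1}(antiderivK q) integ_deriv antideriv0 subr0. Qed.

Lemma size_antideriv q : (size (antideriv q) <= (size q).+1)%N.
Proof. exact: size_poly. Qed.

Definition bubble : {poly F} := 'X * (1 - 'X).

Lemma bubble0 : bubble.[0] = 0. Proof. by rewrite /bubble !hornerE. Qed.
Lemma bubble1 : bubble.[1] = 0. Proof. by rewrite /bubble !hornerE subrr. Qed.

Lemma size_bubble : size bubble = 3.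
Proof.
have -> : bubble = - ('X * ('X - 1%:P)) by rewrite /bubble -mulrN opprB.
by rewrite size_polyN mulrC size_mulX ?size_XsubC ?polyXsubC_eq0.
Qed.

Lemma bubble_neq0 : bubble != 0. Proof. by rewrite -size_poly_gt0 size_bubble. Qed.

Lemma bubble_factor q : q.[0] = 0 -> q.[1] = 0 ->
  exists2 r, q = bubble * r & (size r <= (size q).-2)%N.
Proof.
move=> q0 q1.
have /factor_theorem[r1 e1] : root q 0 by apply/eqP.
have /factor_theorem[r2 e2] : root r1 1.
  by apply/eqP; rewrite -q1 e1 !hornerE subr0 mulr1.
have eq : q = bubble * - r2 by rewrite e1 e2 /bubble subr0; ring.
exists (- r2) => //; have [r20|r2n0] := eqVneq (- r2) 0.
  by rewrite r20 size_poly0.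
by rewrite eq size_mul ?bubble_neq0 // size_bubble.
Qed.

End Moments.

Lemma integ_map (F G : numFieldType) (f : {rmorphism F -> G}) (q : {poly F}) :
  integ (map_poly f q) = f (integ q).
Proof.
rewrite /integ /pairing size_map_poly rmorph_sum; apply: eq_bigr => i _.
by rewrite coef_map rmorphM fmorphV rmorph_nat.
Qed.

Section RealInteg.
Variable R : realType.
Implicit Types p q : {poly R}.

Lemma integ_ge0 p : (forall x, 0 <= x <= 1 -> 0 <= p.[x]) -> 0 <= integ p.
Proof.
move=> p0; rewrite -(antiderivK p) integ_deriv.
have [c cI ->] := poly_mvt (antideriv p) (@ltr01 R).
rewrite antiderivK subr0 mulr1 p0 //.
by move: cI; rewrite in_itv /= => /andP[/ltW -> /ltW ->].
Qed.

Lemma poly_eq0_itv p : (forall x : R, 0 < x < 1 -> p.[x] = 0) -> p = 0.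
Proof.
move=> p0; pose s := mkseq (fun i => i.+2%:R^-1 : R) (size p).
apply: (@roots_geq_poly_eq0 _ p s).
- apply/allP => _ /mapP[i _ ->]; apply/eqP/p0.
  by rewrite invr_gt0 ltr0n /= invf_lt1 ?ltr0n // ltr1n.
- rewrite /s map_inj_uniq ?iota_uniq // => i j /eqP.
  by rewrite (inj_eq invr_inj) eqr_nat => /eqP[].
- by rewrite size_mkseq.
Qed.

Lemma integ_eq0 p : (forall x, 0 <= x <= 1 -> 0 <= p.[x]) -> integ p = 0 -> p = 0.
Proof.
move=> p0 ip; have cst x : 0 < x < 1 -> (antideriv p).[x] = 0.
  move=> /andP[x0 x1]; apply/eqP; rewrite eq_le; apply/andP; split.
    rewrite -[leRHS]ip integE -subr_ge0.
    have [c cI ->] := poly_mvt (antideriv p) x1.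
    rewrite antiderivK; apply: mulr_ge0; last by rewrite subr_ge0 ltW.
    apply: p0.
    move: cI; rewrite in_itv /= => /andP[/(lt_trans x0)/ltW -> /ltW -> //].
  have [c cI ] := poly_mvt (antideriv p) x0.
  rewrite antideriv0 !subr0 => ->; rewrite antiderivK; apply: mulr_ge0; last exact: ltW.
  apply: p0.
  by move: cI; rewrite in_itv /= => /andP[/ltW -> /= /lt_trans/(_ x1)/ltW].
by rewrite -(antiderivK p) (poly_eq0_itv cst) linear0.
Qed.

End RealInteg.

Section Modulus.
Variable R : realType.
Local Notation C := R[i].
Implicit Types z w : C.

Lemma modulusD z w : modulus (z + w) <= modulus z + modulus w.
Proof. exact: le_normcD. Qed.
Lemma modulusN z : modulus (- z) = modulus z.
Proof. exact: normcN. Qed.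
Lemma modulusB z w : modulus (z - w) <= modulus z + modulus w.
Proof. by rewrite -(modulusN w) modulusD. Qed.
Lemma modulusM z w : modulus (z * w) = modulus z * modulus w.
Proof. exact: ComplexField.Normc.normcM. Qed.
Lemma modulus0 : modulus (0 : C) = 0.
Proof. exact: ComplexField.Normc.normc0. Qed.
Lemma modulus1 : modulus (1 : C) = 1.
Proof. exact: ComplexField.Normc.normc1. Qed.
Lemma modulus_ge0 z : 0 <= modulus z.
Proof. by case: z => a b; exact: sqrtr_ge0. Qed.
Lemma modulusV z : modulus z^-1 = (modulus z)^-1.
Proof. exact: ComplexField.Normc.normcV. Qed.
Lemma modulusX z n : modulus (z ^+ n) = modulus z ^+ n.
Proof. by elim: n => [|n IH]; rewrite ?modulus1 // !exprS modulusM IH. Qed.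
Lemma modulus_real (x : R) : modulus (x%:C)%C = `|x|.
Proof. by rewrite /modulus /= expr0n /= addr0 sqrtr_sqr. Qed.
Lemma modulus_nat n : modulus (n%:R : C) = n%:R.
Proof. by rewrite -(rmorph_nat (real_complex R)) modulus_real normr_nat. Qed.
Lemma modulus_sum I (r : seq I) (P : pred I) (f : I -> C) :
  modulus (\sum_(i <- r | P i) f i) <= \sum_(i <- r | P i) modulus (f i).
Proof.
elim/big_rec2: _ => [|i x y _ h]; first by rewrite modulus0.
by apply: (le_trans (modulusD _ _)); rewrite lerD2l.
Qed.
Lemma modulus_conj z : modulus (z^*)%C = modulus z.
Proof. by case: z => a b; rewrite /modulus /= sqrrN. Qed.
Lemma sqr_modulus z : modulus z ^+ 2 = complex.Re z ^+ 2 + complex.Im z ^+ 2.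
Proof. by case: z => a b; rewrite /modulus /= sqr_sqrtr // addr_ge0 // sqr_ge0. Qed.
Lemma normr_Re_le z : `|complex.Re z| <= modulus z.
Proof. by case: z => a b; rewrite -sqrtr_sqr /modulus /= ler_wsqrtr // lerDl sqr_ge0. Qed.
Lemma normr_Im_le z : `|complex.Im z| <= modulus z.
Proof. by case: z => a b; rewrite -sqrtr_sqr /modulus /= ler_wsqrtr // lerDr sqr_ge0. Qed.
Lemma Re_le_modulus z : complex.Re z <= modulus z.
Proof. exact: le_trans (ler_norm _) (normr_Re_le z). Qed.
Lemma modulus_le_ReIm z : modulus z <= `|complex.Re z| + `|complex.Im z|.
Proof.
rewrite -(ler_pXn2r (_ : 0 < 2)%N) ?nnegrE ?modulus_ge0 ?addr_ge0 //.
rewrite sqr_modulus sqrrD !real_normK ?num_real //.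
have := mulr_ge0 (normr_ge0 (complex.Re z)) (normr_ge0 (complex.Im z)); lra.
Qed.
Lemma ReD z w : complex.Re (z + w) = complex.Re z + complex.Re w.
Proof. by case: z; case: w. Qed.
Lemma ImD z w : complex.Im (z + w) = complex.Im z + complex.Im w.
Proof. by case: z; case: w. Qed.
Lemma ReN z : complex.Re (- z) = - complex.Re z.
Proof. by case: z. Qed.
Lemma ImN z : complex.Im (- z) = - complex.Im z.
Proof. by case: z. Qed.
Lemma Re_scale (x : R) z : complex.Re ((x%:C)%C * z) = x * complex.Re z.
Proof. by case: z => a b /=; rewrite mul0r subr0. Qed.
Lemma Re_sum I (r : seq I) (P : pred I) (f : I -> C) :
  complex.Re (\sum_(i <- r | P i) f i) = \sum_(i <- r | P i) complex.Re (f i).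
Proof. by apply: (big_morph _ ReD). Qed.

End Modulus.

(** * Coefficient norms and the L2 norm of complex polynomials on [0, 1] *)

Section ComplexPoly.
Variable R : realType.
Local Notation C := R[i].
Local Notation RC := (map_poly (real_complex R)).
Implicit Types (P Q : {poly C}) (n : nat).

(** A seminorm with kernel the polynomials of degree below n: it controls all
    derivatives of order at least n on [0, 1].  It decreases with n, so that bounds
    for different orders can be chained. *)
Definition tail n P : R := \sum_(n <= i < size P) modulus P`_i.

Lemma tail_widen n P s : (size P <= s)%N ->
  tail n P = \sum_(n <= i < s) modulus P`_i.
Proof.
move=> h; rewrite /tail; have [hn|hn] := leqP n (size P).
  rewrite (big_cat_nat hn h) /= [X in _ + X]big1_seq ?addr0 // => i.
  by rewrite mem_index_iota /= => /andP[hi _]; rewrite nth_default ?modulus0.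
rewrite !big_nat [LHS]big1; first last.
  by move=> i /andP[ni /(leq_ltn_trans ni)]; rewrite ltnNge (ltnW hn).
rewrite big1 // => i /andP[/(leq_trans (ltnW hn)) hi _].
by rewrite nth_default ?modulus0.
Qed.

Lemma tail_ge0 n P : 0 <= tail n P.
Proof. by apply: sumr_ge0 => i _; exact: modulus_ge0. Qed.

Lemma tail_anti n1 n2 P : (n1 <= n2)%N -> tail n2 P <= tail n1 P.
Proof.
move=> h; rewrite /tail; have [h2|h2] := leqP n2 (size P).
  by rewrite (big_cat_nat h h2) /= lerDr; apply: sumr_ge0 => i _; exact: modulus_ge0.
by rewrite big_geq 1?ltnW // tail_ge0.
Qed.

Lemma tail_gt_size n P : (size P <= n)%N -> tail n P = 0.
Proof. by move=> h; rewrite /tail big_geq. Qed.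

Lemma tailD n P Q : tail n (P + Q) <= tail n P + tail n Q.
Proof.
set s := maxn (size P) (size Q).
rewrite (@tail_widen n P s) ?leq_maxl // (@tail_widen n Q s) ?leq_maxr //.
rewrite (tail_widen n (size_polyD P Q)) -big_split /=.
by apply: ler_sum => i _; rewrite coefD modulusD.
Qed.

Lemma tailZ n (a : C) P : tail n (a *: P) = modulus a * tail n P.
Proof.
rewrite (tail_widen n (size_scale_leq a P)) /tail mulr_sumr.
by apply: eq_bigr => i _; rewrite coefZ modulusM.
Qed.

Lemma tailN n P : tail n (- P) = tail n P.
Proof. by rewrite -scaleN1r tailZ modulusN modulus1 mul1r. Qed.

Lemma tailB n P Q : tail n (P - Q) <= tail n P + tail n Q.
Proof. by rewrite -(tailN n Q) tailD. Qed.

Lemma tail_coef n i P : (n <= i)%N -> modulus P`_i <= tail n P.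
Proof.
move=> ni; have [hi|hi] := ltnP i (size P); last first.
  by rewrite nth_default // modulus0 tail_ge0.
rewrite /tail (bigD1_seq i) ?mem_index_iota ?ni ?iota_uniq //=.
by rewrite lerDl; apply: sumr_ge0 => j _; exact: modulus_ge0.
Qed.

Lemma tail0C (a : C) : tail 0 a%:P = modulus a.
Proof.
rewrite (tail_widen 0 (size_polyC_leq1 a)) big_nat1 coefC //.
Qed.

Lemma tailXn n k : tail n ('X^k : {poly C}) <= 1.
Proof.
apply: (le_trans (tail_anti _ (leq0n n))).
rewrite /tail size_polyXn big_nat_recr //= coefXn eqxx modulus1 big1_seq ?add0r //.
by move=> i; rewrite mem_index_iota => /andP[_ /ltn_eqF h]; rewrite coefXn h modulus0.
Qed.

Lemma tail_recl P : tail 0 P = modulus P`_0 + tail 1 P.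
Proof.
have [->|P0] := eqVneq P 0.
  by rewrite !tail_gt_size ?size_poly0 // coef0 modulus0 addr0.
by rewrite /tail big_ltn // size_poly_gt0.
Qed.

Lemma tail_deriv n P : tail n P^`() <= (size P)%:R * tail n.+1 P.
Proof.
rewrite (@tail_widen n _ (size P).-1); last exact: size_poly.
have [->|P0] := eqVneq P 0.
  by rewrite size_poly0 big_geq // mul0r.
rewrite /tail -{3}(@prednK (size P)) ?size_poly_gt0 // big_add1 /= mulr_sumr.
rewrite !big_nat; apply: ler_sum => i /andP[_ hi].
rewrite coef_deriv -[_ *+ _]mulr_natl modulusM modulus_nat ler_wpM2r ?modulus_ge0 //.
by rewrite ler_nat; apply: (leq_trans hi); exact: leq_pred.
Qed.


Lemma tailM P Q : tail 0 (P * Q) <= tail 0 P * tail 0 Q.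
Proof.
have aux n : tail 0 (P * 'X^n) <= tail 0 P.
  rewrite (@tail_widen 0 _ (n + size P)); last first.
    apply: (leq_trans (size_polyMleq _ _)).
    by rewrite size_polyXn addnS /= addnC.
  rewrite (big_cat_nat (leq0n n) (leq_addr _ _)) /= big1_seq ?add0r; last first.
    by move=> i; rewrite mem_index_iota /= => hi; rewrite coefMXn hi modulus0.
  rewrite -{1}(add0n n) big_addn addKn /tail.
  by apply: ler_sum => i _; rewrite coefMXn ltnNge leq_addl /= addnK.
rewrite -{1}[Q]coefK poly_def mulr_sumr.
have: tail 0 (\sum_(i < size Q) (P * (Q`_i *: 'X^i))) <=
  \sum_(i < size Q) tail 0 (P * (Q`_i *: 'X^i)).
  elim/big_rec2: _ => [|i x y _ h]; first by rewrite tail_gt_size ?size_poly0.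
  by apply: (le_trans (tailD _ _ _)); rewrite lerD2l.
move/le_trans; apply; rewrite [X in _ <= _ * X]/tail big_mkord mulr_sumr.
apply: ler_sum => i _; rewrite -scalerAr tailZ mulrC.
by rewrite ler_wpM2r ?modulus_ge0.
Qed.

Lemma modulus_horner P (x : C) : modulus x <= 1 -> modulus P.[x] <= tail 0 P.
Proof.
move=> x1; rewrite horner_coef; apply: (le_trans (modulus_sum _ _ _)).
rewrite /tail big_mkord; apply: ler_sum => i _; rewrite modulusM modulusX.
by rewrite ler_piMr ?modulus_ge0 // exprn_ile1 ?modulus_ge0.
Qed.

Lemma modulus_pairing (s : nat -> C) P (e : R) n :
  (forall i, (i < n)%N -> s i = 0) ->
  (forall i, (i < size P)%N -> modulus (s i) <= e) ->
  modulus (pairing s P) <= e * tail n P.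
Proof.
move=> s0 se; apply: (le_trans (modulus_sum _ _ _)).
have [hn|hn] := leqP n (size P); last first.
  rewrite tail_gt_size 1?ltnW // mulr0 big1 // => i _.
  by rewrite s0 ?mulr0 ?modulus0 // (ltn_trans _ hn).
rewrite -(big_mkord xpredT (fun i => modulus (P`_i * s i))) /=.
rewrite (big_cat_nat _ hn) //= big1_seq ?add0r; last first.
  by move=> i; rewrite mem_index_iota => /andP[_ hi]; rewrite s0 ?mulr0 ?modulus0.
rewrite /tail mulr_sumr !big_nat; apply: ler_sum => i /andP[_ hi].
by rewrite modulusM mulrC ler_wpM2r ?modulus_ge0 // se.
Qed.

Lemma modulus_integ P : modulus (integ P) <= tail 0 P.
Proof.
rewrite -[leRHS]mul1r; apply: modulus_pairing => // i _.
by rewrite modulusV modulus_nat invf_le1 ?ltr0n ?ler1n.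
Qed.

End ComplexPoly.

Section L2.
Variable R : realType.
Local Notation C := R[i].
Local Notation RC := (map_poly (real_complex R)).
Implicit Types (P Q : {poly C}) (V : {poly R}).

Definition rep P : {poly R} := \poly_(i < size P) complex.Re P`_i.
Definition imp P : {poly R} := \poly_(i < size P) complex.Im P`_i.
Definition conjp P : {poly C} := map_poly conjc P.

Lemma coef_rep P i : (rep P)`_i = complex.Re P`_i.
Proof. by rewrite coef_poly; case: ltnP => // /(nth_default 0) ->. Qed.
Lemma coef_imp P i : (imp P)`_i = complex.Im P`_i.
Proof. by rewrite coef_poly; case: ltnP => // /(nth_default 0) ->. Qed.

Lemma poly_ReIm P : P = RC (rep P) + 'i%C *: RC (imp P).
Proof.
apply/polyP => i; rewrite coefD coefZ !(coef_map (real_complex R)) /= coef_rep coef_imp.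
exact: complexE.
Qed.

Lemma conjp_ReIm P : conjp P = RC (rep P) - 'i%C *: RC (imp P).
Proof.
apply/polyP => i; rewrite coefB coefZ (coef_map conjc) !(coef_map (real_complex R)) /= coef_rep coef_imp.
by case: P`_i => a b /=; simpc.
Qed.

(** The square of the modulus of a complex polynomial on the real line. *)
Definition sqmod P : {poly R} := rep P ^+ 2 + imp P ^+ 2.

Lemma mul_conjp P : P * conjp P = RC (sqmod P).
Proof.
rewrite conjp_ReIm {1}[P]poly_ReIm mulrC -subr_sqr /sqmod rmorphD !rmorphXn /=.
by rewrite exprZn sqr_i scaleN1r opprK.
Qed.

Lemma sqmod_ge0 P x : 0 <= (sqmod P).[x].
Proof. by rewrite !hornerE addr_ge0 // sqr_ge0. Qed.

Lemma sqmod_eq0 P : sqmod P = 0 -> P = 0.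
Proof.
move=> e; have h x : ((rep P).[x] == 0) && ((imp P).[x] == 0).
  have : (sqmod P).[x] = 0 by rewrite e horner0.
  by rewrite !hornerE => /eqP; rewrite paddr_eq0 ?sqr_ge0 // !sqrf_eq0.
have r0 : rep P = 0 by apply: poly_eq0_itv => x _; apply/eqP; case/andP: (h x).
have i0 : imp P = 0 by apply: poly_eq0_itv => x _; apply/eqP; case/andP: (h x).
by rewrite [P]poly_ReIm r0 i0 rmorph0 scaler0 addr0.
Qed.

Definition energy P : R := integ (sqmod P).

Lemma energy_ge0 P : 0 <= energy P.
Proof. by apply: integ_ge0 => x _; exact: sqmod_ge0. Qed.

Lemma integ_mul_conjp P : integ (P * conjp P) = ((energy P)%:C)%C.
Proof. by rewrite mul_conjp integ_map. Qed.

Lemma bubble_map : RC (bubble R) = bubble C.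
Proof. by rewrite /bubble rmorphM rmorphB /= map_polyX rmorph1. Qed.

Lemma bubble_ge0 (x : R) : 0 <= x <= 1 -> 0 <= (bubble R).[x] <= 1.
Proof. by rewrite /bubble !hornerE => /andP[x0 x1]; apply/andP; split; nra. Qed.

Lemma integ_bubble_conjp_eq0 P : integ (bubble C * (P * conjp P)) = 0 -> P = 0.
Proof.
rewrite mul_conjp -bubble_map -rmorphM integ_map => -[] h.
have /eqP : bubble R * sqmod P = 0.
  apply: integ_eq0 h => x x01; rewrite hornerM mulr_ge0 ?sqmod_ge0 //.
  by case/andP: (bubble_ge0 x01).
by rewrite mulf_eq0 (negbTE (bubble_neq0 _)) => /eqP/sqmod_eq0.
Qed.

(** Cauchy-Schwarz against a real weight between 0 and 1. *)
Lemma sqr_integ_le P V : (forall x, 0 <= x <= 1 -> 0 <= V.[x] <= 1) ->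
  modulus (integ (P * RC V)) ^+ 2 <= energy P.
Proof.
move=> hV; have real (A : {poly R}) : integ (A * V) ^+ 2 <= integ (A ^+ 2).
  set a := integ (A * V).
  have h1 : 0 <= integ ((A - a *: V) ^+ 2).
    by apply: integ_ge0 => x _; rewrite !hornerE sqr_ge0.
  have h2 : integ (V ^+ 2) <= 1.
    have -> : 1 = integ (1 : {poly R}) by rewrite -(expr0 'X) integXn invr1.
    rewrite -subr_ge0 -integB; apply: integ_ge0 => x /hV/andP[v0 v1].
    by rewrite !hornerE subr_ge0 expr_le1.
  have e : (A - a *: V) ^+ 2 = A ^+ 2 - (2 * a) *: (A * V) + (a ^+ 2) *: V ^+ 2.
    by rewrite -!mul_polyC !rmorphM rmorph_nat /=; ring.
  move: h1; rewrite e integD integB !integZ -/a.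
  have := sqr_ge0 a; nra.
rewrite {1}[P]poly_ReIm mulrDl -scalerAl -!rmorphM integD integZ !integ_map.
rewrite sqr_modulus ReD ImD /= /energy /sqmod integD /=.
by rewrite !(mul0r, mul1r, subr0, add0r, addr0, subrr); apply: lerD; exact: real.
Qed.

Lemma sqr_integ1_le P : modulus (integ P) ^+ 2 <= energy P.
Proof.
rewrite -[P in integ P]mulr1 -(rmorph1 RC); apply: sqr_integ_le => x _.
by rewrite hornerE ler01 lexx.
Qed.

Lemma modulus_integ_energy P : modulus (integ P) <= Num.sqrt (energy P).
Proof.
rewrite -(ler_pXn2r (_ : 0 < 2)%N) ?nnegrE ?modulus_ge0 ?sqrtr_ge0 //.
by rewrite sqr_sqrtr ?energy_ge0 // sqr_integ1_le.
Qed.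

Definition gram d : 'M[C]_d := \matrix_(i, j) integ (bubble C * 'X^(i + j)).

Lemma gram_mul d (a : 'rV[C]_d) j :
  (a *m gram d) 0 j = integ (bubble C * (rVpoly a * 'X^j)).
Proof.
rewrite mxE /rVpoly poly_def mulr_suml mulr_sumr raddf_sum /=; apply: eq_bigr => i _.
rewrite mxE -scalerAl -scalerAr integZ -exprD; congr (_ * _).
by rewrite insubT //= => lt_id; congr (a 0 _); apply: val_inj.
Qed.

Lemma gram_unit d : gram d \in unitmx.
Proof.
rewrite -row_free_unit; apply/row_freeP.
have inj (a : 'rV_d) : a *m gram d = 0 -> a = 0.
  move=> aG; suff : rVpoly a = 0 by move=> e; rewrite -(rVpolyK a) e linear0.
  apply: integ_bubble_conjp_eq0.
  rewrite {2}(_ : rVpoly a = \poly_(i < d) (rVpoly a)`_i); last first.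
    apply/polyP => i; rewrite coef_poly; case: ltnP => // hi.
    by rewrite nth_default // (leq_trans (size_poly _ _)).
  rewrite poly_def /conjp rmorph_sum /= !mulr_sumr raddf_sum big1 //= => i _.
  rewrite -mul_polyC rmorphM /= map_polyC /= map_polyXn.
  have := gram_mul a i; rewrite aG mxE => e.
  by rewrite [rVpoly a * _]mulrCA mul_polyC -!scalerAr integZ -e mulr0.
have : row_free (gram d).
  by rewrite -kermx_eq0; apply/rowV0P => v /sub_kermxP; exact: inj.
by move/row_freeP.
Qed.

(** The moments of a polynomial of bounded degree against t (1 - t) t^j
    determine it, since the weight is positive inside [0, 1]. *)
Lemma gram_solve d (s : nat -> C) : exists2 P : {poly C}, (size P <= d)%N &
  forall j, (j < d)%N -> integ (bubble C * (P * 'X^j)) = s j.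
Proof.
pose a := (\row_(j < d) s j) *m invmx (gram d).
exists (rVpoly a); first exact: size_poly.
move=> j jd; rewrite -(gram_mul a (Ordinal jd)) /a mulmxKV ?gram_unit //.
by rewrite mxE.
Qed.

(** Norms are compared through the inverse Gram matrix, whose entries depend on
    the degree only. *)
Lemma gram_bound d : exists2 K : R, 0 <= K & forall P (e : R), (size P <= d)%N ->
  (forall j, (j < d)%N -> modulus (integ (bubble C * (P * 'X^j))) <= e) ->
  tail 0 P <= K * e.
Proof.
exists (\sum_i \sum_j modulus (invmx (gram d) j i)).
  by apply: sumr_ge0 => i _; apply: sumr_ge0 => j _; exact: modulus_ge0.
move=> P e sP hP; pose a := poly_rV P : 'rV[C]_d.
have Pa : rVpoly a = P by rewrite poly_rV_K.
rewrite (tail_widen 0 sP) big_mkord mulr_suml; apply: ler_sum => i _.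
have -> : P`_i = a 0 i by rewrite mxE.
rewrite -[a](mulmxK (gram_unit d)) mxE mulr_suml; apply: (le_trans (modulus_sum _ _ _)).
apply: ler_sum => j _; rewrite modulusM mulrC ler_wpM2l ?modulus_ge0 //.
by rewrite gram_mul Pa hP.
Qed.

End L2.


(** * Estimates on a single cell *)

Section Cell.
Variable R : realType.
Local Notation C := R[i].
Local Notation RC := (map_poly (real_complex R)).
Implicit Types (P Q : {poly C}) (d n : nat).

Lemma tail_le_deriv n P : tail n.+1 P <= tail n P^`().
Proof.
rewrite (@tail_widen _ n _ (size P).-1); last exact: size_poly.
have [->|P0] := eqVneq P 0.
  by rewrite tail_gt_size ?size_poly0 // big_geq.
rewrite /tail -(@prednK (size P)) ?size_poly_gt0 // big_add1 /=.
rewrite !big_nat; apply: ler_sum => i _.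
rewrite coef_deriv -[_ *+ _]mulr_natl modulusM modulus_nat.
by rewrite ler_peMl ?modulus_ge0 // ler1n.
Qed.

Lemma tail_bubble : tail 0 (bubble C) <= 2.
Proof.
have -> : bubble C = 'X - 'X^2 by rewrite /bubble mulrBr mulr1 expr2.
have h1 := tailXn R 0 1; have h2 := tailXn R 0 2; rewrite expr1 in h1.
by apply: (le_trans (tailB _ _ _)); lra.
Qed.

Lemma tail_mulXn P n : tail 0 (P * 'X^n) <= tail 0 P.
Proof.
apply: (le_trans (tailM _ _)).
by rewrite ler_piMr ?tail_ge0 // tailXn.
Qed.

Lemma modulus_integ_bubble P n :
  modulus (integ (bubble C * (P * 'X^n))) <= 2 * tail 0 P.
Proof.
apply: (le_trans (modulus_integ _)); apply: (le_trans (tailM _ _)).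
by apply: ler_pM; rewrite ?tail_ge0 ?tail_bubble ?tail_mulXn.
Qed.

Lemma size_deriv_le P d : (size P <= d)%N -> (size P^`() <= d.-1)%N.
Proof. by move=> h; apply: (leq_trans (size_poly _ _)); case: (size P) h => //= n; case: d. Qed.

Lemma tail_take n P : tail n (P - take_poly n P) = tail n P /\
  tail 0 (P - take_poly n P) = tail n P.
Proof.
have cf i : (P - take_poly n P)`_i = if (i < n)%N then 0 else P`_i.
  by rewrite coefB coef_take_poly; case: ifP => _; rewrite ?subrr ?subr0.
have sz : (size (P - take_poly n P)%R <= maxn n (size P))%N.
  apply: (leq_trans (size_polyD _ _)); rewrite size_polyN geq_max leq_maxr /=.
  by apply: (leq_trans (size_take_poly _ _)); rewrite leq_maxl.
have e : tail n (P - take_poly n P) = tail n P.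
  rewrite (tail_widen n sz) (@tail_widen _ n P (maxn n (size P))) ?leq_maxr //.
  by rewrite !big_nat; apply: eq_bigr => i /andP[ni _]; rewrite cf ltnNge ni.
split => //; rewrite -e (tail_widen 0 sz) (tail_widen n sz).
rewrite (big_cat_nat (leq0n n) (leq_maxl _ _)) /= big_nat big1 ?add0r // => i /andP[_ ni].
by rewrite cf ni modulus0.
Qed.

(** A polynomial solving a second-order equation P'' = beta P' + gamma P up to
    a residual that is small against all bubbles has small high-order
    coefficients.  The weighted projection onto degree d - 2 fixes P'' and the
    first n terms of the right-hand side, so only the terms of index at
    least n are aliased; hence tails are controlled by tails. *)
Lemma tail_recursion d : exists2 K : R, 0 <= K &
  forall (beta gamma : C) P (e : R), 0 <= e -> (size P <= d.+1)%N ->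
  (forall j, (j < d.-1)%N -> modulus (integ (bubble C *
      ((P^`()^`() - (beta *: P^`() + gamma *: P)) * 'X^j))) <= e) ->
  forall n, tail n.+2 P <=
    K * (modulus beta * tail n.+1 P + modulus gamma * tail n P + e).
Proof.
have [K K0 hK] := gram_bound R d.-1; exists (K * 2 * d.+1%:R).
  by rewrite !mulr_ge0.
move=> beta gamma P e e0 sP hP n.
set a := modulus beta * _; set b := modulus gamma * _.
have a0 : 0 <= a by rewrite mulr_ge0 ?modulus_ge0 ?tail_ge0.
have b0 : 0 <= b by rewrite mulr_ge0 ?modulus_ge0 ?tail_ge0.
have [nd|nd] := ltnP n d.-1; last first.
  rewrite tail_gt_size; first by rewrite mulr_ge0 ?addr_ge0 // !mulr_ge0.
  by apply: (leq_trans sP); move: nd; case: d {hK sP hP}.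
set f := beta *: P^`() + gamma *: P; set g := f - take_poly n f.
set r := P^`()^`() - take_poly n f.
have sr : (size r <= d.-1)%N.
  apply: (leq_trans (size_polyD _ _)); rewrite size_polyN geq_max; apply/andP; split.
    exact: (size_deriv_le (size_deriv_le sP)).
  by apply: (leq_trans (size_take_poly _ _)); rewrite ltnW.
have tg : tail 0 g = tail n f by case: (tail_take n f).
have tf : tail n f <= d.+1%:R * (a + b).
  apply: (le_trans (tailD _ _ _)); rewrite !tailZ mulrDr lerD //.
    rewrite /a mulrCA ler_wpM2l ?modulus_ge0 //; apply: (le_trans (tail_deriv _ _)).
    by rewrite ler_wpM2r ?tail_ge0 // ler_nat.
  by rewrite -/b ler_peMl // ler1n.
have tr : tail 0 r <= K * (e + 2 * tail n f).
  apply: (hK _ _ sr) => j jd.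
  have -> : r * 'X^j = (P^`()^`() - f) * 'X^j + g * 'X^j by rewrite /r /g; ring.
  rewrite mulrDr integD; apply: (le_trans (modulusD _ _)); apply: lerD; first exact: hP.
  by rewrite -tg modulus_integ_bubble.
have tP : tail n.+2 P <= tail 0 r.
  apply: (@le_trans _ _ (tail n P^`()^`())).
    by apply: (le_trans (tail_le_deriv _ _)); exact: tail_le_deriv.
  apply: (@le_trans _ _ (tail n r)); last exact: tail_anti.
  rewrite (tail_widen n (_ : (_ <= d.-1)%N)) ?(tail_widen n sr); last first.
    exact: (size_deriv_le (size_deriv_le sP)).
  rewrite le_eqVlt; apply/orP; left; apply/eqP.
  rewrite !big_nat; apply: eq_bigr => i /andP[ni _].
  by rewrite /r coefB coef_take_poly ltnNge ni subr0.
apply: (le_trans tP); apply: (le_trans tr).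
rewrite -!mulrA ler_wpM2l //.
have : 1 <= d.+1%:R :> R by rewrite ler1n.
by move: tf; nra.
Qed.

Lemma integ_bubble_energy P n :
  modulus (integ (bubble C * (P * 'X^n))) <= Num.sqrt (energy P).
Proof.
rewrite -(ler_pXn2r (_ : 0 < 2)%N) ?nnegrE ?modulus_ge0 ?sqrtr_ge0 //.
rewrite sqr_sqrtr ?energy_ge0 // mulrCA.
have -> : bubble C * 'X^n = RC (bubble R * 'X^n).
  by rewrite rmorphM /= bubble_map map_polyXn.
apply: sqr_integ_le => x x01; have /andP[b0 b1] := bubble_ge0 x01.
rewrite hornerM hornerXn; case/andP: x01 => x0 x1.
by rewrite mulr_ge0 ?exprn_ge0 // mulr_ile1 ?exprn_ge0 ?exprn_ile1.
Qed.

(** An inverse inequality: coefficients are bounded through the Gram matrix by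
    weighted moments, and these by the L2 norm. *)
Lemma tail_deriv_energy d : exists2 K : R, 0 <= K &
  forall P, (size P <= d.+1)%N -> tail 0 P^`() <= K * Num.sqrt (energy P^`()).
Proof.
have [K K0 hK] := gram_bound R d; exists K => // P sP.
by apply: hK => [|j _]; [exact: (size_deriv_le sP)|exact: integ_bubble_energy].
Qed.

Definition lin (a0 a1 : C) : {poly C} := a0%:P * (1 - 'X) + a1%:P * 'X.

Lemma lin0 a0 a1 : (lin a0 a1).[0] = a0.
Proof. by rewrite /lin !hornerE; ring. Qed.
Lemma lin1 a0 a1 : (lin a0 a1).[1] = a1.
Proof. by rewrite /lin !hornerE; ring. Qed.

Lemma linE a0 a1 : lin a0 a1 = a0%:P + (a1 - a0) *: 'X.
Proof. by rewrite /lin -mul_polyC polyCB; ring. Qed.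

Lemma size_lin a0 a1 : (size (lin a0 a1) <= 2)%N.
Proof.
rewrite linE; apply: (leq_trans (size_polyD _ _)); rewrite geq_max.
rewrite (leq_trans (size_polyC_leq1 _)) //=.
by apply: (leq_trans (size_scale_leq _ _)); rewrite size_polyX.
Qed.

Lemma deriv_lin a0 a1 : (lin a0 a1)^`() = (a1 - a0)%:P.
Proof. by rewrite linE derivD derivC derivZ derivX add0r alg_polyC. Qed.

Lemma tail1_lin a0 a1 : tail 1 (lin a0 a1) <= modulus (a1 - a0).
Proof.
rewrite linE; apply: (le_trans (tailD _ _ _)).
rewrite tail_gt_size ?size_polyC_leq1 // add0r tailZ.
have := tailXn R 1 1; rewrite expr1 => /ler_piMr; apply; exact: modulus_ge0.
Qed.

Lemma tail_lin a0 a1 : tail 0 (lin a0 a1) <= 2 * modulus a0 + modulus a1.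
Proof.
rewrite linE; apply: (le_trans (tailD _ _ _)); rewrite tail0C tailZ.
have h1 := modulusB a1 a0; have h2 := tailXn R 0 1; rewrite expr1 in h2.
have := modulus_ge0 (a1 - a0); have := tail_ge0 0 ('X : {poly C}).
by have := modulus_ge0 a0; have := modulus_ge0 a1; nra.
Qed.

Lemma lin_decomp d P : (0 < d)%N -> (size P <= d.+1)%N ->
  exists2 r, P = lin P.[0] P.[1] + bubble C * r & (size r <= d.-1)%N.
Proof.
move=> d0 sP.
have [||r e sr] := @bubble_factor _ (P - lin P.[0] P.[1]).
- by rewrite hornerD hornerN lin0 subrr.
- by rewrite hornerD hornerN lin1 subrr.
exists r; first by rewrite -e addrC subrK.
apply: (leq_trans sr); have : (size (P - lin P.[0] P.[1])%R <= d.+1)%N.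
  apply: (leq_trans (size_polyD _ _)); rewrite size_polyN geq_max sP.
  by rewrite (leq_trans (size_lin _ _)).
by case: (size _) => //= -[|] //=; case: d d0 {sP}.
Qed.

(** Subtracting the affine interpolant leaves a multiple of the bubble, whose
    cofactor of degree d - 2 is determined by its weighted moments. *)
Lemma interp_exists d (a0 a1 : C) (s : nat -> C) : (0 < d)%N ->
  exists P, [/\ (size P <= d.+1)%N, P.[0] = a0, P.[1] = a1 &
    forall j, (j < d.-1)%N -> integ (P * 'X^j) = s j].
Proof.
move=> d0; have [r sr hr] := gram_solve d.-1 (fun j => s j - integ (lin a0 a1 * 'X^j)).
exists (lin a0 a1 + bubble C * r); split.
- apply: (leq_trans (size_polyD _ _)); rewrite geq_max (leq_trans (size_lin _ _)) //=.
  have [->|r0] := eqVneq r 0; first by rewrite mulr0 size_poly0.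
  rewrite size_mul ?bubble_neq0 // size_bubble /= !ltnS.
  by case: d d0 sr {hr} => //= d _; rewrite ltnS.
- by rewrite hornerD hornerM bubble0 mul0r addr0 lin0.
- by rewrite hornerD hornerM bubble1 mul0r addr0 lin1.
- by move=> j jd; rewrite mulrDl integD -mulrA hr // addrC subrK.
Qed.

(** Stability of the interpolation of interp_exists, uniformly in the cell. *)
Lemma interp_bound d : (0 < d)%N -> exists2 K : R, 0 <= K &
  forall P (e : R), 0 <= e -> (size P <= d.+1)%N ->
  modulus P.[0] <= e -> modulus P.[1] <= e ->
  (forall j, (j < d.-1)%N -> modulus (integ (P * 'X^j)) <= e) -> tail 0 P <= K * e.
Proof.
move=> d0; have [K K0 hK] := gram_bound R d.-1; exists (3 + 2 * (K * 4)).
  by rewrite addr_ge0 ?mulr_ge0.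
move=> P e e0 sP p0 p1 hP; have [r er sr] := lin_decomp d0 sP.
have tl : tail 0 (lin P.[0] P.[1]) <= 3 * e by apply: (le_trans (tail_lin _ _)); lra.
have tr : tail 0 r <= K * (4 * e).
  apply: hK => // j jd.
  have -> : bubble C * (r * 'X^j) = P * 'X^j - lin P.[0] P.[1] * 'X^j.
    by rewrite {1}er; ring.
  rewrite integB; apply: (le_trans (modulusB _ _)).
  rewrite (_ : 4 * e = e + 3 * e); last by ring.
  apply: lerD; first exact: hP.
  apply: (le_trans (modulus_integ _)); apply: (le_trans _ tl); exact: tail_mulXn.
rewrite er; apply: (le_trans (tailD _ _ _)); rewrite mulrDl lerD //.
apply: (le_trans (tailM _ _)).
rewrite -mulrA ler_pM ?tail_ge0 ?tail_bubble // -mulrA //.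
Qed.

End Cell.


(** * Discrete Green functions *)

Section Fredholm.
Variables (F : fieldType) (M : nat).
Local Open Scope classical_set_scope.
Implicit Types (S : 'rV[F]_M -> Prop).

Definition subspace S :=
  S 0 /\ forall a x y, S x -> S y -> S (a *: x + y).

Lemma subspace_mx S : subspace S ->
  exists A : 'M[F]_M, forall v, S v <-> (v <= A)%MS.
Proof.
move=> [S0 Slin].
pose Q r := `[< exists A : 'M[F]_M, \rank A = r /\ forall v, (v <= A)%MS -> S v >].
have Q0 : exists r, Q r.
  by exists 0%N; apply/asboolP; exists 0; split; [rewrite mxrank0|move=> v; rewrite submx0 => /eqP ->].
have QM r : Q r -> (r <= M)%N by move=> /asboolP[A [<- _]]; exact: rank_leq_row.
case: (ex_maxnP Q0 QM) => r /asboolP[A [rA AS]] maxr.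
exists A => v; split; last exact: AS.
move=> Sv; have rAv : (\rank (A + v)%MS <= r)%N.
  apply: maxr; apply/asboolP; exists (A + v)%MS; split => // w /sub_addsmxP[[u1 u2] /= ->].
  rewrite addrC (_ : u2 *m v = u2 0 0 *: v); first by apply: Slin => //; apply: AS; rewrite submxMl.
  by rewrite [u2 in LHS]mx11_scalar mul_scalar_mx.
have : (A + v <= A)%MS.
  by have [h1 h2] := mxrank_leqif_sup (addsmxSl A v); rewrite -h2 eqn_leq h1 rA.
by apply: submx_trans; exact: addsmxSr.
Qed.

Lemma linear_mulmx (f : 'rV[F]_M -> F) (u : 'rV_M) (A : 'M[F]_M) :
  (forall a x y, f (a *: x + y) = a * f x + f y) ->
  f (u *m A) = \sum_i u 0 i * f (row i A).
Proof.
move=> flin; have f0 : f 0 = 0.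
  by have := flin 1 0 0; rewrite scaler0 addr0 mul1r => /eqP; rewrite -subr_eq0 opprD addNKr oppr_eq0 => /eqP.
have fD x y : f (x + y) = f x + f y by rewrite -{1}[x]scale1r flin mul1r.
rewrite mulmx_sum_row (big_morph f fD f0); apply: eq_bigr => i _.
by rewrite -[_ *: _]addr0 flin f0 addr0.
Qed.

(** Solvability of the finite-dimensional problem B(w, v) = l(w): the
    functional only has to vanish on the kernel of the form. *)
Lemma fredholm S (B : 'rV[F]_M -> 'rV[F]_M -> F) (l : 'rV[F]_M -> F) :
  subspace S ->
  (forall a x y z, B (a *: x + y) z = a * B x z + B y z) ->
  (forall a x y z, B z (a *: x + y) = a * B z x + B z y) ->
  (forall a x y, l (a *: x + y) = a * l x + l y) ->
  (forall w, S w -> (forall v, S v -> B w v = 0) -> l w = 0) ->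
  exists2 v, S v & forall w, S w -> B w v = l w.
Proof.
move=> /subspace_mx[A SA] Bl Br ll ker.
pose G : 'M[F]_M := \matrix_(i, j) B (row j A) (row i A).
pose lv : 'rV[F]_M := \row_j l (row j A).
have /submxP[z lz] : (lv <= G)%MS.
  rewrite submxE; apply/eqP/matrixP => i j; rewrite ord1 mxE [RHS]mxE.
  pose w : 'rV_M := (col j (cokermx G))^T.
  have lw : l (w *m A) = \sum_k lv 0 k * cokermx G k j.
    by rewrite linear_mulmx //; apply: eq_bigr => k _; rewrite !mxE mulrC.
  rewrite -lw; apply: ker; first by apply/SA; rewrite submxMl.
  move=> v /SA/submxP[y ->]; rewrite linear_mulmx //; apply: big1 => k _.
  rewrite (@linear_mulmx (B^~ _)) // (_ : \sum_i0 _ = (G *m cokermx G) k j).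
    by rewrite mulmx_coker mxE mulr0.
  by rewrite mxE; apply: eq_bigr => s _; rewrite !mxE mulrC.
exists (z *m A); first by apply/SA; rewrite submxMl.
move=> w /SA/submxP[y ->]; rewrite (@linear_mulmx (B^~ _)) // linear_mulmx //.
apply: eq_bigr => k _; congr (_ * _); rewrite linear_mulmx //.
transitivity (lv 0 k); last by rewrite mxE.
by rewrite lz mxE; apply: eq_bigr => s _; rewrite !mxE.
Qed.

End Fredholm.

Section Conforming.
Variable R : realType.
Local Notation C := R[i].
Local Notation RC := (map_poly (real_complex R)).
Implicit Types (P Q v : nat -> {poly C}) (deg : nat -> nat) (N : nat).

(** Continuous piecewise polynomials vanishing at both ends, given on each of N
    cells in the local coordinate of the cell. *)
Definition conforming N deg P : Prop :=
  [/\ forall K, (K < N)%N -> (size (P K) <= (deg K).+1)%N,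
      (P 0%N).[0] = 0, (P N.-1).[1] = 0 &
      forall K, (K.+1 < N)%N -> (P K).[1] = (P K.+1).[0]].

(** The part of the sesquilinear form carried by a cell of width h, without the
    conjugation of the test function, so that it is bilinear.  The derivatives
    are with respect to the local coordinate. *)
Definition cellform (h b : R) (c : C) (p q : {poly C}) : C :=
  (h^-1%:C)%C * integ (p^`() * q^`()) + (b%:C)%C * integ (p^`() * q)
  + (h%:C)%C * c * integ (p * q).

Definition formh N h b c P Q : C := \sum_(K < N) cellform h b c (P K) (Q K).

Lemma cellform_linl h b c a (p1 p2 q : {poly C}) :
  cellform h b c (a *: p1 + p2) q = a * cellform h b c p1 q + cellform h b c p2 q.
Proof.
rewrite /cellform derivD derivZ !(mulrDl _ _ q) !(mulrDl _ _ q^`()).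
by rewrite -!(@scalerAl C {poly C}) !integD !integZ; ring.
Qed.

Lemma cellform_linr h b c a (p1 p2 q : {poly C}) :
  cellform h b c q (a *: p1 + p2) = a * cellform h b c q p1 + cellform h b c q p2.
Proof.
rewrite /cellform derivD derivZ !(mulrDr q) !(mulrDr q^`()).
by rewrite -!(@scalerAr C {poly C}) !integD !integZ; ring.
Qed.

Lemma cellform0l h b c q : cellform h b c 0 q = 0.
Proof. by have := cellform_linl h b c (-1) 0 0 q; rewrite scaler0 addr0 mulN1r addNr. Qed.

Lemma conjp_deriv (p : {poly C}) : (conjp p)^`() = conjp p^`().
Proof. by rewrite /conjp deriv_map. Qed.

Lemma conjp0 (p : {poly C}) : (conjp p).[0] = (p.[0]^*)%C.
Proof. by rewrite -{1}(rmorph0 (@conjc R)) /conjp horner_map. Qed.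
Lemma conjp1 (p : {poly C}) : (conjp p).[1] = (p.[1]^*)%C.
Proof. by rewrite -{1}(rmorph1 (@conjc R)) /conjp horner_map. Qed.

Lemma size_conjp (p : {poly C}) : size (conjp p) = size p.
Proof. exact: size_map_poly. Qed.

Lemma conjpK (p : {poly C}) : conjp (conjp p) = p.
Proof. by apply/polyP => i; rewrite /conjp !coef_map /= conjcK. Qed.

Lemma tail_conjp n (p : {poly C}) : tail n (conjp p) = tail n p.
Proof.
rewrite /tail size_conjp; apply: eq_bigr => i _.
by rewrite (coef_map conjc) modulus_conj.
Qed.


Lemma conforming_conj N deg P :
  conforming N deg P -> conforming N deg (fun K => conjp (P K)).
Proof.
case=> h1 h2 h3 h4; split.
- by move=> K /h1; rewrite size_conjp.
- by rewrite conjp0 h2 conjc0.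
- by rewrite conjp1 h3 conjc0.
- by move=> K /h4 e; rewrite conjp0 conjp1 e.
Qed.

Lemma Re_integ_conj (p : {poly C}) :
  complex.Re (integ ((conjp p)^`() * p)) =
  (modulus p.[1] ^+ 2 - modulus p.[0] ^+ 2) / 2.
Proof.
have h1 := integ_by_parts (conjp p) p.
have h2 : integ (conjp p * p^`()) = ((integ ((conjp p)^`() * p))^*)%C.
  rewrite -(integ_map conjc) rmorphM /= -/(conjp _) -/(conjp p).
  by rewrite -conjp_deriv conjpK mulrC.
have sq (z : C) : complex.Re ((z^*)%C * z) = modulus z ^+ 2.
  by rewrite sqr_modulus; case: z => a b /=; ring.
move: h1; rewrite h2 conjp1 conjp0.
move=> /(congr1 (@complex.Re R)); rewrite !ReD !ReN !sq.
by case: (integ _) => a b /=; lra.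
Qed.

Lemma telescope_cells (V : zmodType) N P (f : C -> V) : (0 < N)%N ->
  (forall K, (K.+1 < N)%N -> (P K).[1] = (P K.+1).[0]) ->
  \sum_(K < N) (f (P K).[1] - f (P K).[0]) = f (P N.-1).[1] - f (P 0%N).[0].
Proof.
case: N => // N _ cont; elim: N cont => [|N IH] cont; first by rewrite big_ord1.
rewrite big_ord_recr /= IH; last by move=> K KN; apply: cont; rewrite ltnS ltnW.
by rewrite /= cont // addrC addrA subrK.
Qed.

(** Coercivity: the first-order term is skew-symmetric up to boundary values, so
    the real part of the form dominates the energy of the derivative. *)
Lemma coercive N deg h b c P : (0 < N)%N -> 0 < h -> 0 < complex.Re c ->
  conforming N deg P ->
  h^-1 * \sum_(K < N) energy (P K)^`() <=
  complex.Re (formh N h b c (fun K => conjp (P K)) P).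
Proof.
move=> N0 h0 c0 [_ P0 P1 Pc]; rewrite /formh Re_sum.
have e K : complex.Re (cellform h b c (conjp (P K)) (P K)) =
   h^-1 * energy (P K)^`() + b / 2 * (modulus (P K).[1] ^+ 2 - modulus (P K).[0] ^+ 2)
   + h * complex.Re c * energy (P K).
  rewrite /cellform !ReD -!mulrA !Re_scale Re_integ_conj.
  rewrite conjp_deriv ![conjp _ * _]mulrC !integ_mul_conjp /=.
  by case: c c0 => c1 c2 _ /=; rewrite !mulr0 subr0; ring.
rewrite (eq_bigr _ (fun (K : 'I_N) _ => e K)).
rewrite !big_split /= -!mulr_sumr (@telescope_cells _ N P (fun z => modulus z ^+ 2)) //.
rewrite P0 P1 modulus0 subrr mulr0 addr0 lerDl.
by rewrite mulr_ge0 ?sumr_ge0 // => [|K _]; [rewrite mulr_ge0 // ltW|exact: energy_ge0].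
Qed.

Lemma eq_conforming N deg P Q : (0 < N)%N -> (forall K, (K < N)%N -> P K = Q K) ->
  conforming N deg P -> conforming N deg Q.
Proof.
move=> N0 e [h1 h2 h3 h4]; split.
- by move=> K KN; rewrite -e // h1.
- by rewrite -e.
- by rewrite -e // prednK.
- by move=> K KN; rewrite -!e ?h4 // ltnW.
Qed.

Lemma conforming_lin N deg a P Q : conforming N deg P -> conforming N deg Q ->
  conforming N deg (fun K => a *: P K + Q K).
Proof.
case=> h1 h2 h3 h4 [g1 g2 g3 g4]; split.
- move=> K KN; apply: (leq_trans (size_polyD _ _)); rewrite geq_max g1 // andbT.
  by apply: (leq_trans (size_scale_leq _ _)); exact: h1.
- by rewrite !hornerE h2 g2 mulr0 addr0.
- by rewrite !hornerE h3 g3 mulr0 addr0.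
- by move=> K KN; rewrite !hornerE h4 // g4.
Qed.

Lemma energy_deriv_eq0 (p : {poly C}) : energy p^`() = 0 -> p = p.[0]%:P.
Proof.
move=> e0; have [K _ hK] := tail_deriv_energy R (size p).
have t1 : tail 1 p = 0.
  apply/eqP; rewrite eq_le tail_ge0 andbT; apply: (le_trans (tail_le_deriv _ _)).
  by apply: (le_trans (hK p (leqnSn _))); rewrite e0 sqrtr0 mulr0.
apply/polyP => i; rewrite coefC; case: i => [|i] /=; first by rewrite horner_coef0.
apply: ComplexField.Normc.eq0_normc; apply/eqP; rewrite eq_le modulus_ge0 andbT.
by rewrite -t1 tail_coef.
Qed.

(** Coercivity excludes a nonzero w with B(w, v) = 0 for all v: it may be applied
    with v the conjugate of w.  Piecewise polynomials are encoded as row vectors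
    of coefficients. *)
Lemma green_exists N deg k h b c :
  (0 < N)%N -> 0 < h -> 0 < complex.Re c ->
  (forall K, (K < N)%N -> (deg K <= k)%N) ->
  exists2 v, conforming N deg v &
    forall P, conforming N deg P -> formh N h b c P v = (P N.-1).[0].
Proof.
move=> N0 h0 c0 dk.
pose dec (x : 'rV[C]_(N * k.+1)) (K : nat) : {poly C} :=
  if insub K is Some i then rVpoly (row i (vec_mx x)) else 0.
pose enc P : 'rV[C]_(N * k.+1) := mxvec (\matrix_(i < N, j < k.+1) (P i)`_j).
have decK P K : (K < N)%N -> (size (P K) <= k.+1)%N -> dec (enc P) K = P K.
  move=> KN sP; rewrite /dec insubT /enc mxvecK; apply/polyP => j.
  rewrite coef_rVpoly; case: insubP => [i ji <-|]; first by rewrite !mxE.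
  by rewrite -leqNgt => /(leq_trans sP) ?; rewrite nth_default.
have dec_lin a x y K : dec (a *: x + y) K = a *: dec x K + dec y K.
  by rewrite /dec; case: insubP => [i _ _|_]; rewrite ?linearP // scaler0 addr0.
have conf_enc P : conforming N deg P -> conforming N deg (dec (enc P)).
  move=> cP; apply: (eq_conforming _ _ cP) => // K KN; rewrite decK //.
  by case: cP => sP _ _ _; apply: (leq_trans (sP _ KN)); rewrite ltnS dk.
have form_enc P v : conforming N deg P -> formh N h b c (dec (enc P)) v = formh N h b c P v.
  move=> [sP _ _ _]; apply: eq_bigr => K _; rewrite decK //.
  by apply: (leq_trans (sP _ (ltn_ord K))); rewrite ltnS dk.
have [||||w Sw hw|x Sx hx] := @fredholm _ _ (fun x => conforming N deg (dec x))
   (fun x y => formh N h b c (dec x) (dec y)) (fun x => (dec x N.-1).[0]).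
- split.
    have dec0 K : dec 0 K = 0.
      by rewrite -[0]addr0 -{1}[0](scale0r 0) dec_lin scale0r add0r /dec; case: insubP => // i _ _; rewrite !linear0.
    by split; rewrite ?dec0 ?horner0 // => K _; rewrite !dec0 ?horner0 ?size_poly0.
  move=> a x y Sx Sy; apply: (eq_conforming _ _ (conforming_lin a Sx Sy)) => // K _.
- move=> a x y z; rewrite /formh mulr_sumr -big_split /=; apply: eq_bigr => K _.
  by rewrite dec_lin cellform_linl.
- move=> a x y z; rewrite /formh mulr_sumr -big_split /=; apply: eq_bigr => K _.
  by rewrite dec_lin cellform_linr.
- by move=> a x y; rewrite dec_lin !hornerE.
- have cJ := conforming_conj Sw.
  have cw := hw _ (conf_enc _ cJ).
  have co : h^-1 * \sum_(K < N) energy (conjp (dec w K))^`() <= 0.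
    have := coercive b N0 h0 c0 cJ; congr (_ <= _).
    rewrite -[RHS](congr1 (@complex.Re R) cw) /=; congr complex.Re.
    apply: eq_bigr => K _; rewrite conjpK decK //.
    by case: cJ => sP _ _ _; apply: (leq_trans (sP _ (ltn_ord K))); rewrite ltnS dk.
  have s0 : \sum_(K < N) energy (conjp (dec w K))^`() = 0.
    apply/eqP; rewrite eq_le sumr_ge0 ?andbT; last by move=> K _; exact: energy_ge0.
    by rewrite -(pmulr_rle0 _ (_ : 0 < h^-1)) // invr_gt0.
  have/psumr_eq0P e0 := s0.
  have NN : (N.-1 < N)%N by rewrite prednK.
  have /energy_deriv_eq0 := e0 (fun K _ => energy_ge0 _) (Ordinal NN) isT.
  case: Sw => _ _ w1 _; move/(congr1 (fun p => p.[1])); rewrite hornerC conjp1 conjp0 w1.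
  by rewrite conjc0 => /esym/eqP; rewrite conjc_eq0 => /eqP.
- exists (dec x) => // P cP; rewrite -(form_enc _ _ cP) hx; last exact: conf_enc.
  rewrite decK ?prednK //; case: cP => sP _ _ _.
  by apply: (leq_trans (sP _ _)); rewrite ?ltnS ?dk ?prednK.
Qed.

End Conforming.


(** * Bounds for the discrete Green function of the last interior node *)

Section Green.
Variable R : realType.
Local Notation C := R[i].
Implicit Types (P Q v : nat -> {poly C}) (deg : nat -> nat) (N M : nat).

Lemma sqr_sum_le n (f : nat -> R) :
  (\sum_(i < n) f i) ^+ 2 <= n%:R * \sum_(i < n) f i ^+ 2.
Proof.
elim: n => [|n IH]; first by rewrite !big_ord0 expr0n mul0r.
rewrite !big_ord_recr /=; move: IH; set s := \sum_(i < n) f i; set S := \sum_(i < n) _.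
have [->|n0] := eqVneq n 0%N => IH.
  have s0 : s = 0 by apply/eqP; rewrite -sqrf_eq0 eq_le sqr_ge0 andbT (le_trans IH) ?mul0r.
  have S0 : 0 <= S by apply: sumr_ge0 => i _; exact: sqr_ge0.
  by rewrite s0 add0r mul1r; lra.
have npos : 0 < n%:R :> R by rewrite ltr0n lt0n.
rewrite -(ler_pM2l npos) -natr1; have := sqr_ge0 (s - n%:R * f n).
set x := n%:R in IH npos *; set y := f n; nra.
Qed.

(** The nodal value is the sum of the increments over the cells to its left, and
    each increment is the integral of the derivative over its cell. *)
Lemma node_le M deg P K : conforming M.+1 deg P -> (K <= M)%N ->
  modulus (P K).[0] <= \sum_(j < M.+1) Num.sqrt (energy (P j)^`()).
Proof.
move=> [_ P0 _ Pc] KM; apply: (@le_trans _ _ (\sum_(j < K) Num.sqrt (energy (P j)^`()))).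
  elim: K KM => [|K IH] KM; first by rewrite P0 modulus0 big_ord0.
  rewrite big_ord_recr /= -Pc // -(subrK (P K).[0] (P K).[1]) -integ_deriv addrC.
  apply: (le_trans (modulusD _ _)); rewrite lerD ?IH 1?ltnW //.
  exact: modulus_integ_energy.
rewrite -!(big_mkord xpredT (fun j => Num.sqrt (energy (P j)^`()))).
rewrite [leRHS](big_cat_nat (leq0n K) (leqW KM)) /= lerDl.
by apply: sumr_ge0 => i _; exact: sqrtr_ge0.
Qed.

Lemma tail0E (p : {poly C}) : tail 0 p = modulus p.[0] + tail 1 p.
Proof. by rewrite tail_recl horner_coef0. Qed.

(** For an affine q the leading term only depends on the increment of p.  Over
    several cells with the same slope these increments telescope, so this
    singular term can be removed before taking moduli. *)
Lemma modulus_cellform (h b : R) (c : C) (p q : {poly C}) :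
  0 < h -> q^`()^`() = 0 ->
  modulus (cellform h b c p q - (h^-1%:C)%C * q^`().[0] * (p.[1] - p.[0])) <=
  (`|b| * tail 0 p^`() + h * modulus c * tail 0 p) * tail 0 q.
Proof.
move=> h0 q2; have e : q^`() = (q^`().[0])%:P.
  apply/polyP => -[|i]; rewrite coefC /= ?horner_coef0 //.
  have := congr1 (fun p : {poly C} => p`_i) q2; rewrite coef_deriv coef0 => /eqP.
  by rewrite mulrn_eq0 => /orP[//|/eqP].
move: e; set a := q^`().[0] => e; rewrite /cellform {1}e [p^`() * _]mulrC mul_polyC integZ integ_deriv.
rewrite (_ : _ + _ + _ - _ = (b%:C)%C * integ (p^`() * q) + (h%:C)%C * c * integ (p * q)); last by ring.
apply: (le_trans (modulusD _ _)); rewrite !modulusM !modulus_real (gtr0_norm h0).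
have h1 := le_trans (modulus_integ _) (tailM p^`() q).
have h2 := le_trans (modulus_integ _) (tailM p q).
have := ler_wpM2l (normr_ge0 b) h1.
have := ler_wpM2l (mulr_ge0 (ltW h0) (modulus_ge0 c)) h2; lra.
Qed.

(** Testing with the Green function itself makes it of size h near its pole,
    because the pole is one cell away from the boundary; subtracting the linear
    function with the same value at the pole and testing again propagates this
    bound to the other cells. *)
Lemma green_estimate (k : nat) (L kappa : R) : 0 < L -> 0 <= kappa ->
  exists2 A : R, 0 <= A & forall M deg (h b : R) (c : C) (D : R) v, (0 < M)%N -> 0 < h ->
  M.+1%:R * h = L -> 0 < complex.Re c -> 1 <= D -> `|b| <= kappa * D ->
  modulus c <= kappa * D ^+ 2 ->
  (forall K, (K <= M)%N -> (0 < deg K <= k)%N) -> conforming M.+1 deg v ->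
  (forall P, conforming M.+1 deg P -> formh M.+1 h b c P v = (P M).[0]) ->
  [/\ \sum_(K < M) tail 1 (v K) <= A * D ^+ 2 * h,
      forall K, (K < M)%N -> tail 0 (v K) <= A * D ^+ 2 * h &
      tail 0 (v M) <= A * h].
Proof.
move=> L0 k0; have [K' K0 hK] := tail_deriv_energy R k.
pose A0 := 6 * (1 + K') * (kappa + kappa * L).
have A00 : 0 <= A0 by rewrite /A0 !mulr_ge0 ?addr_ge0 ?mulr_ge0 // ltW.
exists ((1 + K') * (L * A0) + 6 + K'); first by rewrite !addr_ge0 ?mulr_ge0 ?addr_ge0 // ?mulr_ge0 // ltW.
move=> M deg h b c D v M0 h0 hL c0 D1 hb hc hdeg cv green.
have [sv v0 v1 vc] := cv.
have sz K : (K <= M)%N -> (size (v K) <= k.+1)%N.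
  by move=> KM; apply: (leq_trans (sv _ _)); rewrite ?ltnS //; case/andP: (hdeg _ KM).
set x := (v M).[0]; pose tau := Num.sqrt (energy (v M)^`()).
have tau0 : 0 <= tau := sqrtr_ge0 _.
have xtau : modulus x <= tau.
  have := modulus_integ_energy (v M)^`(); rewrite integ_deriv.
  by move: v1; rewrite /= => ->; rewrite sub0r modulusN.
have tauh : tau <= h.
  have /le_trans := coercive b (ltn0Sn M) h0 c0 cv.
  rewrite green; last exact: conforming_conj.
  rewrite conjp0 -/x => /(_ _ (Re_le_modulus _)); rewrite modulus_conj.
  rewrite ler_pdivrMl // big_ord_recr /= => co.
  have : tau ^+ 2 <= h * tau.
    rewrite sqr_sqrtr ?energy_ge0 //; apply: (@le_trans _ _ (h * modulus x)).
      by apply: (le_trans _ co); rewrite lerDr sumr_ge0 // => K _; exact: energy_ge0.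
    by rewrite ler_pM2l.
  have [->|tn0] := eqVneq tau 0; first by move=> _; rewrite ltW.
  by rewrite expr2 ler_pM2r // lt_def tn0.
have xh : modulus x <= h := le_trans xtau tauh.
have Mpos : 0 < M%:R :> R by rewrite ltr0n.
(* the affine function of the mesh with value 1 at the pole *)
pose ell (K : nat) : {poly C} := lin ((K%:R / M%:R)%:C)%C ((K.+1%:R / M%:R)%:C)%C.
pose psi (K : nat) := if (K < M)%N then v K - x *: ell K else 0.
have ell' K : (ell K)^`() = ((M%:R^-1%:C)%C)%:P.
  by rewrite deriv_lin -rmorphB -mulrBl -natr1 addrAC subrr add0r mul1r.
have ell0 K : (ell K).[0] = ((K%:R / M%:R)%:C)%C by rewrite lin0.
have ell1 K : (ell K).[1] = ((K.+1%:R / M%:R)%:C)%C by rewrite lin1.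
have tell K : (K <= M)%N -> tail 0 (ell K) <= 6.
  move=> KM; apply: (le_trans (tail_lin _ _)); rewrite !modulus_real !ger0_norm ?divr_ge0 //.
  have hM : 1 <= M%:R :> R by rewrite ler1n.
  have hKM : K%:R <= M%:R :> R by rewrite ler_nat.
  have -> : 2 * (K%:R / M%:R) + K.+1%:R / M%:R = (3 * K%:R + 1) / M%:R :> R.
    by rewrite -natr1; field; rewrite gt_eqF.
  by rewrite ler_pdivrMr //; lra.
have cpsi : conforming M.+1 deg psi.
  split.
  - rewrite /psi => K KM; case: ifP => _; last by rewrite size_poly0.
    apply: (leq_trans (size_polyD _ _)); rewrite geq_max sv //= size_polyN.
    apply: (leq_trans (size_scale_leq _ _)); apply: (leq_trans (size_lin _ _)).
    by rewrite ltnS; case/andP: (hdeg _ KM).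
  - by rewrite /psi M0 hornerD hornerN hornerZ v0 ell0 mul0r rmorph0 mulr0 subrr.
  - by rewrite /psi ltnn horner0.
  - move=> K; rewrite ltnS => KM; rewrite /psi KM hornerD hornerN hornerZ ell1 vc //.
    have [KM'|MK] := ltnP K.+1 M; first by rewrite hornerD hornerN hornerZ ell0.
    have -> : K.+1 = M by apply/eqP; rewrite eqn_leq KM MK.
    by rewrite horner0 divff ?gt_eqF // rmorph1 mulr1 subrr.
pose sig K := Num.sqrt (energy (psi K)^`()).
have sig0 K : 0 <= sig K by exact: sqrtr_ge0.
pose s1 := \sum_(K < M.+1) sig K.
have s10 : 0 <= s1 by apply: sumr_ge0.
have tpsi' K : (K <= M)%N -> tail 0 (psi K)^`() <= K' * sig K.
  move=> KM; apply: hK; case: cpsi => sp _ _ _; apply: (leq_trans (sp _ _)); rewrite ?ltnS //.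
  by case/andP: (hdeg _ KM).
have sigs K : (K <= M)%N -> sig K <= s1.
  move=> KM; rewrite /s1 (bigD1 (Ordinal (KM : (K < M.+1)%N))) //= lerDl.
  by apply: sumr_ge0.
have tpsi K : (K <= M)%N -> tail 0 (psi K) <= (1 + K') * s1.
  move=> KM; rewrite tail0E mulrDl mul1r lerD ?(node_le cpsi) //.
  apply: (le_trans (tail_le_deriv _ _)); apply: (le_trans (tpsi' _ KM)).
  by rewrite ler_wpM2l // sigs.
have cJ := conforming_conj cpsi.
pose Z := \sum_(K < M.+1) cellform h b c (conjp (psi K)) (ell K).
have eZ : formh M.+1 h b c (fun K => conjp (psi K)) psi = - (x * Z).
  apply/eqP; rewrite -addr_eq0; have := green _ cJ.
  have pM : psi M = 0 by rewrite /psi ltnn.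
  rewrite conjp0 pM horner0 conjc0 => e; apply/eqP; rewrite -[RHS]e.
  rewrite /formh /Z mulr_sumr -big_split /=; apply: eq_bigr => K _.
  rewrite addrC -cellform_linr; have [KM|/negbTE KM] := boolP (K < M)%N.
    by congr cellform; rewrite /psi KM addrC subrK.
  have -> : psi K = 0 by rewrite /psi KM.
  by rewrite /conjp rmorph0 !cellform0l.
(* the singular terms of the cells cancel by telescoping *)
have hZ : modulus Z <= A0 * D ^+ 2 * s1.
  have -> : Z = \sum_(K < M.+1) (cellform h b c (conjp (psi K)) (ell K) -
      (h^-1%:C)%C * (ell K)^`().[0] * ((conjp (psi K)).[1] - (conjp (psi K)).[0])).
    rewrite big_split /= -[LHS]addr0; congr (_ + _); rewrite sumrN -[LHS]oppr0; congr (- _).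
    have -> : \sum_(K < M.+1) (h^-1%:C)%C * (ell K)^`().[0] * ((conjp (psi K)).[1] - (conjp (psi K)).[0]) =
       (h^-1%:C)%C * (M%:R^-1%:C)%C * \sum_(K < M.+1) ((conjp (psi K)).[1] - (conjp (psi K)).[0]).
      by rewrite mulr_sumr; apply: eq_bigr => K _; rewrite ell' hornerC.
    have [_ j0 j1 jc] := cJ; have := @telescope_cells _ _ M.+1 (fun K => conjp (psi K)) id (ltn0Sn M) jc.
    by move=> /= ->; rewrite /= in j1; rewrite j0 j1 subrr mulr0.
  apply: (le_trans (modulus_sum _ _ _)).
  apply: (@le_trans _ _ (\sum_(K < M.+1) 6 * (1 + K') * (`|b| * sig K + modulus c * h * s1))).
    apply: ler_sum => K _; have KM : (K <= M)%N by rewrite -ltnS.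
    apply: (le_trans (modulus_cellform _ _ _ h0 _)); first by rewrite ell' derivC.
    rewrite conjp_deriv !tail_conjp.
    have e1 := ler_wpM2l (normr_ge0 b) (tpsi' _ KM).
    have e2 := ler_wpM2l (mulr_ge0 (ltW h0) (modulus_ge0 c)) (tpsi _ KM).
    have e3 := mulr_ge0 (normr_ge0 b) (sig0 K).
    rewrite -(mulrA 6) mulrC; apply: ler_pM; rewrite ?tail_ge0 ?tell //.
      by rewrite addr_ge0 ?mulr_ge0 ?tail_ge0 ?modulus_ge0 // ltW.
    lra.
  rewrite -mulr_sumr big_split /= -mulr_sumr -/s1 sumr_const card_ord -[_ *+ M.+1]mulr_natl.
  have -> : M.+1%:R * (modulus c * h * s1) = modulus c * L * s1 by rewrite -hL; ring.
  rewrite /A0 -!mulrA ler_pM2l // ler_wpM2l ?addr_ge0 //.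
  have DD : D <= D ^+ 2 by nra.
  have e1 : `|b| <= kappa * D ^+ 2 by apply: (le_trans hb); rewrite ler_wpM2l.
  have e2 := ler_wpM2r s10 e1.
  have e3 := ler_wpM2r (mulr_ge0 (ltW L0) s10) hc; lra.
have hs1 : s1 <= L * h * (A0 * D ^+ 2).
  have co := coercive b (ltn0Sn M) h0 c0 cpsi; rewrite eZ ler_pdivrMl // in co.
  have co2 : \sum_(K < M.+1) energy (psi K)^`() <= h * (h * (A0 * D ^+ 2 * s1)).
    apply: (le_trans co); rewrite ler_pM2l //; apply: (le_trans (Re_le_modulus _)).
    by rewrite modulusN modulusM ler_pM ?modulus_ge0.
  have := sqr_sum_le M.+1 sig; rewrite -/s1.
  have -> : \sum_(i < M.+1) sig i ^+ 2 = \sum_(K < M.+1) energy (psi K)^`().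
    by apply: eq_bigr => K _; rewrite sqr_sqrtr ?energy_ge0.
  move=> /le_trans /(_ (ler_wpM2l (ler0n _ _) co2)).
  rewrite [M.+1%:R * _]mulrA hL (expr2 s1); have [->|sn0] := eqVneq s1 0.
    by move=> _; apply: mulr_ge0; apply: mulr_ge0; rewrite ?sqr_ge0 // ltW.
  rewrite !mulrA ler_pM2r; first by move=> /le_trans; apply; lra.
  by rewrite lt_def sn0.
have D2 : 1 <= D ^+ 2 by rewrite expr_ge1 // (le_trans ler01).
have vpsi K : (K < M)%N -> v K = psi K + x *: ell K by move=> KM; rewrite /psi KM subrK.
have hs2 : (1 + K') * s1 <= (1 + K') * (L * A0) * D ^+ 2 * h.
  by apply: (le_trans (ler_wpM2l (addr_ge0 ler01 K0) hs1)); lra.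
have Dh : h <= D ^+ 2 * h by rewrite ler_peMl // ltW.
split.
- apply: (@le_trans _ _ (\sum_(K < M) (K' * sig K + h * M%:R^-1))).
    apply: ler_sum => K _; rewrite vpsi //; apply: (le_trans (tailD _ _ _)); apply: lerD.
      by apply: (le_trans (tail_le_deriv _ _)); apply: tpsi'; rewrite ltnW.
    rewrite tailZ ler_pM ?modulus_ge0 ?tail_ge0 //; apply: (le_trans (tail1_lin _ _)).
    by rewrite -rmorphB -mulrBl -natr1 addrAC subrr add0r mul1r modulus_real ger0_norm ?invr_ge0.
  rewrite big_split /= -mulr_sumr sumr_const card_ord -[_ *+ M]mulr_natl mulrCA divff ?gt_eqF // mulr1.
  have : \sum_(K < M) sig K <= s1 by rewrite /s1 big_ord_recr /= lerDl.
  move=> /(ler_wpM2l K0); have := mulr_ge0 K0 (ltW h0); nra.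
- move=> K KM; rewrite vpsi //; apply: (le_trans (tailD _ _ _)); rewrite tailZ.
  have e1 := tpsi _ (ltnW KM).
  have e2 := ler_pM (modulus_ge0 x) (tail_ge0 0 (ell K)) xh (tell _ (ltnW KM)).
  have := mulr_ge0 K0 (ltW h0); nra.
- rewrite tail0E -/x; have e1 : tail 1 (v M) <= K' * h.
    apply: (le_trans (tail_le_deriv _ _)); apply: (le_trans (hK _ (sz _ (leqnn _)))).
    by rewrite ler_wpM2l.
  have : 0 <= (1 + K') * (L * A0) * h.
    by rewrite mulr_ge0 ?(ltW h0) // mulr_ge0 ?addr_ge0 // mulr_ge0 ?(ltW L0).
  by lra.
Qed.

End Green.


(** * Superconvergence at the last interior node and the boundary cell *)

Section Core.
Variable R : realType.
Local Notation C := R[i].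
Implicit Types (P Q v chi : nat -> {poly C}) (deg : nat -> nat) (N M : nat).

(** The contribution of a cell to the Galerkin equation of an interpolation
    error with local moments nu. *)
Definition cellload (h b : R) (c : C) (nu : nat -> C) (q : {poly C}) : C :=
  (b%:C)%C * pairing nu q^`() - (h%:C)%C * c * pairing nu q.

Lemma modulus_cellload (h b : R) (c : C) nu (q : {poly C}) (e : R) n : 0 < h ->
  (forall i, (i < n)%N -> nu i = 0) ->
  (forall i, (i < size q)%N -> modulus (nu i) <= e) ->
  modulus (cellload h b c nu q) <=
    e * (`|b| * tail n q^`() + h * modulus c * tail n q).
Proof.
move=> h0 nu0 nue; apply: (le_trans (modulusB _ _)).
rewrite !modulusM !modulus_real (gtr0_norm h0) mulrDr; apply: lerD.
  rewrite mulrCA ler_wpM2l //; apply: modulus_pairing => // i iq; apply: nue.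
  by apply: (leq_trans iq); apply: (leq_trans (size_poly _ _)); exact: leq_pred.
rewrite mulrCA ler_wpM2l ?mulr_ge0 ?modulus_ge0 ?(ltW h0) //.
exact: modulus_pairing.
Qed.

(** Against a function vanishing at both ends of its cell, the form is the strong
    residual of the other argument. *)
Lemma cellform_bubble_l (h b : R) (c : C) (q v : {poly C}) : 0 < h ->
  q.[0] = 0 -> q.[1] = 0 -> (h%:C)%C * cellform h b c q v =
  - integ (q * (v^`()^`() - (((- (h * b))%:C)%C *: v^`() + ((h ^+ 2)%:C)%C * c *: v))).
Proof.
move=> h0 q0 q1; rewrite /cellform !integ_by_parts q0 q1 !mul0r !subrr !sub0r.
rewrite !(mulrBr q) !(mulrDr q) -!(@scalerAr C {poly C}) integB integD !integZ.
rewrite rmorphV ?unitfE ?gt_eqF // rmorphN rmorphM rmorphXn /=.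
by field; rewrite fmorph_eq0 gt_eqF.
Qed.

Lemma cellform_bubble_r (h b : R) (c : C) (q v : {poly C}) : 0 < h ->
  q.[0] = 0 -> q.[1] = 0 -> (h%:C)%C * cellform h b c v q =
  - integ (q * (v^`()^`() - (((h * b)%:C)%C *: v^`() + ((h ^+ 2)%:C)%C * c *: v))).
Proof.
move=> h0 q0 q1; rewrite /cellform.
have -> : integ (v^`() * q^`()) = - integ (q * v^`()^`()).
  by rewrite mulrC integ_by_parts q0 q1 !mul0r subrr sub0r.
rewrite ![_ * q]mulrC !(mulrBr q) !(mulrDr q) -!(@scalerAr C {poly C}) integB integD !integZ.
rewrite rmorphV ?unitfE ?gt_eqF // rmorphM rmorphXn /=.
by field; rewrite fmorph_eq0 gt_eqF.
Qed.

Definition on_cell (K0 : nat) (q : {poly C}) (K : nat) : {poly C} :=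
  if K == K0 then q else 0.

Lemma conforming_on_cell M deg K0 (q : {poly C}) : (K0 <= M)%N -> (size q <= (deg K0).+1)%N ->
  q.[0] = 0 -> q.[1] = 0 -> conforming M.+1 deg (on_cell K0 q).
Proof.
move=> KM sq q0 q1.
have e0 K : (on_cell K0 q K).[0] = 0 by rewrite /on_cell; case: ifP; rewrite ?horner0.
have e1 K : (on_cell K0 q K).[1] = 0 by rewrite /on_cell; case: ifP; rewrite ?horner0.
by split => // [K _|K _]; rewrite ?e0 ?e1 // /on_cell; case: eqP => [->|_]; rewrite ?size_poly0.
Qed.

Lemma sum_on_cell M K0 q (f : nat -> {poly C} -> C) : (K0 <= M)%N ->
  (forall K, f K 0 = 0) -> \sum_(K < M.+1) f K (on_cell K0 q K) = f K0 q.
Proof.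
move=> KM f0; rewrite (bigD1 (Ordinal (KM : (K0 < M.+1)%N))) //= big1 ?addr0.
  by rewrite /on_cell eqxx.
move=> K /negbTE nK; rewrite /on_cell; case: eqP => // e.
by move: nK; rewrite -val_eqE /= e eqxx.
Qed.

Lemma size_bubble_Xn d j : (j < d.-1)%N -> (size (bubble C * 'X^j)%R <= d.+1)%N.
Proof.
move=> jd; apply: (leq_trans (size_polyMleq _ _)); rewrite size_bubble size_polyXn.
by move: jd; case: d => [|d] //=; rewrite addnS /= !ltnS.
Qed.

Lemma bubbleXn0 j : (bubble C * 'X^j).[0] = 0.
Proof. by rewrite hornerM bubble0 mul0r. Qed.
Lemma bubbleXn1 j : (bubble C * 'X^j).[1] = 0.
Proof. by rewrite hornerM bubble1 mul0r. Qed.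

Lemma tail_recursion_le k : exists2 K : R, 0 <= K &
  forall d (beta gamma : C) (P : {poly C}) (e : R), (d <= k)%N -> 0 <= e -> (size P <= d.+1)%N ->
  (forall j, (j < d.-1)%N -> modulus (integ (bubble C *
      ((P^`()^`() - (beta *: P^`() + gamma *: P)) * 'X^j))) <= e) ->
  forall n, tail n.+2 P <=
    K * (modulus beta * tail n.+1 P + modulus gamma * tail n P + e).
Proof.
elim: k => [|k [K1 K10 h1]].
  have [K K0 hK] := tail_recursion R 0; exists K => // d beta gamma P e.
  by rewrite leqn0 => /eqP ->; exact: hK.
have [K2 K20 h2] := tail_recursion R k.+1; exists (K1 + K2); first exact: addr_ge0.
move=> d beta gamma P e dk e0 sP hP n.
have nn : 0 <= modulus beta * tail n.+1 P + modulus gamma * tail n P + e.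
  by rewrite !addr_ge0 ?mulr_ge0 ?modulus_ge0 ?tail_ge0.
have := mulr_ge0 K10 nn; have := mulr_ge0 K20 nn; rewrite mulrDl.
move: dk; rewrite leq_eqVlt => /orP[/eqP dk|dk].
  by subst d; have := h2 _ _ _ _ e0 sP hP n; lra.
by have := h1 _ _ _ _ _ dk e0 sP hP n; lra.
Qed.

(** A homogeneous solution of the recursion: every index gains a factor d.  The
    constant 2 K kappa + 1 dominates the two previous terms of the recursion. *)
Lemma tail_decay (K kappa d : R) (beta gamma : C) (p : {poly C}) :
  0 <= K -> 0 <= kappa -> 0 <= d ->
  modulus beta <= kappa * d -> modulus gamma <= kappa * d ^+ 2 ->
  (forall n, tail n.+2 p <= K * (modulus beta * tail n.+1 p + modulus gamma * tail n p)) ->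
  forall n, tail n.+1 p <= (2 * (K * kappa) + 1) ^+ n * d ^+ n * (tail 1 p + d * tail 0 p).
Proof.
move=> K0 k0 d0 hb hg rec; set G := 2 * _ + 1; set Y := _ + _.
have Kk := mulr_ge0 K0 k0.
have G1 : 1 <= G by rewrite /G lerDr mulr_ge0.
have t0 := tail_ge0 0 p; have t1 := tail_ge0 1 p.
have Y0 : 0 <= Y by rewrite addr_ge0 ?mulr_ge0.
have step n (x y : R) : 0 <= x -> 0 <= y -> tail n.+1 p <= x -> tail n p <= y ->
   tail n.+2 p <= K * kappa * (d * x + d ^+ 2 * y).
  move=> x0 y0 hx hy; apply: (le_trans (rec n)); rewrite -mulrA ler_wpM2l // mulrDr lerD //.
    by rewrite mulrA ler_pM ?modulus_ge0 ?tail_ge0.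
  by rewrite mulrA ler_pM ?modulus_ge0 ?tail_ge0.
have G0 : 0 <= G by rewrite (le_trans ler01).
suff H n : tail n.+1 p <= G ^+ n * d ^+ n * Y /\ tail n.+2 p <= G ^+ n.+1 * d ^+ n.+1 * Y.
  by move=> n; case: (H n).
elim: n => [|n [IH1 IH2]].
  rewrite !expr0 !mul1r !expr1; split; first by rewrite /Y lerDl mulr_ge0.
  apply: (le_trans (step 0%N _ _ t1 t0 (lexx _) (lexx _))).
  have -> : K * kappa * (d * tail 1 p + d ^+ 2 * tail 0 p) = (K * kappa) * (d * Y) by rewrite /Y; ring.
  rewrite -(mulrA G) ler_wpM2r ?mulr_ge0 // /G; lra.
split => //; have e1 : 0 <= G ^+ n.+1 * d ^+ n.+1 * Y by rewrite !mulr_ge0 ?exprn_ge0.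
have e2 : 0 <= G ^+ n * d ^+ n * Y by rewrite !mulr_ge0 ?exprn_ge0.
apply: (le_trans (step _ _ _ e1 e2 IH2 IH1)).
set W := d ^+ n * Y; have W0 : 0 <= d ^+ 2 * W by rewrite !mulr_ge0 ?exprn_ge0.
have Gn0 : 0 <= G ^+ n by rewrite exprn_ge0.
have -> : K * kappa * (d * (G ^+ n.+1 * d ^+ n.+1 * Y) + d ^+ 2 * (G ^+ n * d ^+ n * Y)) =
  K * kappa * (G + 1) * (G ^+ n * (d ^+ 2 * W)) by rewrite /W !exprS; ring.
have -> : G ^+ n.+2 * d ^+ n.+2 * Y = G * G * (G ^+ n * (d ^+ 2 * W)) by rewrite /W !exprS; ring.
apply: ler_wpM2r; first by rewrite mulr_ge0.
by rewrite /G; nra.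
Qed.

(** The value of the discrete error at the last interior node is the load paired
    with the Green function; since the moments nu vanish up to order m - 2, only
    the coefficients of order at least m - 1 of the Green function enter, and
    these gain the missing powers of h. *)
Lemma nodal_estimate (m k : nat) (L kappa : R) : 0 < L -> 0 <= kappa -> (0 < m)%N ->
  exists2 A : R, 0 <= A &
  forall M deg (h b : R) (c : C) (D : R) chi (nu : nat -> nat -> C) (e : R), 0 < h ->
  M.+1%:R * h = L -> 0 < complex.Re c -> 1 <= D -> `|b| <= kappa * D ->
  modulus c <= kappa * D ^+ 2 ->
  (forall K, (K <= M)%N -> (m <= deg K <= k)%N) -> conforming M.+1 deg chi ->
  0 <= e ->
  (forall K i, (K <= M)%N -> (i < (deg K).-1)%N -> nu K i = 0) ->
  (forall K i, (K <= M)%N -> (i <= k)%N -> modulus (nu K i) <= e) ->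
  (forall psi, conforming M.+1 deg psi ->
     formh M.+1 h b c chi psi = \sum_(K < M.+1) cellload h b c (nu K) (psi K)) ->
  modulus (chi M).[0] <= A * (e * D ^+ (m + 3) * h ^+ m).
Proof.
move=> L0 k0 m0; have [A A0 hA] := green_estimate k L0 k0.
have [G0 G00 hrec] := tail_recursion_le k.
set G := 2 * (G0 * kappa) + 1.
have G1 : 1 <= G by rewrite /G lerDr mulr_ge0 // mulr_ge0.
have Gp : 0 <= G ^+ m.-1 by rewrite exprn_ge0 // (le_trans ler01).
have B0 : 0 <= kappa * k.+2%:R * G ^+ m.-1 * (2 * A * (1 + L)).
  by rewrite !mulr_ge0 // addr_ge0 // ltW.
exists (kappa * k.+2%:R * G ^+ m.-1 * (2 * A * (1 + L))) => //.
move=> M deg h b c D chi nu e h0 hL c0 D1 hb hc hdeg cchi e0 nu0 nue gal.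
have D0 : 0 <= D := le_trans ler01 D1.
have [->|M0] := posnP M.
  by case: cchi => _ -> _ _; rewrite modulus0 (mulr_ge0 B0) // !mulr_ge0 ?exprn_ge0 // ltW.
have hdeg' K : (K <= M)%N -> (0 < deg K <= k)%N.
  by move=> /hdeg /andP[h1 ->]; rewrite (leq_trans m0).
have [v cv green] : exists2 v, conforming M.+1 deg v &
    forall P, conforming M.+1 deg P -> formh M.+1 h b c P v = (P M).[0].
  by apply: (@green_exists _ _ _ k) => // K KM; case/andP: (hdeg _ KM).
have [s1 s0 sl] := hA _ _ _ _ _ _ _ M0 h0 hL c0 D1 hb hc hdeg' cv green.
have [sv _ _ _] := cv.
rewrite -(green _ cchi) gal //.
set d := D * h; have d0 : 0 <= d by rewrite mulr_ge0 // ltW.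
pose Y K := tail 1 (v K) + d * tail 0 (v K).
have Y0 K : 0 <= Y K by apply: addr_ge0; [exact: tail_ge0|apply: mulr_ge0 => //; exact: tail_ge0].
have cb : h * `|b| <= kappa * d by rewrite /d mulrA -[kappa * D * h]mulrC ler_pM2l.
have cc : h ^+ 2 * modulus c <= kappa * d ^+ 2.
  by rewrite exprMn mulrA -[kappa * _ * _]mulrC ler_wpM2l // sqr_ge0.
have hrecv K n : (K <= M)%N -> tail n.+2 (v K) <= G0 * (modulus (((- (h * b))%:C)%C : C) * tail n.+1 (v K)
    + modulus (((h ^+ 2)%:C)%C * c) * tail n (v K)).
  move=> KM; rewrite -[X in _ * X]addr0; apply: (hrec (deg K)) => //; first by case/andP: (hdeg _ KM).
    exact: sv.
  move=> j jd; rewrite mulrA mulrAC.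
  have := @cellform_bubble_l h b c (bubble C * 'X^j) (v K) h0 (bubbleXn0 j) (bubbleXn1 j).
  have /green : conforming M.+1 deg (on_cell K (bubble C * 'X^j)).
    by apply: conforming_on_cell; rewrite ?size_bubble_Xn ?bubbleXn0 ?bubbleXn1.
  rewrite /formh (@sum_on_cell M K _ (fun K p => cellform h b c p (v K))) //; last first.
    by move=> K'; rewrite cellform0l.
  move=> ->; rewrite /on_cell; case: eqP => [<-|_]; rewrite ?bubbleXn0 ?horner0 mulr0 => /eqP;
    by rewrite eq_sym oppr_eq0 => /eqP ->; rewrite modulus0.
have decay K n : (K <= M)%N -> tail n.+1 (v K) <= G ^+ n * d ^+ n * Y K.
  move=> KM; apply: (tail_decay (beta := ((- (h * b))%:C)%C) (gamma := ((h ^+ 2)%:C)%C * c)) => //.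
  - by rewrite modulus_real normrN normrM (gtr0_norm h0).
  - by rewrite modulusM modulus_real ger0_norm ?sqr_ge0.
  - by move=> n'; exact: hrecv.
have cell K : (K <= M)%N -> modulus (cellload h b c (nu K) (v K)) <=
    e * (kappa * D * k.+2%:R * (G ^+ m.-1 * d ^+ m.-1)) * Y K.
  move=> KM; have /andP[mK Kk] := hdeg _ KM.
  apply: (le_trans (modulus_cellload (e := e) (n := m.-1) b c h0 _ _)).
  - by move=> i im; apply: nu0 => //; apply: (leq_trans im); rewrite -!subn1 leq_sub2r.
  - by move=> i iK; apply: nue => //; rewrite -ltnS (leq_trans iK) // (leq_trans (sv _ _)).
  rewrite -(mulrA e) ler_wpM2l //.
  have e1 : tail m.-1 (v K)^`() <= k.+1%:R * (G ^+ m.-1 * d ^+ m.-1 * Y K).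
    apply: (le_trans (tail_deriv _ _)); apply: ler_pM; rewrite ?ler0n ?tail_ge0 ?decay //.
    by rewrite ler_nat (leq_trans (sv _ _)).
  have e2 : h * modulus c * tail m.-1 (v K) <= kappa * D * (G ^+ m.-1 * d ^+ m.-1 * Y K).
    have hc' : h * modulus c <= kappa * D * d.
      rewrite /d (_ : kappa * D * (D * h) = h * (kappa * D ^+ 2)); last by ring.
      by rewrite ler_pM2l.
    case: m m0 {hA hdeg Gp e1 mK nu0 nue gal B0} => // -[|m] _ /=.
      rewrite !expr0 !mul1r; apply: (@le_trans _ _ (kappa * D * d * tail 0 (v K))).
        by rewrite ler_wpM2r ?tail_ge0.
      have yk : d * tail 0 (v K) <= Y K by have := tail_ge0 1 (v K); rewrite /Y; lra.
      by rewrite -(mulrA _ d) ler_wpM2l // mulr_ge0.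
    apply: (@le_trans _ _ (kappa * D * d * (G ^+ m * d ^+ m * Y K))).
      by rewrite ler_pM ?mulr_ge0 ?modulus_ge0 ?tail_ge0 ?decay ?(ltW h0).
    rewrite (_ : G ^+ m.+1 * d ^+ m.+1 * Y K = G * (d * (G ^+ m * d ^+ m * Y K))); last first.
      by rewrite !exprS; ring.
    rewrite -(mulrA _ d) ler_wpM2l ?mulr_ge0 // ler_peMl //.
    by apply: mulr_ge0 => //; apply: mulr_ge0 => //; rewrite mulr_ge0 ?exprn_ge0 // (le_trans ler01).
  have e3 := ler_pM (normr_ge0 b) (tail_ge0 m.-1 _) hb e1.
  apply: (le_trans (lerD e3 e2)); rewrite -[k.+2%:R]natr1 le_eqVlt; apply/orP; left; apply/eqP; ring.
have sumY : \sum_(K < M.+1) Y K <= 2 * A * (1 + L) * (D ^+ 3 * h).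
  have D3 : D ^+ 2 <= D ^+ 3 by rewrite exprS ler_peMl // sqr_ge0.
  have D13 : D <= D ^+ 3 by rewrite -{1}(expr1 D) ler_weXn2l.
  have D03 : 1 <= D ^+ 3 by rewrite (le_trans D1).
  have Ah : 0 <= A * h by rewrite mulr_ge0 // ltW.
  rewrite big_ord_recr /=; have -> : 2 * A * (1 + L) * (D ^+ 3 * h) =
     A * (1 + L) * (D ^+ 3 * h) + A * (1 + L) * (D ^+ 3 * h) by ring.
  apply: lerD.
    rewrite big_split /= -mulr_sumr; apply: (@le_trans _ _ (A * D ^+ 2 * h + d * (M%:R * (A * D ^+ 2 * h)))).
      apply: lerD => //; rewrite ler_wpM2l //.
      apply: (@le_trans _ _ (\sum_(K < M) (A * D ^+ 2 * h))); first by apply: ler_sum => K _; exact: s0.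
      by rewrite sumr_const card_ord -[_ *+ M]mulr_natl.
    have Mh : M%:R * h <= L by rewrite -hL ler_pM2r // ler_nat.
    have -> : A * D ^+ 2 * h + d * (M%:R * (A * D ^+ 2 * h)) =
       (A * h) * (D ^+ 2 + (M%:R * h) * D ^+ 3) by rewrite /d; ring.
    have -> : A * (1 + L) * (D ^+ 3 * h) = (A * h) * (D ^+ 3 + L * D ^+ 3) by ring.
    by rewrite ler_wpM2l // lerD // ler_wpM2r // (le_trans ler01).
  rewrite /Y; have t1 : tail 1 (v M) <= A * h by apply: (le_trans (tail_anti _ (leq0n 1))).
  have e1 := ler_wpM2l d0 sl.
  apply: (le_trans (lerD t1 e1)).
  have hl : h <= L by rewrite -hL ler_peMl ?ler1n // ltW.
  have -> : A * h + d * (A * h) = (A * h) * (1 + D * h) by rewrite /d; ring.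
  have -> : A * (1 + L) * (D ^+ 3 * h) = (A * h) * (D ^+ 3 + D ^+ 3 * L) by ring.
  by rewrite ler_wpM2l // lerD // ler_pM // ltW.
apply: (le_trans (modulus_sum _ _ _)).
apply: (@le_trans _ _ (\sum_(K < M.+1) e * (kappa * D * k.+2%:R * (G ^+ m.-1 * d ^+ m.-1)) * Y K)).
  by apply: ler_sum => K _; apply: cell; rewrite -ltnS.
rewrite -mulr_sumr; apply: (le_trans (ler_wpM2l _ sumY)).
  by rewrite !mulr_ge0 // exprn_ge0.
rewrite le_eqVlt; apply/orP; left; apply/eqP.
have -> : m = m.-1.+1 by rewrite prednK.
by rewrite /d exprMn !exprS exprD !exprS expr0 /=; ring.
Qed.

(** The recursion with a source E which, in contrast to the initial data X,
    gains no factor d. *)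
Lemma decay_with_source (K A1 : R) n : 0 <= K -> 0 <= A1 -> exists2 A : R, 0 <= A &
  forall (t : nat -> R) (d X E : R), 0 <= d <= 1 -> 0 <= X -> 0 <= E ->
  t 0%N <= A1 * (X + E) -> t 1%N <= A1 * (d * X + E) ->
  (forall n, t n.+2 <= K * (d * t n.+1 + d ^+ 2 * t n + E)) ->
  t n <= A * (d ^+ n * X + E).
Proof.
move=> K0 A10.
suff [A hA0 hA] : exists2 A : R, 0 <= A &
  forall (t : nat -> R) (d X E : R), 0 <= d <= 1 -> 0 <= X -> 0 <= E ->
  t 0%N <= A1 * (X + E) -> t 1%N <= A1 * (d * X + E) ->
  (forall n, t n.+2 <= K * (d * t n.+1 + d ^+ 2 * t n + E)) ->
  t n <= A * (d ^+ n * X + E) /\ t n.+1 <= A * (d ^+ n.+1 * X + E).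
  by exists A => // t d X E h1 h2 h3 h4 h5 h6; case: (hA t d X E h1 h2 h3 h4 h5 h6).
elim: n => [|n [A hA0 hA]].
  by exists A1 => // t d X E _ _ _ h1 h2 _; rewrite expr0 mul1r expr1.
exists (A + K * (2 * A + 1)); first by rewrite addr_ge0 ?mulr_ge0 ?addr_ge0 ?mulr_ge0.
move=> t d X E hd X0 E0 h1 h2 rec; have [i1 i2] := hA t d X E hd X0 E0 h1 h2 rec.
have /andP[d0 d1] := hd; set Z := d ^+ n.+2 * X.
have Z0 : 0 <= Z by rewrite mulr_ge0 ?exprn_ge0.
split.
  apply: (le_trans i2); rewrite ler_wpM2r ?lerDl ?mulr_ge0 ?addr_ge0 ?mulr_ge0 ?exprn_ge0 //.
apply: (le_trans (rec n)).
have e1 : d * t n.+1 <= A * (Z + E).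
  apply: (le_trans (ler_wpM2l d0 i2)); rewrite mulrCA ler_wpM2l // mulrDr lerD //.
    by rewrite mulrA -exprS.
  by rewrite ler_piMl.
have e2 : d ^+ 2 * t n <= A * (Z + E).
  apply: (le_trans (ler_wpM2l (sqr_ge0 d) i1)); rewrite mulrCA ler_wpM2l // mulrDr lerD //.
    by rewrite mulrA -exprD.
  by rewrite ler_piMl // expr_le1.
apply: (@le_trans _ _ (K * ((2 * A + 1) * (Z + E)))); first by rewrite ler_wpM2l //; lra.
by rewrite mulrA ler_wpM2r ?addr_ge0 // lerDr.
Qed.

(** On the boundary cell the discrete error is driven by its value chi(0) at the
    interior node and by the local load.  Testing with the conjugate of
    chi minus its affine interpolant bounds its size.  If D h <= 1, the recursion on
    tails then shows that the n-th derivative of the part driven by chi(0)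
    scales like D^(n-1) / h instead of h^(-n); otherwise the bound on the
    size is already sufficient. *)
Lemma boundary_cell_estimate (k n : nat) (L kappa : R) : 0 < L -> 0 <= kappa -> (0 < k)%N ->
  exists2 A : R, 0 <= A &
  forall (h b : R) (c : C) (D : R) (chi : {poly C}) (nu : nat -> C) (e : R), 0 < h ->
  h <= L -> 0 < complex.Re c -> 1 <= D -> `|b| <= kappa * D ->
  modulus c <= kappa * D ^+ 2 -> (size chi <= k.+1)%N -> chi.[1] = 0 -> 0 <= e ->
  (forall i, (i <= k)%N -> modulus (nu i) <= e) ->
  (forall psi : {poly C}, (size psi <= k.+1)%N -> psi.[0] = 0 -> psi.[1] = 0 ->
     cellform h b c chi psi = cellload h b c nu psi) ->
  tail n chi <= A * ((D * h) ^+ n * (Num.max 2 (2 / (D * h)) * D ^+ 2 * modulus chi.[0])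
                     + D ^+ 2 * e).
Proof.
move=> L0 k0 kpos; have [K' K0 hK] := tail_deriv_energy R k.
have [G0 G00 hrec] := tail_recursion_le k.
pose A1 := 2 + K' ^+ 2 * kappa * (L + 2 * L ^+ 2).
have A10 : 0 <= A1 by rewrite addr_ge0 // !mulr_ge0 ?sqr_ge0 // addr_ge0 ?mulr_ge0 ?sqr_ge0 // ltW.
pose G1 := G0 * (kappa + 4 * k.+1%:R * kappa).
have G10 : 0 <= G1 by rewrite mulr_ge0 // addr_ge0 // !mulr_ge0.
have [A2 A20 hA2] := decay_with_source n G10 A10.
exists (A1 + A2); first exact: addr_ge0.
move=> h b c D chi nu e h0 hL c0 D1 hb hc schi chi1 e0 nue gal.
have D0 : 0 <= D := le_trans ler01 D1.
set d := D * h; have d0 : 0 < d by rewrite mulr_gt0 // (lt_le_trans ltr01).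
set x := modulus chi.[0]; have x0 : 0 <= x := modulus_ge0 _.
set Mx := Num.max _ _; have Mx2 : 2 <= Mx by rewrite le_max lexx.
have cb : h * `|b| <= kappa * d by rewrite /d mulrA -[kappa * D * h]mulrC ler_pM2l.
have cc : h ^+ 2 * modulus c <= kappa * d ^+ 2.
  by rewrite exprMn mulrA -[kappa * _ * _]mulrC ler_wpM2l // sqr_ge0.
have D21 : 1 <= D ^+ 2 by rewrite expr_ge1.
have [r er sr] := lin_decomp kpos schi.
set chi0 := bubble C * r in er; rewrite chi1 in er.
have echi0 : chi0 = chi - lin chi.[0] 0 by apply/eqP; rewrite eq_sym subr_eq addrC; apply/eqP.
have schi0 : (size chi0 <= k.+1)%N.
  rewrite echi0; apply: (leq_trans (size_polyD _ _)); rewrite size_polyN geq_max schi.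
  by rewrite (leq_trans (size_lin _ _)).
have c00 : chi0.[0] = 0 by rewrite hornerM bubble0 mul0r.
have c01 : chi0.[1] = 0 by rewrite hornerM bubble1 mul0r.
(* the conjugate of chi0 is the test function of the energy estimate *)
pose Q := conjp chi0.
have sQ : (size Q <= k.+1)%N by rewrite size_conjp.
have Q0 : Q.[0] = 0 by rewrite conjp0 c00 conjc0.
have Q1 : Q.[1] = 0 by rewrite conjp1 c01 conjc0.
pose sig := Num.sqrt (energy Q^`()).
have sig0 : 0 <= sig := sqrtr_ge0 _.
have tQ' : tail 0 Q^`() <= K' * sig by exact: hK.
have tQ : tail 0 Q <= K' * sig.
  by rewrite tail0E Q0 modulus0 add0r; apply: (le_trans (tail_le_deriv _ _)).
have ks0 : 0 <= K' * sig by rewrite mulr_ge0.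
have hsig : sig <= kappa * (d + 2 * d ^+ 2) * K' * (x + e).
  have co : h^-1 * energy Q^`() <= complex.Re (cellform h b c chi0 Q).
    have cQ : conforming 1 (fun=> k) (fun=> Q) by split => // K; rewrite ltnS ltn0.
    by have := coercive b (ltn0Sn 0) h0 c0 cQ; rewrite /formh !big_ord1 conjpK.
  have split_ : cellform h b c chi0 Q = cellform h b c chi Q - cellform h b c (lin chi.[0] 0) Q.
    apply/eqP; rewrite eq_sym subr_eq; apply/eqP; rewrite {1}er addrC.
    by have := cellform_linl h b c 1 chi0 (lin chi.[0] 0) Q; rewrite scale1r mul1r.
  have b1 : modulus (cellform h b c chi Q) <= e * (`|b| + h * modulus c) * (K' * sig).
    rewrite gal //; apply: (le_trans (@modulus_cellload h b c nu Q e 0 h0 _ _)) => //.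
      by move=> i iQ; apply: nue; rewrite -ltnS (leq_trans iQ).
    rewrite -(mulrA e) ler_wpM2l // mulrDl lerD // ler_wpM2l //.
    by rewrite mulr_ge0 ?modulus_ge0 // ltW.
  have b2 : modulus (cellform h b c (lin chi.[0] 0) Q) <= x * (`|b| + 2 * (h * modulus c)) * (K' * sig).
    rewrite /cellform deriv_lin !mul_polyC !integZ integ_deriv Q0 Q1 subrr !mulr0 add0r sub0r.
    apply: (le_trans (modulusD _ _)); rewrite !modulusM modulusN !modulus_real (gtr0_norm h0) -/x.
    have i1 := le_trans (modulus_integ Q) tQ.
    have i2 : modulus (integ (lin chi.[0] 0 * Q)) <= 2 * x * (K' * sig).
      apply: (le_trans (modulus_integ _)); apply: (le_trans (tailM _ _)).
      rewrite ler_pM ?tail_ge0 //; apply: (le_trans (tail_lin _ _)).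
      by rewrite modulus0 addr0.
    have i3 := ler_wpM2l (mulr_ge0 (normr_ge0 b) x0) i1.
    have i4 := ler_wpM2l (mulr_ge0 (ltW h0) (modulus_ge0 c)) i2.
    clear - i3 i4; lra.
  have tot : sig ^+ 2 <= h * ((`|b| + 2 * (h * modulus c)) * (x + e)) * (K' * sig).
    rewrite sqr_sqrtr ?energy_ge0 //; move: co; rewrite ler_pdivrMl // => /le_trans; apply.
    rewrite -!mulrA ler_pM2l //; apply: (le_trans (Re_le_modulus _)); rewrite split_.
    apply: (le_trans (modulusB _ _)).
    have := mulr_ge0 e0 (mulr_ge0 (mulr_ge0 (ltW h0) (modulus_ge0 c)) ks0).
    clear - b1 b2; lra.
  have [s0|sn0] := eqVneq sig 0.
    by rewrite s0 !mulr_ge0 ?addr_ge0 // ?mulr_ge0 ?sqr_ge0 // ltW.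
  have sp : 0 < sig by rewrite lt_def sn0.
  move: tot; rewrite expr2 mulrA ler_pM2r // => /le_trans; apply.
  rewrite (_ : h * _ * K' = (h * `|b| + 2 * (h ^+ 2 * modulus c)) * (K' * (x + e))); last by ring.
  rewrite -mulrA ler_wpM2r ?mulr_ge0 ?addr_ge0 //; clear - cb cc; lra.
have hd : d + 2 * d ^+ 2 <= (L + 2 * L ^+ 2) * D ^+ 2.
  have : d <= L * D ^+ 2.
    rewrite /d mulrC ler_pM ?(ltW h0) // expr2 ler_peMl //.
  have : d ^+ 2 <= L ^+ 2 * D ^+ 2.
    by rewrite /d exprMn mulrC ler_wpM2r ?sqr_ge0 // ler_pXn2r ?nnegrE ?(ltW h0) ?(ltW L0).
  by lra.
have T0 : tail 0 chi <= A1 * (D ^+ 2 * x + D ^+ 2 * e).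
  rewrite er; apply: (le_trans (tailD _ _ _)).
  have h1 : tail 0 (lin chi.[0] 0) <= 2 * x.
    by apply: (le_trans (tail_lin _ _)); rewrite modulus0 addr0.
  have h2 : tail 0 chi0 <= K' * (kappa * ((L + 2 * L ^+ 2) * D ^+ 2) * K' * (x + e)).
    rewrite -(tail_conjp _ chi0); apply: (le_trans tQ); rewrite ler_wpM2l //.
    apply: (le_trans hsig); rewrite ler_wpM2r ?addr_ge0 // ler_wpM2r // ler_wpM2l //.
  have h3 : x <= D ^+ 2 * x by rewrite ler_peMl.
  have h4 : 0 <= D ^+ 2 * e by rewrite mulr_ge0 ?sqr_ge0.
  rewrite /A1; clear - h1 h2 h3 h4; lra.
(* for d > 1 the factor d^n Mx is at least 1 and T0 suffices *)
have [dle|dgt] := lerP d 1; last first.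
  apply: (le_trans (tail_anti _ (leq0n n))); apply: (le_trans T0).
  have X0 : 0 <= D ^+ 2 * x by rewrite mulr_ge0 ?sqr_ge0.
  have E0 : 0 <= D ^+ 2 * e by rewrite mulr_ge0 ?sqr_ge0.
  have dn : 1 <= d ^+ n by rewrite exprn_ege1 // ltW.
  have dM : 1 <= d ^+ n * Mx.
    by apply: (le_trans dn); rewrite ler_peMr ?(le_trans ler01 dn) // (le_trans _ Mx2) // ler1n.
  apply: ler_pM; [by []|exact: addr_ge0|by rewrite lerDl|].
  have := ler_peMl X0 dM; clear; lra.
apply: (@le_trans _ _ (A2 * (d ^+ n * (Mx * D ^+ 2 * x) + D ^+ 2 * e))); last first.
  rewrite ler_wpM2r ?lerDr // addr_ge0 ?mulr_ge0 ?exprn_ge0 ?sqr_ge0 ?(ltW d0) //; lra.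
have X0 : 0 <= D ^+ 2 * x by rewrite mulr_ge0 ?sqr_ge0.
have E0 : 0 <= D ^+ 2 * e by rewrite mulr_ge0 ?sqr_ge0.
have dMx : 2 <= d * Mx.
  have : 2 / d <= Mx by rewrite le_max lexx orbT.
  by rewrite ler_pdivrMr // mulrC.
apply: (hA2 (fun i => tail i chi) d) => //.
- by rewrite (ltW d0).
- by rewrite -mulrA mulr_ge0 // (le_trans _ Mx2).
- apply: (le_trans T0); rewrite ler_wpM2l // lerD2r -mulrA ler_peMl //.
  by apply: le_trans Mx2; rewrite ler1n.
- apply: (le_trans (tail_anti _ (leq0n 1))); apply: (le_trans T0); rewrite ler_wpM2l // lerD2r.
  have dM1 : 1 <= d * Mx by apply: le_trans dMx; rewrite ler1n.
  have := ler_peMl X0 dM1; clear; lra.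
move=> i.
have phi0 : 0 <= 4 * k.+1%:R * kappa * e by rewrite !mulr_ge0.
apply: (@le_trans _ _ (G0 * (modulus (((h * b)%:C)%C : C) * tail i.+1 chi
    + modulus (((h ^+ 2)%:C)%C * c) * tail i chi + 4 * k.+1%:R * kappa * e))).
  apply: (hrec k) => // j jd; rewrite mulrA mulrAC.
  have := @cellform_bubble_r h b c (bubble C * 'X^j) chi h0 (bubbleXn0 j) (bubbleXn1 j).
  have sb := size_bubble_Xn jd.
  rewrite gal ?bubbleXn0 ?bubbleXn1 //.
  move=> /(congr1 (@modulus R)); rewrite modulusN => <-.
  rewrite modulusM modulus_real (gtr0_norm h0).
  have tb : tail 0 (bubble C * 'X^j) <= 2 by apply: (le_trans (tail_mulXn _ _)); exact: tail_bubble.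
  have tb' : tail 0 (bubble C * 'X^j)^`() <= k.+1%:R * 2.
    apply: (le_trans (tail_deriv _ _)); apply: ler_pM; rewrite ?tail_ge0 ?ler_nat //.
    exact: (le_trans (tail_anti _ (leq0n 1))).
  apply: (@le_trans _ _ (h * (e * (`|b| * (k.+1%:R * 2) + h * modulus c * (k.+1%:R * 2))))).
    rewrite ler_pM2l //; apply: (le_trans (@modulus_cellload h b c nu _ e 0 h0 _ _)) => //.
      by move=> i' iQ; apply: nue; rewrite -ltnS (leq_trans iQ).
    rewrite ler_wpM2l // lerD // ler_wpM2l ?mulr_ge0 ?modulus_ge0 ?(ltW h0) //.
    by apply: (le_trans tb); rewrite ler_peMl // ler1n.
  rewrite (_ : h * _ = (h * `|b| + h ^+ 2 * modulus c) * (2 * k.+1%:R * e)); last by ring.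
  rewrite (_ : 4 * k.+1%:R * kappa * e = (kappa + kappa) * (2 * k.+1%:R * e)); last by ring.
  rewrite ler_wpM2r ?mulr_ge0 // lerD //.
    by apply: (le_trans cb); rewrite ler_piMr.
  by apply: (le_trans cc); rewrite ler_piMr // expr_le1 // ltW.
rewrite /G1 -(mulrA G0) ler_wpM2l //.
rewrite modulusM !modulus_real (ger0_norm (sqr_ge0 h)) normrM (gtr0_norm h0).
have t0 := tail_ge0 i chi; have t1 := tail_ge0 i.+1 chi.
have f1 := ler_wpM2r t1 cb; have f2 := ler_wpM2r t0 cc.
have f3 : 0 <= 4 * k.+1%:R * kappa by rewrite !mulr_ge0.
have f4 : 0 <= d * tail i.+1 chi + d ^+ 2 * tail i chi by rewrite addr_ge0 ?mulr_ge0 ?sqr_ge0 // ltW.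
have f5 : e <= D ^+ 2 * e by rewrite ler_peMl.
have := ler_wpM2l f3 f5; have := mulr_ge0 f3 f4; have := mulr_ge0 k0 E0.
clear - f1 f2; lra.
Qed.

End Core.


(** * Integrals over intervals *)

Section Intervals.
Variable R : realType.
Local Notation mu := (@lebesgue_measure R).
Local Open Scope classical_set_scope.
Implicit Types (a b c x y : R) (f g : R -> R).

Definition itg a b f := mu.-integrable `[a, b] (EFin \o f).

Lemma sub_itv_oc_cc a b : `]a, b] `<=` `[a, b].
Proof. by move=> x /=; rewrite !in_itv /= => /andP[/ltW -> ->]. Qed.

Lemma itg_oo a b f : itg a b f <-> mu.-integrable `]a, b[ (EFin \o f).
Proof.
split; first by apply: integrableS => //; exact: subset_itv_oo_cc.
move=> /integrableP[mf fi]; apply/integrableP; split.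
  exact: emeasurable_fun_itv_cc mf.
have mof : measurable_fun `]a, b] (fun x => `|(EFin \o f) x|)%E.
  by apply: measurableT_comp => //; apply/emeasurable_fun_itv_bndo_bndcP.
rewrite -integral_itv_obnd_cbnd //.
rewrite -integral_itv_bndo_bndc //.
exact: measurableT_comp.
Qed.

(** End points are negligible; derivatives of functions on a closed cell are
    only under control inside. *)
Lemma eq_itg a b f g : (forall x, a < x < b -> f x = g x) ->
  itg a b f -> itg a b g /\
  \int[mu]_(x in `[a, b]) f x = \int[mu]_(x in `[a, b]) g x.
Proof.
move=> fg /itg_oo fi.
have gi : mu.-integrable `]a, b[ (EFin \o g).
  apply: eq_integrable fi => // x; rewrite inE /= in_itv /= => xab.
  by rewrite fg.
have E h : mu.-integrable `]a, b[ (EFin \o h) ->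
    \int[mu]_(x in `[a, b]) h x = \int[mu]_(x in `]a, b[) h x.
  move=> hi; rewrite Rintegral_itv_bndo_bndc // Rintegral_itv_obnd_cbnd //.
  by move/itg_oo : hi; apply: integrableS => //; exact: sub_itv_oc_cc.
split; first exact/itg_oo.
rewrite !E //; apply: eq_Rintegral => x; rewrite inE /= in_itv /=; exact: fg.
Qed.

Lemma itgS a b c d f : a <= c -> d <= b -> itg a b f -> itg c d f.
Proof.
move=> ac db; apply: integrableS => // x /=; rewrite !in_itv /= => /andP[cx xd].
by rewrite (le_trans ac) //= (le_trans xd).
Qed.

Lemma itg_cat a b c f : a <= b -> b <= c -> itg a b f -> itg b c f ->
  itg a c f /\ \int[mu]_(x in `[a, c]) f x =
    \int[mu]_(x in `[a, b]) f x + \int[mu]_(x in `[b, c]) f x.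
Proof.
move=> ab bc fab fbc.
have fbc' : mu.-integrable `]b, c] (EFin \o f).
  by apply: integrableS fbc => //; exact: sub_itv_oc_cc.
have e : `[a, c] = `[a, b] `|` `]b, c].
  by apply: itv_bndbnd_setU; rewrite bnd_simp.
have dis : [disjoint `[a, b] & `]b, c]].
  apply/disj_setPLR => z /=; rewrite !in_itv /= => /andP[_ zb]; apply/negP.
  by rewrite negb_and -leNgt zb.
have fac : itg a c f.
  rewrite /itg e; apply/integrableP.
  move/integrableP : fab => [m1 i1]; move/integrableP : fbc' => [m2 i2].
  have m12 : measurable_fun (`[a, b] `|` `]b, c]) (EFin \o f) by apply/measurable_funU.
  split => //; rewrite ge0_integral_setU //=; first exact: lte_add_pinfty.
  by apply/measurable_EFinP; apply: measurableT_comp => //; exact/measurable_EFinP.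
split => //; rewrite e Rintegral_setU //; last by rewrite -e.
by rewrite Rintegral_itv_obnd_cbnd.
Qed.

Lemma itgD a b f g : itg a b f -> itg a b g -> itg a b (fun x => f x + g x).
Proof. by move=> fi gi; exact: (integrableD _ fi gi). Qed.
Lemma itgB a b f g : itg a b f -> itg a b g -> itg a b (fun x => f x - g x).
Proof. by move=> fi gi; exact: (integrableB _ fi gi). Qed.
Lemma itgZ a b r f : itg a b f -> itg a b (fun x => r * f x).
Proof. by move=> fi; exact: (integrableZl _ _ fi). Qed.

Lemma itg_continuous a b f : {within `[a, b], continuous f} -> itg a b f.
Proof. by move=> cf; apply: continuous_compact_integrable => //; exact: segment_compact. Qed.

Lemma itg_sum a b n (f : nat -> R -> R) : (forall i, (i < n)%N -> itg a b (f i)) ->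
  itg a b (fun x => \sum_(i < n) f i x) /\
  \int[mu]_(x in `[a, b]) (\sum_(i < n) f i x) = \sum_(i < n) \int[mu]_(x in `[a, b]) f i x.
Proof.
elim: n => [|n IH] fi.
  have -> : (fun x => \sum_(i < 0) f i x) = fun=> 0 by apply/funext => x; rewrite big_ord0.
  rewrite big_ord0; split; first exact: integrable0.
  by rewrite /Rintegral integral0.
have [i1 e1] := IH (fun i ni => fi i (ltnW ni)).
have -> : (fun x => \sum_(i < n.+1) f i x) = fun x => \sum_(i < n) f i x + f n x.
  by apply/funext => x; rewrite big_ord_recr.
split; first exact: itgD (fi _ _).
by rewrite RintegralD //; [rewrite big_ord_recr e1|exact: fi].
Qed.

Lemma norm_Rint_le a b f M : a <= b -> itg a b f -> 0 <= M ->
  {ae mu, forall x, a < x < b -> `|f x| <= M} ->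
  `|\int[mu]_(x in `[a, b]) f x| <= M * (b - a).
Proof.
move=> ab fi M0 fM; have [_ ->] := eq_itg (fun x _ => erefl (f x)) fi.
apply: (le_trans (le_normr_Rintegral _ fi)) => //.
have -> : \int[mu]_(x in `[a, b]) `|f x| = \int[mu]_(x in `]a, b[) `|f x|.
  have ni : itg a b (fun x => `|f x|) by exact: integrable_norm.
  rewrite Rintegral_itv_bndo_bndc; last by move/itg_oo : ni.
  by rewrite Rintegral_itv_obnd_cbnd //; apply: integrableS ni => //; exact: sub_itv_oc_cc.
have := @integral_le_bound _ _ _ mu `]a, b[ (EFin \o f) M%:E.
have fo : mu.-integrable `]a, b[ (EFin \o f) by exact/itg_oo.
move=> /(_ _ (measurable_int _ fo)) H.
have {}H : (\int[mu]_(x in `]a, b[) `|(EFin \o f) x| <= M%:E * mu `]a, b[)%E.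
  by apply: H => //; rewrite ?lee_fin //.
rewrite lebesgue_measure_itv /= in H.
rewrite -lee_fin /Rintegral fineK.
  apply: (le_trans H); rewrite lte_fin; case: ltP => h.
    by rewrite -EFinB -EFinM.
  by rewrite mule0 lee_fin mulr_ge0 // subr_ge0.
by move/integrable_abse : fo; exact: integrable_fin_num.
Qed.

End Intervals.

(** * Functions with absolutely continuous derivatives *)

Section Acr.
Variable R : realType.
Local Notation mu := (@lebesgue_measure R).
Local Open Scope classical_set_scope.
Implicit Types (a b c x y M : R) (f g w : R -> R).

(** Absolute continuity on the open interval, for a real component and with the
    derivative as a separate argument. *)
Definition primitive a b g g' := forall x y, a < x -> x <= y -> y < b ->
  itg x y g' /\ g y - g x = \int[mu]_(z in `[x, y]) g' z.

Lemma primitive_lip a b g g' M : primitive a b g g' -> 0 <= M ->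
  {ae mu, forall x, a < x < b -> `|g' x| <= M} ->
  forall x y, a < x < b -> a < y < b -> `|g y - g x| <= M * `|y - x|.
Proof.
move=> gg' M0 hM; have main x y : a < x -> x <= y -> y < b -> `|g y - g x| <= M * `|y - x|.
  move=> ax xy yb; have [gi ->] := gg' _ _ ax xy yb.
  rewrite (ger0_norm (_ : 0 <= y - x)) ?subr_ge0 //; apply: norm_Rint_le => //.
  apply: (@filterS _ _ (ae_filter_ringOfSetsType mu) _ _ _ hM) => z hz /andP[xz zy]; apply: hz.
  by rewrite (lt_trans ax) //= (lt_trans zy).
move=> x y /andP[ax xb] /andP[ay yb]; have [xy|yx] := leP x y; first exact: main.
by rewrite distrC (distrC y); apply: main => //; exact: ltW.
Qed.

Lemma poly_FTC (p : {poly R}) x y : x <= y ->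
  itg x y (horner (deriv p)) /\ p.[y] - p.[x] = \int[mu]_(z in `[x, y]) (deriv p).[z].
Proof.
have ci : itg x y (horner (deriv p)).
  by apply: itg_continuous; apply: continuous_subspaceT; exact: continuous_horner.
rewrite le_eqVlt => /predU1P[xy|xy]; split => //.
  by rewrite -xy subrr set_itv1 Rintegral_set1.
 rewrite /Rintegral (@continuous_FTC2 _ _ (horner p)) //=.
- by apply: continuous_subspaceT; exact: continuous_horner.
- split; first by move=> z _; exact: derivable_horner.
    by apply: cvg_at_right_filter; exact: continuous_horner.
  by apply: cvg_at_left_filter; exact: continuous_horner.
- by move=> z _; rewrite derivE.
Qed.

Lemma primitive_poly a b (p : {poly R}) : primitive a b (horner p) (horner (deriv p)).
Proof. by move=> x y _ xy _; exact: poly_FTC. Qed.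

Lemma primitiveB a b f f' g g' : primitive a b f f' -> primitive a b g g' ->
  primitive a b (fun x => f x - g x) (fun x => f' x - g' x).
Proof.
move=> hf hg x y ax xy yb; have [fi fe] := hf _ _ ax xy yb; have [gi ge] := hg _ _ ax xy yb.
split; first exact: itgB.
by rewrite RintegralB // -fe -ge; ring.
Qed.

(** The primitive of a function integrable up to the end points has limits
    there. *)
Lemma primitive_extend a b g g' : a < b -> primitive a b g g' -> itg a b g' ->
  exists2 G, {within `[a, b], continuous G} & forall y, a < y < b -> G y = g y.
Proof.
move=> ab gg' gi; pose c := (a + b) / 2.
have ac : a < c by rewrite /c; lra.
have cb : c < b by rewrite /c; lra.
pose I y := \int[mu]_(z in `[a, y]) g' z.
have cI : {within `[a, b], continuous I} by exact: (parameterized_integral_continuous (ltW ab) gi).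
exists (fun y => I y + (g c - I c)).
  by move=> z; apply: cvgD; [exact: cI|exact: cvg_cst].
have step x y : a < x -> x <= y -> y < b -> I y - I x = g y - g x.
  move=> ax xy yb; have [gxy ->] := gg' _ _ ax xy yb.
  have gax : itg a x g' by apply: itgS gi => //; rewrite (le_trans xy) // ltW.
  by have [_ e] := itg_cat (ltW ax) xy gax gxy; rewrite /I e; ring.
move=> y /andP[ay yb]; have [cy|yc] := leP c y.
  by have := step _ _ ac cy yb; lra.
by have := step _ _ ay (ltW yc) cb; lra.
Qed.

Lemma within_continuous_at a b f x : {within `[a, b], continuous f} -> a < x < b ->
  {for x, continuous f}.
Proof.
move=> cf xab; have ab : a < b by case/andP: xab => /lt_trans; apply.
by move/(continuous_within_itvP _ ab) : cf => [+ _ _]; apply; rewrite in_itv.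
Qed.

Lemma near_itv_oo a b x : a < x < b -> \forall y \near x, a < y < b.
Proof.
move=> xab; have : (x \in `]a, b[)%R by rewrite in_itv.
by move/near_in_itvoo; apply: filterS => y; rewrite in_itv.
Qed.

Lemma primitive_continuous a b g g' : primitive a b g g' -> itg a b g' ->
  forall x, a < x < b -> {for x, continuous g}.
Proof.
move=> gg' gi x xab; have ab : a < b by case/andP: xab => /lt_trans; apply.
have [G cG Gg] := primitive_extend ab gg' gi.
have := within_continuous_at cG xab; rewrite /prop_for /continuous_at Gg //.
apply: cvg_trans; apply: near_eq_cvg.
by apply: filterS (near_itv_oo xab) => y /Gg.
Qed.

Lemma primitive_derivable a b g g' : primitive a b g g' -> itg a b g' ->
  forall x, a < x < b -> {for x, continuous g'} -> derivable g x 1 /\ g^`() x = g' x.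
Proof.
move=> gg' gi x xab cx; have /andP[ax xb] := xab.
pose I y := \int[mu]_(z in `[a, y]) g' z.
have [dI eI] := continuous_FTC1_closed xb gi ax cx.
pose G y := I y + (g x - I x).
have Gg : {near x, G =1 g}.
  apply: filterS (near_itv_oo xab) => y /andP[ay yb].
  have [xy|yx] := leP x y.
    have [gxy e1] := gg' _ _ ax xy yb.
    have gax : itg a x g' by apply: itgS gi => //; exact: ltW.
    by have [_ e] := itg_cat (ltW ax) xy gax gxy; rewrite /G /I e; lra.
  have [gxy e1] := gg' _ _ ay (ltW yx) xb.
  have gax : itg a y g' by apply: itgS gi => //; exact: ltW.
  by have [_ e] := itg_cat (ltW ay) (ltW yx) gax gxy; rewrite /G /I e; lra.
have dI1 : is_derive x (1 : R) I (g' x) by apply: DeriveDef; rewrite -?derive1E.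
have dG : is_derive x (1 : R) G (g' x).
  have := is_deriveD dI1 (is_derive_cst (g x - I x) x (1 : R)).
  by rewrite addr0.
have := near_eq_is_derive Gg dG => -[dg eg]; split => //.
by rewrite derive1E.
Qed.

(** The polynomial, in the global variable, with local representation p on the
    cell [x, x + h]. *)
Definition glob x h (p : {poly R}) : {poly R} := p \Po (h^-1 *: ('X - x%:P)).

Lemma horner_glob x h p y : (glob x h p).[y] = p.[(y - x) / h].
Proof. by rewrite horner_comp !hornerE mulrC. Qed.

Lemma deriv_glob x h p : deriv (glob x h p) = h^-1 *: glob x h (deriv p).
Proof.
rewrite /glob deriv_comp derivZ derivB derivX derivC subr0.
by rewrite -[1]/(1%:P) -scalerAr mulr1.
Qed.

(** The Taylor polynomial at the midpoint, built by induction on the degree: the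
    polynomial of g' is integrated and the constant adjusted at the midpoint.
    One polynomial serves for all derivatives. *)
Lemma taylor_approx x h M r : 0 < h -> 0 <= M -> forall g : nat -> R -> R,
  (forall j, (j <= r)%N -> primitive x (x + h) (g j) (g j.+1)) ->
  {ae mu, forall y, x < y < x + h -> `|g r.+1 y| <= M} ->
  exists2 T : {poly R}, (size T <= r.+1)%N & forall j, (j <= r)%N ->
    forall y, x < y < x + h ->
    `|g j y - h ^- j * (derivn j T).[(y - x) / h]| <= M * h ^+ (r.+1 - j).
Proof.
move=> h0 M0; pose c := x + h / 2.
have cin : x < c < x + h by apply/andP; split; rewrite /c; lra.
have dist y : x < y < x + h -> `|y - c| <= h.
  by move=> /andP[xy yx]; rewrite ler_norml /c; apply/andP; split; lra.
elim: r => [|r IH] g hg hM.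
  exists (g 0%N c)%:P; first exact: size_polyC_leq1.
  move=> j; rewrite leqn0 => /eqP -> y yin; rewrite derivn0 hornerC expr0 invr1 mul1r expr1.
  apply: (le_trans (primitive_lip (hg 0%N (leqnn _)) M0 hM cin yin)).
  by rewrite ler_wpM2l // dist.
have [T1 sT1 hT1] := IH (fun j => g j.+1) (fun j jr => hg j.+1 jr) hM.
pose T := (g 0%N c - h * (antideriv T1).[(c - x) / h])%:P + h *: antideriv T1.
have T' : deriv T = h *: T1 by rewrite /T derivD derivC add0r derivZ antiderivK.
exists T.
  rewrite /T; apply: (leq_trans (size_polyD _ _)); rewrite geq_max.
  rewrite (leq_trans (size_polyC_leq1 _)) //=.
  by apply: (leq_trans (size_scale_leq _ _)); apply: (leq_trans (size_antideriv _)).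
move=> [|j] jr y yin; last first.
  rewrite derivSn T' derivnZ hornerZ exprS invfM mulrA -[_ * h]mulrA [h ^- j * h]mulrC mulrA.
  by rewrite mulVf ?gt_eqF // mul1r subSS; exact: hT1.
rewrite derivn0 expr0 invr1 mul1r.
pose d z := g 0%N z - T.[(z - x) / h].
have dc : d c = 0 by rewrite /d /T !hornerE; ring.
have ad : primitive x (x + h) d (fun z => g 1%N z - T1.[(z - x) / h]).
  have hd := primitiveB (hg 0%N (leq0n _)) (@primitive_poly x (x + h) (glob x h T)).
  have e1 : (fun z => g 0%N z - (glob x h T).[z]) = d.
    by apply/funext => z; rewrite horner_glob.
  have e2 : (fun z => g 1%N z - (deriv (glob x h T)).[z]) = (fun z => g 1%N z - T1.[(z - x) / h]).
    apply/funext => z; rewrite deriv_glob hornerZ horner_glob T' hornerZ.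
    by rewrite mulrA mulVf ?gt_eqF // mul1r.
  by move: hd; rewrite e1 e2.
have B0 : 0 <= M * h ^+ r.+1 by rewrite mulr_ge0 // exprn_ge0 // ltW.
have := @primitive_lip _ _ _ _ (M * h ^+ r.+1) ad B0 _ c y cin yin.
rewrite dc subr0 => /(_ _) H; apply: (le_trans (H _)).
  apply: aeW => z zin; have := hT1 0%N (leq0n _) z zin.
  by rewrite derivn0 expr0 invr1 mul1r subn0.
by rewrite subn0 [h ^+ r.+2]exprSr mulrA ler_wpM2l // dist.
Qed.

End Acr.

(** * Local moments and integration by parts on the cells of a uniform mesh *)

Section Cells.
Variable R : realType.
Local Notation mu := (@lebesgue_measure R).
Local Open Scope classical_set_scope.
Implicit Types (a b x y h : R) (f g w : R -> R) (q p : {poly R}).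

(** The regularity required for integration by parts up to the end points of a
    cell, where derive1 depends on values outside of the cell. *)
Definition C1 a b w w1 :=
  [/\ derivable_oo_LRcontinuous w a b, {within `[a, b], continuous w1} &
      forall y, a < y < b -> w^`() y = w1 y].

Definition locmom x h w (j : nat) : R :=
  h^-1 * \int[mu]_(y in `[x, x + h]) (w y * ((y - x) / h) ^+ j).

Lemma continuous_glob x h q A : {within A, continuous (fun y => q.[(y - x) / h])}.
Proof.
rewrite (_ : (fun y => _) = horner (glob x h q)); last first.
  by apply/funext => y; rewrite horner_glob.
by apply: continuous_subspaceT; exact: continuous_horner.
Qed.

Lemma within_continuousM A f g : {within A, continuous f} ->
  {within A, continuous g} -> {within A, continuous (fun y : R => f y * g y : R)}.
Proof. by move=> cf cg z; apply: cvgM; [exact: cf|exact: cg]. Qed.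

Lemma locmom_pairing x h w q : {within `[x, x + h], continuous w} ->
  itg x (x + h) (fun y => w y * q.[(y - x) / h]) /\
  h^-1 * \int[mu]_(y in `[x, x + h]) (w y * q.[(y - x) / h]) = pairing (locmom x h w) q.
Proof.
move=> cw; have ci : itg x (x + h) (fun y => w y * q.[(y - x) / h]).
  by apply: itg_continuous; apply: within_continuousM => //; exact: continuous_glob.
split => //; have := @itg_sum _ x (x + h) (size q) (fun i y => q`_i * (w y * ((y - x) / h) ^+ i)).
have cXn i : itg x (x + h) (fun y => w y * ((y - x) / h) ^+ i).
  have := @continuous_glob x h 'X^i `[x, x + h].
  rewrite (_ : (fun y => _) = fun y => ((y - x) / h) ^+ i).
    by move=> cX; apply: itg_continuous; exact: within_continuousM.
  by apply/funext => y; rewrite hornerXn.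
move=> [i _|_ e]; first exact: itgZ.
have -> : (fun y => w y * q.[(y - x) / h]) =
    (fun y => \sum_(i < size q) q`_i * (w y * ((y - x) / h) ^+ i)).
  by apply/funext => y; rewrite horner_coef mulr_sumr; apply: eq_bigr => i _; ring.
rewrite e mulr_sumr; apply: eq_bigr => i _.
by rewrite RintegralZl // /locmom; [ring|exact: cXn].
Qed.

Lemma cell_parts x h w w1 q : 0 < h -> C1 x (x + h) w w1 ->
  itg x (x + h) (fun y => w1 y * q.[(y - x) / h]) /\
  \int[mu]_(y in `[x, x + h]) (w1 y * q.[(y - x) / h]) =
  w (x + h) * q.[1] - w x * q.[0] - pairing (locmom x h w) (deriv q).
Proof.
move=> h0 [dw cw1 ew1]; have xh : x < x + h by rewrite ltrDl.
have cw := derivable_oo_LRcontinuous_within dw.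
split.
  by apply: itg_continuous; apply: within_continuousM => //; exact: continuous_glob.
have cg r : {within `[x, x + h], continuous (horner r)}.
  by apply: continuous_subspaceT; exact: continuous_horner.
have dg : derivable_oo_LRcontinuous (horner (glob x h q)) x (x + h).
  split; first by move=> z _; exact: derivable_horner.
    by apply: cvg_at_right_filter; exact: continuous_horner.
  by apply: cvg_at_left_filter; exact: continuous_horner.
have := @Rintegration_by_parts R (horner (glob x h q)) w (horner (deriv (glob x h q))) w1
   x (x + h) xh (cg _) dg (fun z _ => esym (congr1 (fun f => f z) (derivE _))) cw1 dw.
have hw : {in (`]x, (x + h)[)%R, w^`() =1 w1} by move=> z; rewrite in_itv /=; exact: ew1.
have g0 : (glob x h q).[x] = q.[0] by rewrite horner_glob subrr mul0r.
have g1 : (glob x h q).[x + h] = q.[1].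
  by rewrite horner_glob addrAC subrr add0r divff ?gt_eqF.
move=> /(_ hw); rewrite g0 g1.
have [_ <-] := @locmom_pairing x h w (deriv q) cw.
have -> : (fun y => (horner (glob x h q)) y * w1 y) = (fun y => w1 y * q.[(y - x) / h]).
  by apply/funext => y; rewrite horner_glob mulrC.
move=> ->; rewrite [q.[1] * _]mulrC [q.[0] * _]mulrC; congr (_ - _).
have -> : (fun y => (horner (deriv (glob x h q))) y * w y) =
  (fun y => h^-1 * (w y * (deriv q).[(y - x) / h])).
  by apply/funext => y; rewrite deriv_glob hornerZ horner_glob; ring.
by rewrite RintegralZl //; have [] := @locmom_pairing x h w (deriv q) cw.
Qed.

Lemma eq_locmom x h w w' j : (forall y, x < y < x + h -> w y = w' y) ->
  {within `[x, x + h], continuous w} -> locmom x h w j = locmom x h w' j.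
Proof.
move=> e cw; congr (_ * _).
have [i1 _] := @locmom_pairing x h w 'X^j cw.
have E v : (fun y => v y * ((y - x) / h) ^+ j) = (fun y => v y * 'X^j.[(y - x) / h]).
  by apply/funext => y; rewrite hornerXn.
rewrite !E; have [|_ ->] := @eq_itg _ x (x + h) _ (fun y => w' y * 'X^j.[(y - x) / h]) _ i1.
  by move=> y yin; rewrite e.
by [].
Qed.

Lemma Rint_glob x h p : 0 < h ->
  h^-1 * \int[mu]_(y in `[x, x + h]) p.[(y - x) / h] = integ p.
Proof.
move=> h0; have xh : x <= x + h by rewrite lerDl ltW.
have [_] := poly_FTC (h *: glob x h (antideriv p)) xh.
rewrite !hornerZ !horner_glob subrr mul0r addrAC subrr add0r divff ?gt_eqF //.
rewrite antideriv0 mulr0 subr0 -integE derivZ deriv_glob antiderivK scalerA mulfV ?gt_eqF //.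
rewrite scale1r => e; rewrite (_ : (fun y => _) = horner (glob x h p)).
  by rewrite -e mulrA mulVf ?gt_eqF // mul1r.
by apply/funext => y; rewrite horner_glob.
Qed.

Lemma locmom_close x h w p (rho : R) j : 0 < h -> 0 <= rho ->
  {within `[x, x + h], continuous w} ->
  (forall y, x < y < x + h -> `|w y - p.[(y - x) / h]| <= rho) ->
  `|locmom x h w j - integ (p * 'X^j)| <= rho.
Proof.
move=> h0 r0 cw hw; have xh : x <= x + h by rewrite lerDl ltW.
have [i1 _] := @locmom_pairing x h w 'X^j cw.
have i2 : itg x (x + h) (fun y => (p * 'X^j).[(y - x) / h]).
  by apply: itg_continuous; exact: continuous_glob.
rewrite -(@Rint_glob x h) // /locmom -mulrBr.
rewrite (_ : (fun y => w y * ((y - x) / h) ^+ j) = fun y => w y * 'X^j.[(y - x) / h]); last first.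
  by apply/funext => y; rewrite hornerXn.
rewrite -RintegralB // normrM gtr0_norm ?invr_gt0 // mulrC ler_pdivrMr //.
apply: (@le_trans _ _ (rho * (x + h - x))); last by rewrite addrAC subrr add0r.
apply: norm_Rint_le => //; first exact: itgB.
apply: aeW => y yin; rewrite hornerM !hornerXn -mulrBl normrM.
have t0 : 0 <= (y - x) / h <= 1.
  case/andP: yin => xy yx; rewrite divr_ge0 ?(ltW h0) ?subr_ge0 ?(ltW xy) //=.
  by rewrite ler_pdivrMr // mul1r; lra.
rewrite -[leRHS]mulr1; apply: ler_pM => //; first exact: hw.
by rewrite normrX exprn_ile1 // ger0_norm; case/andP: t0.
Qed.

Lemma locmom_poly x h p j : 0 < h ->
  locmom x h (fun y => p.[(y - x) / h]) j = integ (p * 'X^j).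
Proof.
move=> h0; apply/eqP; rewrite -subr_eq0 -normr_le0.
apply: locmom_close => //; first exact: continuous_glob.
by move=> y _; rewrite subrr normr0.
Qed.

Lemma C1_poly a b w p : a < b -> (forall y, a <= y <= b -> w y = p.[y]) ->
  C1 a b w (horner (deriv p)).
Proof.
move=> ab wp; have near_eq y : a < y < b -> \forall z \near y, p.[z] = w z.
  move=> yab; apply: filterS (near_itv_oo yab) => z /andP[az zb].
  by rewrite wp // !ltW.
split.
- split.
  + move=> y; rewrite in_itv /= => yab.
    by have [] := near_eq_is_derive (near_eq _ yab) (is_derive_poly p y).
  + rewrite wp ?lexx ?ltW //.
    apply: cvg_trans (cvg_at_right_filter (@continuous_horner _ p a)).
    apply: near_eq_cvg; near=> z; rewrite wp //; apply/andP; split; near: z.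
      exact: nbhs_right_ge.
    exact: nbhs_right_le.
  + rewrite wp ?lexx ?ltW //.
    apply: cvg_trans (cvg_at_left_filter (@continuous_horner _ p b)).
    apply: near_eq_cvg; near=> z; rewrite wp //; apply/andP; split; near: z.
      exact: nbhs_left_ge.
    exact: nbhs_left_le.
- by apply: continuous_subspaceT; exact: continuous_horner.
- move=> y yab; rewrite derivE !derive1E; apply: near_eq_derive.
  by apply: filterS (near_eq _ yab) => z ->.
Unshelve. all: by end_near. Qed.

Lemma sum_cells N h f (I : nat -> R) : 0 <= h ->
  (forall K, (K < N)%N -> itg (K%:R * h) (K%:R * h + h) f /\
     \int[mu]_(y in `[(K%:R * h), (K%:R * h + h)]) f y = I K) ->
  itg 0 (N%:R * h) f /\ \int[mu]_(y in `[0, (N%:R * h)]) f y = \sum_(K < N) I K.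
Proof.
move=> h0; elim: N => [|N IH] hK.
  rewrite mul0r big_ord0 set_itv1; split; last exact: Rintegral_set1.
  by rewrite /itg set_itv1; apply/integrableP; rewrite integral_set1; split => //; exact: measurable_fun_set1.
have [i1 e1] := IH (fun K KN => hK K (ltnW KN)); have [i2 e2] := hK N (ltnSn N).
have eN : N.+1%:R * h = N%:R * h + h by rewrite -natr1 mulrDl mul1r.
have p1 : 0 <= N%:R * h by rewrite mulr_ge0.
have p2 : N%:R * h <= N%:R * h + h by rewrite lerDl.
have [i3 e3] := itg_cat p1 p2 i1 i2.
by rewrite eN; split => //; rewrite e3 e1 e2 big_ord_recr.
Qed.

End Cells.


(** * Piecewise polynomial test functions *)

Section CellGal.
Variable F : numFieldType.
Implicit Types (h e : F) (s : nat -> F) (q : {poly F}).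

(** The three bilinear terms of the form on a cell, after integration by parts:
    they involve a function only through its end values e0, e1 and its local
    moments s. *)
Definition gal11 h e0 e1 s q :=
  h^-1 * (e1 * (deriv q).[1] - e0 * (deriv q).[0] - pairing s (deriv (deriv q))).
Definition gal10 e0 e1 s q := e1 * q.[1] - e0 * q.[0] - pairing s (deriv q).
Definition gal00 h s q := h * pairing s q.
Definition cellgal h b c e0 e1 s q :=
  gal11 h e0 e1 s q + b * gal10 e0 e1 s q + c * gal00 h s q.

Lemma cellgalB h b c e0 e1 s e0' e1' s' q :
  cellgal h b c (e0 - e0') (e1 - e1') (fun i => s i - s' i) q =
  cellgal h b c e0 e1 s q - cellgal h b c e0' e1' s' q.
Proof.
rewrite /cellgal /gal11 /gal10 /gal00.
have pB r : pairing (fun i => s i - s' i) r = pairing s r - pairing s' r.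
  by rewrite /pairing -sumrB; apply: eq_bigr => i _; rewrite mulrBr.
by rewrite !pB; ring.
Qed.

Lemma cellgal_linear h b c e0 e1 s a q1 q2 :
  cellgal h b c e0 e1 s (a *: q1 + q2) =
  a * cellgal h b c e0 e1 s q1 + cellgal h b c e0 e1 s q2.
Proof.
rewrite /cellgal /gal11 /gal10 /gal00 !(derivD, derivZ) !hornerD !hornerZ.
by rewrite !pairingD !pairingZ; ring.
Qed.

End CellGal.

Section Pw.
Variable R : realType.
Local Notation mu := (@lebesgue_measure R).
Local Notation C := R[i].
Local Notation RC := (map_poly (real_complex R)).
Local Open Scope classical_set_scope.
Implicit Types (h x y : R) (w psi : R -> R) (q : {poly R}) (Q : nat -> {poly R}).

Lemma RC_horner q (x : R) : (RC q).[(x%:C)%C] = (q.[x]%:C)%C.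
Proof. by rewrite horner_map. Qed.

Lemma pairing_RC (s : nat -> C) q : pairing s (RC q) =
  ((pairing (fun i => complex.Re (s i)) q) +i* (pairing (fun i => complex.Im (s i)) q))%C.
Proof.
rewrite /pairing size_map_poly.
elim/big_rec3: _ => [//|i y1 y2 y3 _ ->]; rewrite coef_map /=.
by case: (s i) => a b; simpc.
Qed.

Lemma cellgal_RC h b (c e0 e1 : C) (s : nat -> C) q :
  cellgal (h%:C)%C (b%:C)%C c e0 e1 s (RC q) =
  (gal11 h (complex.Re e0) (complex.Re e1) (fun i => complex.Re (s i)) q +i*
   gal11 h (complex.Im e0) (complex.Im e1) (fun i => complex.Im (s i)) q)%C
  + (b%:C)%C *
  (gal10 (complex.Re e0) (complex.Re e1) (fun i => complex.Re (s i)) q +i*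
   gal10 (complex.Im e0) (complex.Im e1) (fun i => complex.Im (s i)) q)%C
  + c * (gal00 h (fun i => complex.Re (s i)) q +i* gal00 h (fun i => complex.Im (s i)) q)%C.
Proof.
have e (r : {poly R}) : ((RC r).[1] = (r.[1]%:C)%C) * ((RC r).[0] = (r.[0]%:C)%C).
  by rewrite -[1]/((1%:C)%C : C) -[0]/((0%:C)%C : C) !RC_horner.
rewrite /cellgal /gal11 /gal10 /gal00 !deriv_map !pairing_RC !e -(fmorphV (real_complex R)).
case: e0 => a0 b0; case: e1 => a1 b1 /=.
by congr (_ + _ * _ + _ * _); simpc; congr (_ +i* _)%C; ring.
Qed.

Lemma cell_forms x h w w1 psi q : 0 < h -> C1 x (x + h) w w1 ->
  (forall y, x <= y <= x + h -> psi y = q.[(y - x) / h]) ->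
  [/\ itg x (x + h) (fun y => derive1 w y * derive1 psi y) /\
      \int[mu]_(y in `[x, x + h]) (derive1 w y * derive1 psi y) =
        gal11 h (w x) (w (x + h)) (locmom x h w) q,
      itg x (x + h) (fun y => derive1 w y * psi y) /\
      \int[mu]_(y in `[x, x + h]) (derive1 w y * psi y) =
        gal10 (w x) (w (x + h)) (locmom x h w) q &
      itg x (x + h) (fun y => w y * psi y) /\
      \int[mu]_(y in `[x, x + h]) (w y * psi y) = gal00 h (locmom x h w) q].
Proof.
move=> h0 nw hpsi; have [dw cw1 ew1] := nw; have xh : x < x + h by rewrite ltrDl.
have cw := derivable_oo_LRcontinuous_within dw.
have hpsi' y : x <= y <= x + h -> psi y = (glob x h q).[y] by move=> /hpsi ->; rewrite horner_glob.
have [_ _ epsi] := C1_poly xh hpsi'.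
have oc y : x < y < x + h -> x <= y <= x + h by move=> /andP[/ltW -> /ltW ->].
split.
- have [i1 e1] := @cell_parts _ x h w w1 (deriv q) h0 nw.
  have [] := @eq_itg _ x (x + h) _ (fun y => derive1 w y * derive1 psi y) _ (itgZ h^-1 i1).
    move=> y yin; rewrite ew1 // epsi // deriv_glob hornerZ horner_glob; ring.
  by move=> i2 <-; split => //; rewrite RintegralZl // e1.
- have [i1 e1] := @cell_parts _ x h w w1 q h0 nw.
  have [] := @eq_itg _ x (x + h) _ (fun y => derive1 w y * psi y) _ i1.
    by move=> y yin; rewrite ew1 // hpsi // oc.
  by move=> i2 <-; split.
- have [i1 e1] := @locmom_pairing _ x h w q cw.
  have [] := @eq_itg _ x (x + h) _ (fun y => w y * psi y) _ i1.
    by move=> y yin; rewrite hpsi // oc.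
  move=> i2 <-; split => //; rewrite /gal00 -e1 mulrA divff ?gt_eqF // mul1r //.
Qed.

Definition cmom x h (u : R -> C) (j : nat) : C :=
  (locmom x h (fun y => complex.Re (u y)) j +i* locmom x h (fun y => complex.Im (u y)) j)%C.

Definition C1_cells N h (u : R -> C) := forall K, (K < N)%N ->
  (exists w1, C1 (K%:R * h) (K%:R * h + h) (fun y => complex.Re (u y)) w1) /\
  (exists w1, C1 (K%:R * h) (K%:R * h + h) (fun y => complex.Im (u y)) w1).

Definition follows N h psi Q := forall K y, (K < N)%N ->
  K%:R * h <= y <= K%:R * h + h -> psi y = (Q K).[(y - K%:R * h) / h].

(** Real test functions suffice (see galerkin_complex), and for them the
    conjugation in the form disappears. *)
Lemma form_a_cells N h b (c : C) (u : R -> C) psi Q : 0 < h ->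
  C1_cells N h u -> follows N h psi Q ->
  form_a (N%:R * h) b c u (fun y => (psi y)%:C)%C =
  \sum_(K < N) cellgal (h%:C)%C (b%:C)%C c (u (K%:R * h)) (u (K%:R * h + h))
     (cmom (K%:R * h) h u) (RC (Q K)).
Proof.
move=> h0 nu fpsi; rewrite /form_a.
have dR y : (cderive 1 (fun y => (psi y)%:C)%C y) = (derive1 psi y)%:C%C.
  rewrite /cderive !derive1n1; congr (_ +i* _)%C.
  by rewrite (_ : _ \o _ = cst 0) ?derive1_cst //; apply/funext.
have cI (f g : R -> R) (k : R -> R) :
   cintegral 0 (N%:R * h) (fun y => (f y +i* g y) * (k y)%:C^*)%C =
   ((\int[mu]_(y in `[0, (N%:R * h)]) (f y * k y)) +i* (\int[mu]_(y in `[0, (N%:R * h)]) (g y * k y)))%C.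
  rewrite /cintegral; congr (_ +i* _)%C; apply: eq_Rintegral => y _ /=; ring.
have h0' := ltW h0.
pose wR y := complex.Re (u y); pose wI y := complex.Im (u y).
have nR K (KN : (K < N)%N) := (nu K KN).1; have nI K (KN : (K < N)%N) := (nu K KN).2.
have cf (w : R -> R) : (forall K, (K < N)%N -> exists w1, C1 (K%:R * h) (K%:R * h + h) w w1) ->
  [/\ \int[mu]_(y in `[0, (N%:R * h)]) (derive1 w y * derive1 psi y) = \sum_(K < N) gal11 h (w (K%:R * h)) (w (K%:R * h + h)) (locmom (K%:R * h) h w) (Q K),
   \int[mu]_(y in `[0, (N%:R * h)]) (derive1 w y * psi y) = \sum_(K < N) gal10 (w (K%:R * h)) (w (K%:R * h + h)) (locmom (K%:R * h) h w) (Q K) &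
   \int[mu]_(y in `[0, (N%:R * h)]) (w y * psi y) = \sum_(K < N) gal00 h (locmom (K%:R * h) h w) (Q K)].
  move=> nw; have cells K (KN : (K < N)%N) : exists w1, C1 (K%:R * h) (K%:R * h + h) w w1 by exact: nw.
  split.
  - apply: (proj2 (@sum_cells _ N h _ (fun K => gal11 h (w (K%:R * h)) (w (K%:R * h + h)) (locmom (K%:R * h) h w) (Q K)) h0' _)).
    move=> K KN; have [w1 n1] := cells K KN.
    by have [] := @cell_forms (K%:R * h) h w w1 psi (Q K) h0 n1 (fun y => @fpsi K y KN).
  - apply: (proj2 (@sum_cells _ N h _ (fun K => gal10 (w (K%:R * h)) (w (K%:R * h + h)) (locmom (K%:R * h) h w) (Q K)) h0' _)).
    move=> K KN; have [w1 n1] := cells K KN.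
    by have [] := @cell_forms (K%:R * h) h w w1 psi (Q K) h0 n1 (fun y => @fpsi K y KN).
  - apply: (proj2 (@sum_cells _ N h _ (fun K => gal00 h (locmom (K%:R * h) h w) (Q K)) h0' _)).
    move=> K KN; have [w1 n1] := cells K KN.
    by have [] := @cell_forms (K%:R * h) h w w1 psi (Q K) h0 n1 (fun y => @fpsi K y KN).
have [r11 r10 r00] := cf wR nR; have [i11 i10 i00] := cf wI nI.
have eu y : cderive 1 u y = (derive1 wR y +i* derive1 wI y)%C by [].
rewrite (_ : (fun y => cderive 1 u y * (cderive 1 (fun y => (psi y)%:C) y)^*)%C =
   (fun y => (derive1 wR y +i* derive1 wI y) * (derive1 psi y)%:C^*)%C); last first.
  by apply/funext => y; rewrite dR eu.
rewrite (_ : (fun y => cderive 1 u y * ((psi y)%:C)^*)%C =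
   (fun y => (derive1 wR y +i* derive1 wI y) * (psi y)%:C^*)%C); last first.
  by apply/funext => y; rewrite eu.
rewrite (_ : (fun y => u y * ((psi y)%:C)^*)%C = (fun y => (wR y +i* wI y) * (psi y)%:C^*)%C); last first.
  by apply/funext => y; rewrite /wR /wI; case: (u y).
rewrite !cI r11 r10 r00 i11 i10 i00.
have sumC (f g : nat -> R) : ((\sum_(K < N) f K) +i* (\sum_(K < N) g K))%C = \sum_(K < N) (f K +i* g K)%C.
  by elim/big_rec3: _ => [//|i y1 y2 y3 _ <-].
rewrite (sumC (fun K => gal11 h (wR (K%:R * h)) (wR (K%:R * h + h)) (locmom (K%:R * h) h wR) (Q K))
  (fun K => gal11 h (wI (K%:R * h)) (wI (K%:R * h + h)) (locmom (K%:R * h) h wI) (Q K))).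
rewrite (sumC (fun K => gal10 (wR (K%:R * h)) (wR (K%:R * h + h)) (locmom (K%:R * h) h wR) (Q K))
  (fun K => gal10 (wI (K%:R * h)) (wI (K%:R * h + h)) (locmom (K%:R * h) h wI) (Q K))).
rewrite (sumC (fun K => gal00 h (locmom (K%:R * h) h wR) (Q K))
  (fun K => gal00 h (locmom (K%:R * h) h wI) (Q K))).
rewrite !mulr_sumr -!big_split /=; apply: eq_bigr => K _.
by rewrite cellgal_RC.
Qed.

(** At a node this uses the local representation on the right; continuity across
    the node makes the choice immaterial, and at the right end of the mesh
    it reads one representation beyond the last cell. *)
Definition glue h Q y : R := (Q (Num.truncn (y / h))).[y / h - (Num.truncn (y / h))%:R].

Lemma glue_follows N h Q : 0 < h ->
  (forall K, (K.+1 < N)%N -> (Q K).[1] = (Q K.+1).[0]) ->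
  (Q N.-1).[1] = (Q N).[0] -> follows N h (glue h Q) Q.
Proof.
move=> h0 Qc QN K y KN /andP[Ky yK].
have e : (y - K%:R * h) / h = y / h - K%:R by rewrite mulrBl mulfK ?gt_eqF.
rewrite e /glue; have k1 : K%:R <= y / h by rewrite ler_pdivlMr.
have k2 : y / h <= K.+1%:R by rewrite ler_pdivrMr // -natr1 mulrDl mul1r.
move: k2; rewrite le_eqVlt => /orP[/eqP ->|k2]; last first.
  by rewrite (@Num.Theory.truncn_def _ _ K) // k1.
rewrite natrK subrr -natr1 addrAC subrr add0r.
have [KN1|NK] := ltnP K.+1 N; first by rewrite Qc.
have eN : N = K.+1 by apply/eqP; rewrite eqn_leq KN NK.
by rewrite -eN -QN eN.
Qed.

Lemma follows_FTC N h psi Q : 0 < h -> follows N h psi Q ->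
  forall y, 0 <= y <= N%:R * h ->
  itg 0 y (derive1 psi) /\ \int[mu]_(z in `[0, y]) derive1 psi z = psi y - psi 0.
Proof.
move=> h0 fpsi.
suff H M : (M <= N)%N -> forall y, 0 <= y <= M%:R * h ->
    itg 0 y (derive1 psi) /\ \int[mu]_(z in `[0, y]) derive1 psi z = psi y - psi 0.
  by apply: H.
elim: M => [_ y|M IH MN y /andP[y0 yM]].
  rewrite mul0r -eq_le => /eqP <-; rewrite set_itv1 subrr; split; last exact: Rintegral_set1.
  by rewrite /itg set_itv1; apply/integrableP; rewrite integral_set1; split => //; exact: measurable_fun_set1.
have IH' := IH (ltnW MN).
have [yM'|My] := leP y (M%:R * h); first by apply: IH'; rewrite y0.
have M0 : 0 <= M%:R * h by rewrite mulr_ge0 // ltW.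
have [i1 e1] := IH' (M%:R * h) (introT andP (conj M0 (lexx _))).
have yh : y <= M%:R * h + h by move: yM; rewrite -natr1 mulrDl mul1r.
pose g := glob (M%:R * h) h (Q M).
have eg z : M%:R * h <= z <= y -> psi z = g.[z].
  by move=> /andP[mz zy]; rewrite (fpsi M) ?horner_glob // mz (le_trans zy).
have [_ _ epsi] := C1_poly My eg.
have [i2 e2] := poly_FTC g (ltW My).
have [] := @eq_itg _ (M%:R * h) y _ (derive1 psi) _ i2; first by move=> z zin; rewrite epsi.
move=> i3 e3; have [i4 e4] := itg_cat M0 (ltW My) i1 i3.
split => //; rewrite e4 e1 -e3 -e2 -!eg ?lexx ?(ltW My) //; ring.
Qed.

Lemma Lfun1_itg a b f : itg a b f -> f \_ `[a, b] \in Lfun mu 1%E.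
Proof.
move=> fi; apply/Lfun1_integrable; rewrite -restrict_EFin.
have mi : measurable `[a, b] by [].
by have [+ _] := integrable_mkcond (mu := mu) (EFin \o f) mi; apply.
Qed.

Lemma Lfun2_itg a b (f : R -> R) : itg a b f -> itg a b (fun y => f y ^+ 2) ->
  f \_ `[a, b] \in Lfun mu 2%:E.
Proof.
move=> fi f2i; rewrite inE; apply/andP; split; rewrite inE /=.
  case/integrableP: fi => mf _; have mi : measurable `[a, b] by [].
  by apply/(measurable_restrictT _ mi); apply/measurable_EFinP.
rewrite /finite_norm unlock; apply: poweR_lty.
have [_] := integrableP _ _ _ f2i; apply: le_lt_trans.
rewrite [leLHS]integral_mkcond [leRHS]integral_mkcond.
rewrite le_eqVlt; apply/orP; left; apply/eqP; congr (integral _ _ _).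
apply/funext => x; rewrite /= /patch in_setT; case: ifPn => _ /=; rewrite ?normr0 ?powR0 ?pnatr_eq0 //.
by rewrite normrX powR_mulrn.
Qed.

Lemma Lp_real p a b (f : R -> R) : f \_ `[a, b] \in Lfun mu p -> (p = 1%E \/ p = 2%:E) ->
  Lp p a b (fun y => (f y)%:C)%C.
Proof.
move=> fi hp; split => //; rewrite (_ : _ \_ _ = cst 0); last first.
  by apply/funext => x; rewrite /patch; case: ifP.
rewrite inE; apply/andP; split; rewrite inE /=; first exact: measurable_cst.
rewrite /finite_norm (_ : _ \o _ = cst 0%E) ?Lnorm0 ?ltry //.
by case: hp => ->; rewrite eqe ?oner_eq0 ?pnatr_eq0.
Qed.

Lemma Vh_follows N m p h Q psi : 0 < h -> (0 < N)%N -> follows N h psi Q ->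
  (forall K, (K < N)%N -> (size (Q K) <= (cell_degree N m p K).+1)%N) ->
  (Q 0%N).[0] = 0 -> (Q N.-1).[1] = 0 ->
  Vh (N%:R * h) N m p (fun y => (psi y)%:C)%C.
Proof.
move=> h0 N0 fpsi sQ Q0 Q1.
have N00 : (N%:R : R) != 0 by rewrite pnatr_eq0 -lt0n.
have dR : cderive 1 (fun y => (psi y)%:C)%C = fun y => (derive1 psi y)%:C%C.
  apply/funext => y; rewrite /cderive !derive1n1; congr (_ +i* _)%C.
  by rewrite (_ : _ \o _ = cst 0) ?derive1_cst //; apply/funext.
have ew : cell_width (N%:R * h) N = h by rewrite /cell_width mulrAC divff ?mul1r.
have FTC := follows_FTC h0 fpsi.
have Nh0 : 0 <= N%:R * h by rewrite mulr_ge0 // ltW.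
have cells (K : nat) (KN : (K < N)%N) : itg (K%:R * h) (K%:R * h + h) (fun y => (derive1 psi y) ^+ 2)
    /\ itg (K%:R * h) (K%:R * h + h) psi /\ itg (K%:R * h) (K%:R * h + h) (fun y => psi y ^+ 2).
  have Kh : K%:R * h < K%:R * h + h by rewrite ltrDl.
  have eg z : K%:R * h <= z <= K%:R * h + h -> psi z = (glob (K%:R * h) h (Q K)).[z].
    by move=> zin; rewrite (fpsi K) ?horner_glob.
  have [_ _ epsi] := C1_poly Kh eg.
  have pc (r : {poly R}) : itg (K%:R * h) (K%:R * h + h) (horner r).
    by apply: itg_continuous; apply: continuous_subspaceT; exact: continuous_horner.
  have oc y : K%:R * h < y < K%:R * h + h -> K%:R * h <= y <= K%:R * h + h by move=> /andP[/ltW -> /ltW ->].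
  split; last split.
  - have [] := @eq_itg _ (K%:R * h) (K%:R * h + h) _ (fun y => (derive1 psi y) ^+ 2) _ (pc (deriv (glob (K%:R * h) h (Q K)) ^+ 2)) => //.
    by move=> y yin; rewrite epsi // horner_exp.
  - have [] := @eq_itg _ (K%:R * h) (K%:R * h + h) _ psi _ (pc (glob (K%:R * h) h (Q K))) => //.
    by move=> y yin; rewrite eg // oc.
  - have [] := @eq_itg _ (K%:R * h) (K%:R * h + h) _ (fun y => psi y ^+ 2) _ (pc (glob (K%:R * h) h (Q K) ^+ 2)) => //.
    by move=> y yin; rewrite eg ?oc // horner_exp.
have tot f : (forall K, (K < N)%N -> itg (K%:R * h) (K%:R * h + h) f) -> itg 0 (N%:R * h) f.
  move=> hf; have [] := @sum_cells _ N h f (fun K => \int[mu]_(y in `[(K%:R * h), (K%:R * h + h)]) f y) (ltW h0) _ => //.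
  by move=> K KN; split => //; exact: hf.
split; last first.
  move=> K KN; exists (RC (glob (K%:R * h) h (Q K))); split.
    rewrite size_map_poly.
    apply: (leq_trans (size_comp_poly_leq _ _)); rewrite size_scale ?invr_eq0 ?gt_eqF // size_XsubC /= muln1.
    by rewrite ltnS -subn1 leq_subLR add1n; exact: sQ.
  rewrite ew => y; rewrite -natr1 mulrDl mul1r => yin.
  by rewrite RC_horner horner_glob -(fpsi K).
split.
- rewrite /abs_cont dR => x y /=; rewrite !in_itv /= => /andP[x0 xL] /andP[y0 yL] xy.
  have [i1 e1] := FTC x (introT andP (conj x0 xL)); have [i2 e2] := FTC y (introT andP (conj y0 yL)).
  have i3 : itg x y (derive1 psi) by apply: itgS i2.
  have [_ e4] := itg_cat x0 xy i1 i3.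
  split; first by apply: Lp_real; [exact: Lfun1_itg|left].
  rewrite /cintegral /=; have -> : \int[mu]_(x in `[x, y]) 0 = 0 :> R.
    by rewrite /Rintegral integral0.
  by rewrite -rmorphB /=; congr (_ +i* _)%C; lra.
- apply: Lp_real; last by right.
  by apply: Lfun2_itg; apply: tot => K KN; have [_ []] := cells K KN.
- rewrite dR; apply: Lp_real; last by right.
  apply: Lfun2_itg; last by apply: tot => K KN; have [] := cells K KN.
  by have [] := FTC _ (introT andP (conj Nh0 (lexx _))).
- rewrite (fpsi 0%N) // ?mul0r ?subrr ?mul0r ?Q0 //.
  by rewrite lexx add0r ltW.
- have e : N%:R * h = N.-1%:R * h + h by rewrite -{1}(prednK N0) -natr1 mulrDl mul1r.
  rewrite (fpsi N.-1) ?prednK //; last by rewrite e lerDl ltW //=.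
  by rewrite {1}e addrAC subrr add0r divff ?gt_eqF // Q1.
Qed.

End Pw.


(** * Error of the last cell from the orthogonality relations *)

Section Local.
Variable R : realType.
Local Notation C := R[i].
Local Notation RC := (map_poly (real_complex R)).
Implicit Types (p q : {poly C}) (s nu : nat -> C) (h b : R) (c : C).

Lemma rep_horner p (x : R) : (rep p).[x] = complex.Re p.[(x%:C)%C].
Proof.
rewrite {2}[p]poly_ReIm hornerD hornerZ !horner_map [in RHS]ReD /=.
by rewrite !(mul0r, mul1r, subr0, mulr0, addr0).
Qed.

Lemma imp_horner p (x : R) : (imp p).[x] = complex.Im p.[(x%:C)%C].
Proof.
rewrite {2}[p]poly_ReIm hornerD hornerZ !horner_map [in RHS]ImD /=.
by rewrite !(mul0r, mul1r, subr0, mulr0, add0r, addr0).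
Qed.

Lemma pairing_moments p q : pairing (fun j => integ (p * 'X^j)) q = integ (p * q).
Proof.
rewrite -{2}[q]coefK poly_def mulr_sumr raddf_sum; apply: eq_bigr => i _.
by rewrite -scalerAr /= integZ.
Qed.

Lemma cellgal_moments h b c p q : cellgal (h%:C)%C (b%:C)%C c p.[0] p.[1]
  (fun j => integ (p * 'X^j)) q = cellform h b c p q.
Proof.
rewrite /cellgal /gal11 /gal10 /gal00 !pairing_moments /cellform !integ_by_parts.
by rewrite fmorphV mulrA [c * _]mulrC; congr (_ * _ + _ + _); rewrite opprB addrCA; ring.
Qed.

(** Adding to the moments of chi a perturbation that no test polynomial of the
    cell sees through its second derivative produces the load of cellload. *)
Lemma cellgal_perturb h b c p nu q d : (size q <= d.+1)%N ->
  (forall i, (i < d.-1)%N -> nu i = 0) ->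
  cellgal (h%:C)%C (b%:C)%C c p.[0] p.[1] (fun j => integ (p * 'X^j) + nu j) q =
  cellform h b c p q - cellload h b c nu q.
Proof.
move=> sq nu0; rewrite -cellgal_moments /cellload /cellgal /gal11 /gal10 /gal00.
rewrite !pairingDl (_ : pairing nu (deriv (deriv q)) = 0); first by ring.
rewrite /pairing big1 // => i _; rewrite nu0 ?mulr0 //.
apply: (leq_trans (ltn_ord i)); apply: (leq_trans (size_deriv_le (size_deriv_le (leqnn _)))).
by case: (size q) sq => [|[|j]] //; rewrite !ltnS; case: d {nu0}.
Qed.

(** The relations are linear in the test function, so its real and imaginary
    parts may be tested separately. *)
Lemma galerkin_complex N deg h b c (e : nat -> C) (s : nat -> nat -> C) : (0 < N)%N ->
  (forall Q : nat -> {poly R}, (forall K, (K < N)%N -> (size (Q K) <= (deg K).+1)%N) ->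
     (Q 0%N).[0] = 0 -> (Q N.-1).[1] = 0 ->
     (forall K, (K.+1 < N)%N -> (Q K).[1] = (Q K.+1).[0]) ->
     \sum_(K < N) cellgal (h%:C)%C (b%:C)%C c (e K) (e K.+1) (s K) (RC (Q K)) = 0) ->
  forall psi, conforming N deg psi ->
  \sum_(K < N) cellgal (h%:C)%C (b%:C)%C c (e K) (e K.+1) (s K) (psi K) = 0.
Proof.
move=> N0 H psi [sp p0 p1 pc].
have r0 (P : {poly C}) : ((rep P).[0] = complex.Re P.[0]) * ((imp P).[0] = complex.Im P.[0]).
  by have := rep_horner P 0; have := imp_horner P 0; rewrite rmorph0.
have r1 (P : {poly C}) : ((rep P).[1] = complex.Re P.[1]) * ((imp P).[1] = complex.Im P.[1]).
  by have := rep_horner P 1; have := imp_horner P 1; rewrite rmorph1.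
have e1 := H (fun K => rep (psi K)); have e2 := H (fun K => imp (psi K)).
transitivity ('i%C * \sum_(K < N) cellgal (h%:C)%C (b%:C)%C c (e K) (e K.+1) (s K) (RC (imp (psi K)))
   + \sum_(K < N) cellgal (h%:C)%C (b%:C)%C c (e K) (e K.+1) (s K) (RC (rep (psi K)))).
  rewrite mulr_sumr -big_split /=; apply: eq_bigr => K _.
  by rewrite -cellgal_linear addrC -poly_ReIm.
rewrite e1 ?e2 ?mulr0 ?addr0 //.
- by move=> K KN; apply: (leq_trans (size_poly _ _)); exact: sp.
- by rewrite r0 p0.
- by rewrite r1 p1.
- by move=> K KN; rewrite r0 r1 pc.
- by move=> K KN; apply: (leq_trans (size_poly _ _)); exact: sp.
- by rewrite r0 p0.
- by rewrite r1 p1.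
- by move=> K KN; rewrite r0 r1 pc.
Qed.

(** A function that enters only through its end values e0, e1 and its moments s
    is close to S in all the data through which the form sees it. *)
Definition near_poly k (e0 e1 : C) s (S : {poly C}) (r : R) :=
  [/\ modulus (e0 - S.[0]) <= r, modulus (e1 - S.[1]) <= r &
      forall j, (j <= k)%N -> modulus (s j - integ (S * 'X^j)) <= r].

(** The interpolation error is estimated through S: the interpolant of S is S
    itself, so chi - S interpolates data of size r. *)
Lemma interp_close d k : (0 < d)%N -> (d <= k)%N -> exists2 K : R, 0 <= K &
  forall (chi S : {poly C}) s (r : R), 0 <= r -> (size chi <= d.+1)%N -> (size S <= d.+1)%N ->
  (forall j, (j < d.-1)%N -> integ (chi * 'X^j) = s j) ->
  near_poly k chi.[0] chi.[1] s S r ->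
  tail 0 (chi - S) <= K * r /\
  forall j, (j <= k)%N -> modulus (s j - integ (chi * 'X^j)) <= (1 + K) * r.
Proof.
move=> d0 dk; have [K K0 hK] := interp_bound R d0; exists K => //.
move=> chi S s r r0 schi sS hs [h0 h1 hj].
have t : tail 0 (chi - S) <= K * r.
  apply: hK => //.
  - by apply: (leq_trans (size_polyD _ _)); rewrite geq_max schi size_polyN.
  - by rewrite hornerD hornerN.
  - by rewrite hornerD hornerN.
  - move=> j jd; rewrite mulrBl integB hs //; apply: hj.
    by apply: (leq_trans (ltnW jd)); apply: (leq_trans (leq_pred _)).
split=> // j jk.
have -> : s j - integ (chi * 'X^j) = (s j - integ (S * 'X^j)) - integ ((chi - S) * 'X^j).
  by rewrite mulrBl integB; ring.
apply: (le_trans (modulusB _ _)); rewrite [leRHS]mulrDl mul1r lerD ?hj //.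
by apply: (le_trans (modulus_integ _)); apply: (le_trans (tail_mulXn _ _)).
Qed.

(** Two approximations of the error enter on the last cell: S, with the accuracy r
    available on all cells, in the estimate at the node, and S', with the
    accuracy r' that the higher degree m + p permits, in the estimate on the
    cell itself. *)
Lemma last_cell_bound (m p n : nat) (L kappa : R) : 0 < L -> 0 <= kappa -> (0 < m)%N ->
  exists2 A : R, 0 <= A &
  forall M h b c (D : R) (e : nat -> C) (s : nat -> nat -> C) (S : nat -> {poly C})
    (S' : {poly C}) (r r' : R), 0 < h ->
  M.+1%:R * h = L -> 0 < complex.Re c -> 1 <= D -> `|b| <= kappa * D ->
  modulus c <= kappa * D ^+ 2 -> 0 <= r -> 0 <= r' ->
  e 0%N = 0 -> e M.+1 = 0 ->
  (forall K, (K <= M)%N -> (size (S K) <= (cell_degree M.+1 m p K).+1)%N /\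
     near_poly (m + p) (e K) (e K.+1) (s K) (S K) r) ->
  (size S' <= (m + p).+1)%N -> near_poly (m + p) (e M) (e M.+1) (s M) S' r' ->
  (forall psi, conforming M.+1 (cell_degree M.+1 m p) psi ->
    \sum_(K < M.+1) cellgal (h%:C)%C (b%:C)%C c (e K) (e K.+1) (s K) (psi K) = 0) ->
  tail n S' <= A * ((D * h) ^+ n * (Num.max 2 (2 / (D * h)) * D ^+ 2 *
     (r * D ^+ (m + 3) * h ^+ m)) + D ^+ 2 * r').
Proof.
move=> L0 k0 m0; have kpos : (0 < m + p)%N by rewrite addn_gt0 m0.
have [A1 A10 hA1] := nodal_estimate (m + p) L0 k0 m0.
have [A2 A20 hA2] := boundary_cell_estimate n L0 k0 kpos.
have [K1 K10 hK1] := interp_close m0 (leq_addr p m).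
have [K2 K20 hK2] := interp_close kpos (leqnn _).
pose B := 1 + K1 + K2; have B1 : 1 <= B by rewrite /B; lra.
have B0 : 0 <= B by lra.
have BK1 : 1 + K1 <= B by rewrite /B lerDl.
have BK2 : 1 + K2 <= B by rewrite /B addrAC lerDl.
exists (A2 * (A1 * B + B) + K2); first by rewrite addr_ge0 // mulr_ge0 // addr_ge0 // mulr_ge0.
move=> M h b c D e s S S' r r' h0 hL c0 D1 hb hc r0 r'0 e0 eM hS sS' hS' gal.
set deg := cell_degree M.+1 m p in hS gal *.
have degE K : deg K = m \/ deg K = (m + p)%N.
  by rewrite /deg /cell_degree; case: ifP => _; [right|left].
have degM : deg M = (m + p)%N by rewrite /deg /cell_degree eqxx orbT.
have hdeg K : (m <= deg K <= m + p)%N by case: (degE K) => ->; rewrite leqnn ?leq_addr.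
have deg0 K : (0 < deg K)%N by case/andP: (hdeg K) => /(leq_trans m0).
(* chi interpolates the error; nu collects the moments left over *)
pose chi K := projT1 (cid (interp_exists (e K) (e K.+1) (s K) (deg0 K))).
have hchi K : [/\ (size (chi K) <= (deg K).+1)%N, (chi K).[0] = e K, (chi K).[1] = e K.+1 &
    forall j, (j < (deg K).-1)%N -> integ (chi K * 'X^j) = s K j].
  by rewrite /chi; case: cid.
pose nu K j := s K j - integ (chi K * 'X^j).
have nu0 K i : (i < (deg K).-1)%N -> nu K i = 0.
  by move=> id; rewrite /nu; case: (hchi K) => _ _ _ -> //; rewrite subrr.
have cchi : conforming M.+1 deg chi.
  split; first by move=> K _; case: (hchi K).
  - by case: (hchi 0%N) => _ ->.
  - by case: (hchi M) => _ _ ->.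
  - by move=> K _; case: (hchi K) => _ _ -> _; case: (hchi K.+1) => _ -> _.
have nuB K i : (K <= M)%N -> (i <= m + p)%N -> modulus (nu K i) <= B * r.
  move=> KM ik; have [sS nS] := hS _ KM; have [s1 s2 s3 s4] := hchi K.
  have nS' : near_poly (m + p) (chi K).[0] (chi K).[1] (s K) (S K) r by rewrite s2 s3.
  rewrite /nu; case: (degE K) => dK; rewrite dK in sS s1 s4.
    have [_ /(_ _ ik) /le_trans] := hK1 _ _ _ _ r0 s1 sS s4 nS'; apply.
    by rewrite ler_wpM2r.
  have [_ /(_ _ ik) /le_trans] := hK2 _ _ _ _ r0 s1 sS s4 nS'; apply.
  by rewrite ler_wpM2r.
have [s1 s2 s3 s4] := hchi M; rewrite degM in s1 s4.
have nS'' : near_poly (m + p) (chi M).[0] (chi M).[1] (s M) S' r' by rewrite s2 s3.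
have [tS' nuM'] := hK2 _ _ _ _ r'0 s1 sS' s4 nS''.
have nuB' i : (i <= m + p)%N -> modulus (nu M i) <= B * r'.
  by move=> /nuM' /le_trans; apply; rewrite ler_wpM2r.
have cell K (q : {poly C}) : (size q <= (deg K).+1)%N ->
  cellgal (h%:C)%C (b%:C)%C c (e K) (e K.+1) (s K) q = cellform h b c (chi K) q - cellload h b c (nu K) q.
  move=> sq; rewrite -(@cellgal_perturb _ _ _ _ _ _ (deg K)) //; last by move=> i; exact: nu0.
  have [_ -> -> _] := hchi K; congr (cellgal _ _ _ _ _ _ _).
  by apply/funext => j; rewrite /nu addrC subrK.
have gal' psi : conforming M.+1 deg psi ->
    formh M.+1 h b c chi psi = \sum_(K < M.+1) cellload h b c (nu K) (psi K).
  move=> cpsi; apply/eqP; rewrite -subr_eq0 -sumrB -[eqbRHS](gal _ cpsi); apply/eqP.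
  by apply: eq_bigr => K _; rewrite cell //; case: cpsi => sp _ _ _; exact: sp.
have hx : modulus (chi M).[0] <= A1 * (B * r * D ^+ (m + 3) * h ^+ m).
  apply: (hA1 M deg h b c D chi nu) => //; last by move=> K i _; exact: nu0.
  exact: mulr_ge0.
have hL' : h <= L by rewrite -hL ler_peMl ?ler1n // ltW.
have ht := hA2 h b c D (chi M) (nu M) (B * r') h0 hL' c0 D1 hb hc s1 (etrans s3 eM)
  (mulr_ge0 B0 r'0) nuB' _.
have {ht} : tail n (chi M) <= A2 * ((D * h) ^+ n * (Num.max 2 (2 / (D * h)) * D ^+ 2 * modulus (chi M).[0])
   + D ^+ 2 * (B * r')).
  apply: ht => psi spsi p0 p1.
  have cq : conforming M.+1 deg (on_cell M psi) by apply: conforming_on_cell; rewrite ?degM.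
  have := gal' _ cq; rewrite /formh.
  rewrite (@sum_on_cell _ M M psi (fun K q => cellform h b c (chi K) q)) //; last first.
    by move=> K; rewrite /cellform deriv0 !mulr0 /integ !linear0 !mulr0 !addr0.
  rewrite (@sum_on_cell _ M M psi (fun K q => cellload h b c (nu K) q)) // => K.
  by rewrite /cellload deriv0 !linear0 !mulr0 subr0.
move=> ht; have -> : S' = chi M - (chi M - S') by rewrite subKr.
apply: (le_trans (tailB _ _ _)).
have D0 : 0 <= D := le_trans ler01 D1.
pose X := (D * h) ^+ n * (Num.max 2 (2 / (D * h)) * D ^+ 2).
have EX w : (D * h) ^+ n * (Num.max 2 (2 / (D * h)) * D ^+ 2 * w) = X * w.
  by rewrite /X mulrA.
have X0 : 0 <= X.
  rewrite mulr_ge0 ?exprn_ge0 ?mulr_ge0 ?sqr_ge0 ?(ltW h0) //.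
  by rewrite le_max ler0n.
have D2 : 1 <= D ^+ 2 by rewrite expr_ge1.
have t2 : tail n (chi M - S') <= K2 * r' by apply: le_trans tS'; exact: tail_anti.
rewrite !EX in ht *; move: ht hx; set x := modulus _ => ht hx.
pose W := r * D ^+ (m + 3) * h ^+ m.
have W0 : 0 <= W by rewrite !mulr_ge0 // exprn_ge0 // ltW.
have {}hx : X * x <= A1 * B * (X * W).
  by rewrite mulrCA ler_wpM2l //; apply: (le_trans hx); rewrite /W -!mulrA.
have {}t2 : tail n (chi M - S') <= K2 * (D ^+ 2 * r').
  by apply: (le_trans t2); rewrite ler_wpM2l // ler_peMl.
have V0 : 0 <= D ^+ 2 * r' by rewrite mulr_ge0 // sqr_ge0.
rewrite -/W; move: ht t2 V0 (mulr_ge0 X0 W0) hx.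
have -> : D ^+ 2 * (B * r') = B * (D ^+ 2 * r') by ring.
move: (X * x) (X * W) (D ^+ 2 * r') (tail n (chi M)) (tail n (chi M - S')) => z w v t1 t3 ht t2 v0 w0 hz.
have e1 : t1 <= A2 * (A1 * B * w + B * v).
  by apply: (le_trans ht); rewrite ler_wpM2l // lerD2r.
have f1 : 0 <= A2 * B * w by rewrite !mulr_ge0.
have f2 : 0 <= A2 * (A1 * B) * v by rewrite !mulr_ge0.
have f3 := mulr_ge0 K20 w0.
lra.
Qed.

End Local.


(** * Essential bounds and regularity of the exact solution *)

Section Regularity.
Variable R : realType.
Local Notation mu := (@lebesgue_measure R).
Local Notation C := R[i].
Local Open Scope classical_set_scope.
Implicit Types (a b x y h M : R) (w : R -> R) (f u : R -> C).

Lemma mu_setT_gt0 : (0 < mu [set: R])%E.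
Proof. rewrite -set_itvNyy lebesgue_measure_itv /= addye // ltry. Qed.

Lemma Linf_restrictP a b w M :
  ('N[mu]_+oo[EFin \o (w \_ `[a, b])] <= M%:E)%E <-> {ae mu, forall x, `|(w \_ `[a, b]) x| <= M}.
Proof.
rewrite unlock mu_setT_gt0; split.
  by move/ess_supP; apply: (@filterS _ _ (ae_filter_ringOfSetsType mu)) => x; rewrite /= lee_fin.
by move=> h; apply/ess_supP; move: h; apply: (@filterS _ _ (ae_filter_ringOfSetsType mu)) => x; rewrite /= lee_fin.
Qed.

Lemma ae_neq a : {ae mu, forall x, x != a}.
Proof.
exists [set a]; split => //; first by rewrite lebesgue_measure_set1.
by move=> x /= /negP; rewrite negbK => /eqP.
Qed.

Lemma Linf_normP a b f M : 0 <= M ->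
  (Linf_norm a b f <= M%:E)%E <-> {ae mu, forall x, a < x < b -> modulus (f x) <= M}.
Proof.
move=> M0; rewrite /Linf_norm Linf_restrictP; split.
  apply: (@filterS _ _ (ae_filter_ringOfSetsType mu)) => x + xab.
  rewrite /patch mem_set ?ger0_norm ?modulus_ge0 //= in_itv /=.
  by case/andP: xab => /ltW -> /ltW ->.
move=> hf; apply: (@filterS3 _ _ (ae_filter_ringOfSetsType mu) _ _ _ _ _ hf (ae_neq a) (ae_neq b)).
move=> x hx xa xb; rewrite /patch; case: ifPn; last by rewrite normr0.
rewrite inE /= in_itv /= ger0_norm ?modulus_ge0 // => /andP[ax xb'].
by apply: hx; rewrite !lt_neqAle eq_sym xa ax xb xb'.
Qed.

Lemma Linf_norm_ge0 a b f : (0 <= Linf_norm a b f)%E.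
Proof. exact: Lnorm_ge0. Qed.

Lemma Lfun_oo_ae a b w : w \_ `[a, b] \in Lfun mu +oo%E ->
  exists2 M, 0 <= M & {ae mu, forall x, `|(w \_ `[a, b]) x| <= M}.
Proof.
rewrite inE => /andP[_]; rewrite inE /= /finite_norm => fin.
have n0 : (0 <= 'N[mu]_+oo[EFin \o (w \_ `[a, b])])%E by exact: Lnorm_ge0.
have e : ('N[mu]_+oo[EFin \o (w \_ `[a, b])] = (fine 'N[mu]_+oo[EFin \o (w \_ `[a, b])])%:E)%E.
  by rewrite fineK // ge0_fin_numE.
exists (fine 'N[mu]_+oo[EFin \o (w \_ `[a, b])]%E); first exact: fine_ge0.
by apply/Linf_restrictP; rewrite {1}e.
Qed.

Lemma Linf_fin a b f : Lp +oo%E a b f -> exists2 M, 0 <= M & Linf_norm a b f = M%:E.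
Proof.
move=> [/Lfun_oo_ae[M1 M10 h1] /Lfun_oo_ae[M2 M20 h2]].
have hM : (Linf_norm a b f <= (M1 + M2)%:E)%E.
  apply/Linf_normP; first exact: addr_ge0.
  apply: (@filterS2 _ _ (ae_filter_ringOfSetsType mu) _ _ _ _ h1 h2) => x; rewrite /patch => g1 g2 xab.
  move: g1 g2; rewrite mem_set /= ?in_itv /=; last by case/andP: xab => /ltW -> /ltW ->.
  by move=> g1 g2; apply: (le_trans (modulus_le_ReIm _)); exact: lerD.
exists (fine (Linf_norm a b f)); first by apply: fine_ge0; exact: Linf_norm_ge0.
by rewrite fineK // ge0_fin_numE ?Linf_norm_ge0 // (le_lt_trans hM) // ltry.
Qed.

Lemma Lfun_oo_itg a b w : w \_ `[a, b] \in Lfun mu +oo%E -> itg a b w.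
Proof.
move=> hw; have [M M0 hM] := Lfun_oo_ae hw.
have mi : measurable `[a, b] by [].
have mw : measurable_fun `[a, b] w.
  apply/(measurable_restrictT _ mi); move: hw; rewrite inE => /andP[].
  by rewrite inE.
apply/integrableP; split; first by apply/measurable_EFinP.
apply: (@le_lt_trans _ _ (\int[mu]_(x in `[a, b]) (cst M%:E x))%E).
  apply: ae_ge0_le_integral => //.
  - by apply/measurable_EFinP; apply: measurableT_comp.
  - apply: (@filterS _ _ (ae_filter_ringOfSetsType mu) _ _ _ hM) => x hx xab.
    by move: hx; rewrite /patch mem_set //= lee_fin.
rewrite integral_cst //; apply: lte_mul_pinfty; rewrite ?lee_fin //.
have := @lebesgue_measure_itv R `[a, b]%R; rewrite /= => ->.
by case: ifP => _; rewrite ?ltry // -EFinB ltry.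
Qed.

Lemma Lfun1_itgP a b w : w \_ `[a, b] \in Lfun mu 1%E -> itg a b w.
Proof.
move=> /Lfun1_integrable; rewrite -restrict_EFin => hi.
have mi : measurable `[a, b] by [].
by have [_ +] := integrable_mkcond (mu := mu) (EFin \o w) mi; apply.
Qed.

Lemma abs_cont_primitive a b f : abs_cont `]a, b[ f ->
  primitive a b (@complex.Re R \o f) (derive1 (@complex.Re R \o f)) /\
  primitive a b (@complex.Im R \o f) (derive1 (@complex.Im R \o f)).
Proof.
move=> hf; have main x y : a < x -> x <= y -> y < b ->
    (itg x y (derive1 (@complex.Re R \o f)) /\ itg x y (derive1 (@complex.Im R \o f))) /\
    f y - f x = cintegral x y (cderive 1 f).
  move=> ax xy yb; have [||[h1 h2] e] := hf x y _ _ xy.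
  - by rewrite /= in_itv /= ax (le_lt_trans xy).
  - by rewrite /= in_itv /= yb (lt_le_trans ax).
  by split=> //; split; exact: Lfun1_itgP.
split=> x y ax xy yb; have [[h1 h2] e] := main x y ax xy yb; split => //.
  by have := congr1 (@complex.Re R) e; rewrite ReD ReN.
by have := congr1 (@complex.Im R) e; rewrite ImD ImN.
Qed.

Lemma abs_cont_continuous L f : 0 < L -> abs_cont `[0, L] f ->
  {within `[0, L], continuous (@complex.Re R \o f)} /\
  {within `[0, L], continuous (@complex.Im R \o f)}.
Proof.
move=> L0 hf; have in0 : `[0, L] 0 by rewrite /= in_itv /= lexx ltW.
have inL : `[0, L] L by rewrite /= in_itv /= lexx ltW.
have [[/Lfun1_itgP i1 /Lfun1_itgP i2] _] := hf _ _ in0 inL (ltW L0).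
have c w w' : itg 0 L w' -> (forall y, 0 <= y <= L -> w y - w 0 = \int[mu]_(x in `[0, y]) w' x) ->
    {within `[0, L], continuous w}.
  move=> iw' ew; have cI := parameterized_integral_continuous (ltW L0) iw'.
  have cI' : {within `[0, L], continuous (fun y => \int[mu]_(x in `[0, y]) w' x + w 0)}.
    by move=> z; apply: cvgD; [exact: cI|exact: cvg_cst].
  apply: (@subspace_eq_continuous _ _ _ _ _ _ cI') => y; rewrite inE /= in_itv /= => yin.
  by rewrite /from_subspace -ew // subrK.
split; [apply: (c _ _ i1)|apply: (c _ _ i2)] => y /andP[y0 yL];
  have yin : `[0, L] y by rewrite /= in_itv /= y0.
  by have [_ /(congr1 (@complex.Re R))] := hf 0 y in0 yin y0; rewrite ReD ReN.
by have [_ /(congr1 (@complex.Im R))] := hf 0 y in0 yin y0; rewrite ImD ImN.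
Qed.

Lemma C1_sub a b x y w w1 : a <= x -> x < y -> y <= b ->
  (forall z, a < z < b -> derivable w z 1) -> {within `[a, b], continuous w} ->
  {within `[a, b], continuous w1} -> (forall z, a < z < b -> derive1 w z = w1 z) ->
  C1 x y w w1.
Proof.
move=> ax xy yb dw cw cw1 ew.
have sub : `[x, y] `<=` `[a, b].
  by move=> z /=; rewrite !in_itv /= => /andP[xz zy]; rewrite (le_trans ax) //= (le_trans zy).
have oo z : x < z < y -> a < z < b.
  by move=> /andP[xz zy]; rewrite (le_lt_trans ax) //= (lt_le_trans zy).
have cw' := continuous_subspaceW sub cw.
split; last by move=> z zxy; apply: ew; exact: oo.
  have /(continuous_within_itvP _ xy)[_ c1 c2] := cw'.
  by split => // z; rewrite in_itv /= => zxy; apply: dw; exact: oo.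
exact: continuous_subspaceW sub cw1.
Qed.

(** Integrability of the second derivative extends the first one continuously to
    the end points. *)
Lemma C1_primitive L w w2 : 0 < L -> {within `[0, L], continuous w} ->
  primitive 0 L w (derive1 w) -> itg 0 L (derive1 w) ->
  primitive 0 L (derive1 w) w2 -> itg 0 L w2 ->
  forall x y, 0 <= x -> x < y -> y <= L -> exists w1, C1 x y w w1.
Proof.
move=> L0 cw a1 i1 a2 i2 x y x0 xy yL.
have [w1 cw1 ew1] := primitive_extend L0 a2 i2.
have c1 := primitive_continuous a2 i2.
exists w1; apply: (@C1_sub 0 L) => //.
  by move=> z zin; have [] := primitive_derivable a1 i1 zin (c1 z zin).
by move=> z zin; rewrite ew1.
Qed.

End Regularity.


(** * The error on one cell *)

Section CellError.
Variable R : realType.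
Local Notation mu := (@lebesgue_measure R).
Local Notation C := R[i].
Local Notation RC := (map_poly (real_complex R)).
Local Open Scope classical_set_scope.
Implicit Types (a b x y h : R) (w : R -> R) (f u v : R -> C).

(** A bound in the open cell extends to its end points by continuity. *)
Lemma within_end x h w (q : {poly R}) (r : R) : 0 < h ->
  {within `[x, x + h], continuous w} ->
  (forall y, x < y < x + h -> `|w y - q.[(y - x) / h]| <= r) ->
  `|w x - q.[0]| <= r /\ `|w (x + h) - q.[1]| <= r.
Proof.
move=> h0 cw hw; have xh : x < x + h by rewrite ltrDl.
pose d y := `|w y - q.[(y - x) / h]|.
have cd : {within `[x, x + h], continuous d}.
  move=> z; apply: cvg_norm; apply: cvgB; first exact: cw.
  exact: continuous_glob.
have /(continuous_within_itvP _ xh)[_ c1 c2] := cd.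
have e1 : d x = `|w x - q.[0]| by rewrite /d subrr mul0r.
have e2 : d (x + h) = `|w (x + h) - q.[1]|.
  by rewrite /d addrAC subrr add0r divff ?gt_eqF.
rewrite -e1 -e2; split.
  apply: (closed_cvg (fun z : R => z <= r) _ _ _ c1); first exact: closed_le.
  near=> y; apply: hw; apply/andP; split; near: y; first exact: nbhs_right_gt.
  exact: nbhs_right_lt.
apply: (closed_cvg (fun z : R => z <= r) _ _ _ c2); first exact: closed_le.
near=> y; apply: hw; apply/andP; split; near: y; first exact: nbhs_left_gt.
exact: nbhs_left_lt.
Unshelve. all: by end_near. Qed.

Definition follows_cell x h v (q : {poly C}) :=
  forall y, x <= y <= x + h -> v y = q.[(((y - x) / h)%:C)%C].

Lemma follows_cell_ends x h v q : 0 < h -> follows_cell x h v q ->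
  v x = q.[0] /\ v (x + h) = q.[1].
Proof.
move=> h0 vq; split; rewrite vq ?lexx ?lerDl ?(ltW h0) ?andbT //.
  by rewrite subrr mul0r rmorph0.
by rewrite addrAC subrr add0r divff ?gt_eqF // rmorph1.
Qed.

Lemma C1_follows x h v q : 0 < h -> follows_cell x h v q ->
  (exists w1, C1 x (x + h) (fun y => complex.Re (v y)) w1) /\
  (exists w1, C1 x (x + h) (fun y => complex.Im (v y)) w1).
Proof.
move=> h0 vq; have xh : x < x + h by rewrite ltrDl.
split; [exists (horner (deriv (glob x h (rep q))))|exists (horner (deriv (glob x h (imp q))))];
  apply: C1_poly => // y yin.
  by rewrite vq // horner_glob rep_horner.
by rewrite vq // horner_glob imp_horner.
Qed.

Lemma integ_ReIm (q : {poly C}) j :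
  integ (q * 'X^j) = (integ (rep q * 'X^j) +i* integ (imp q * 'X^j))%C.
Proof.
rewrite {1}[q]poly_ReIm mulrDl -scalerAl integD integZ.
rewrite -(map_polyXn (real_complex R)) -!rmorphM !integ_map /=.
by simpc.
Qed.

Lemma cmom_follows x h v q j : 0 < h -> follows_cell x h v q ->
  cmom x h v j = integ (q * 'X^j).
Proof.
move=> h0 vq; rewrite integ_ReIm /cmom -!(@locmom_poly _ x h) //.
have oc y : x < y < x + h -> x <= y <= x + h by move=> /andP[/ltW -> /ltW ->].
congr (_ +i* _)%C; apply/esym; apply: eq_locmom; try exact: continuous_glob.
  by move=> y /oc yin; rewrite vq // rep_horner.
by move=> y /oc yin; rewrite vq // imp_horner.
Qed.

Lemma cell_near x h u v q (TR TI : {poly R}) (r : R) k : 0 < h -> 0 <= r ->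
  {within `[x, x + h], continuous (fun y => complex.Re (u y))} ->
  {within `[x, x + h], continuous (fun y => complex.Im (u y))} ->
  (forall y, x < y < x + h -> `|complex.Re (u y) - TR.[(y - x) / h]| <= r) ->
  (forall y, x < y < x + h -> `|complex.Im (u y) - TI.[(y - x) / h]| <= r) ->
  follows_cell x h v q ->
  near_poly k (u x - v x) (u (x + h) - v (x + h))
    (fun j => cmom x h u j - cmom x h v j) (RC TR + 'i%C *: RC TI - q) (2 * r).
Proof.
move=> h0 r0 cR cI hR hI vq; have [v0 v1] := follows_cell_ends h0 vq.
have [R0 R1] := within_end h0 cR hR; have [I0 I1] := within_end h0 cI hI.
have modle (z : C) (t1 t2 : R) : `|complex.Re z - t1| <= r -> `|complex.Im z - t2| <= r ->
    modulus (z - ((t1%:C)%C + 'i%C * (t2%:C)%C)) <= 2 * r.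
  move=> g1 g2; apply: (le_trans (modulus_le_ReIm _)).
  rewrite ReD ImD ReN ImN ReD ImD /=; simpc.
  by rewrite mulr2n mulrDl mul1r lerD.
have RC0 (P : {poly R}) : (RC P).[0] = (P.[0]%:C)%C by rewrite -{1}(rmorph0 (real_complex R)) horner_map.
have RC1 (P : {poly R}) : (RC P).[1] = (P.[1]%:C)%C by rewrite -{1}(rmorph1 (real_complex R)) horner_map.
split.
- rewrite v0 !hornerE !RC0 opprB addrA subrK; exact: modle.
- rewrite v1 !hornerE !RC1 opprB addrA subrK; exact: modle.
move=> j _; rewrite (cmom_follows _ h0 vq) mulrBl integB opprB addrA subrK.
rewrite mulrDl -scalerAl integD integZ -(map_polyXn (real_complex R)) -!rmorphM !integ_map.
apply: modle; exact: locmom_close.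
Qed.

Lemma Vh_local L N m p psi K : 0 < L -> (0 < N)%N -> Vh L N m p psi -> (K < N)%N ->
  let h := cell_width L N in
  exists2 q : {poly C}, (size q <= (cell_degree N m p K).+1)%N &
    follows_cell (K%:R * h) h psi q.
Proof.
move=> L0 N0 [_ hV] KN h; have [P [sP eP]] := hV K KN.
have h0 : 0 < h by rewrite divr_gt0 ?ltr0n.
exists (P \Po ((h%:C)%C *: 'X + ((K%:R * h)%:C)%C%:P)).
  apply: (leq_trans (size_comp_poly_leq _ _)).
  have hn : (h%:C)%C != 0 :> C by rewrite fmorph_eq0 gt_eqF.
  rewrite size_polyDl size_scale ?size_polyX //; last by rewrite ltnS size_polyC_leq1.
  by rewrite muln1 ltnS -subn1 leq_subLR add1n.
move=> y yin; rewrite eP; last by rewrite -natr1 mulrDl mul1r.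
rewrite horner_comp !hornerE -!rmorphM -rmorphD /=; congr (P.[(_)%:C]%C).
by rewrite mulrCA mulfV ?gt_eqF // mulr1 subrK.
Qed.

Lemma taylor_cell x h u r (U : R) : 0 < h -> 0 <= U ->
  (forall j, (j <= r)%N -> abs_cont `]x, x + h[ (cderive j u)) ->
  {ae mu, forall y, x < y < x + h -> modulus (cderive r.+1 u y) <= U} ->
  exists TR TI : {poly R}, [/\ (size TR <= r.+1)%N, (size TI <= r.+1)%N &
    forall j, (j <= r)%N -> forall y, x < y < x + h ->
    `|complex.Re (cderive j u y) - h ^- j * (derivn j TR).[(y - x) / h]| <= U * h ^+ (r.+1 - j) /\
    `|complex.Im (cderive j u y) - h ^- j * (derivn j TI).[(y - x) / h]| <= U * h ^+ (r.+1 - j)].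
Proof.
move=> h0 U0 hu hU.
have [||TR sR hR] := @taylor_approx _ x h U r h0 U0 (fun j => derive1n j (@complex.Re R \o u)).
- by move=> j jr; have [g1 _] := abs_cont_primitive (hu j jr); rewrite derive1nS; exact: g1.
- apply: (@filterS _ _ (ae_filter_ringOfSetsType mu) _ _ _ hU) => y hy yin.
  exact: le_trans (normr_Re_le _) (hy yin).
have [||TI sI hI] := @taylor_approx _ x h U r h0 U0 (fun j => derive1n j (@complex.Im R \o u)).
- by move=> j jr; have [_ g1] := abs_cont_primitive (hu j jr); rewrite derive1nS; exact: g1.
- apply: (@filterS _ _ (ae_filter_ringOfSetsType mu) _ _ _ hU) => y hy yin.
  exact: le_trans (normr_Im_le _) (hy yin).
exists TR, TI; split => // j jr y yin; split; [exact: hR|exact: hI].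
Qed.

(** The iterated derivative of W inside the interval depends on W near the point
    only, so W may differ from w - q elsewhere. *)
Lemma derive1n_subpoly a b w W (q : {poly R}) n :
  (forall j, (j < n)%N -> forall y, a < y < b -> derivable (derive1n j w) y 1) ->
  (forall y, a < y < b -> W y = w y - q.[y]) ->
  forall y, a < y < b -> derive1n n W y = derive1n n w y - (derivn n q).[y].
Proof.
move=> dw eW; elim: n dw => [|n IH] dw y yin; first by rewrite !derive1n0 derivn0 eW.
have IH' := IH (fun j jn => dw j (ltnW jn)).
rewrite !derive1nS derivnS.
have := is_deriveB (derivableP (dw n (ltnSn n) y yin)) (is_derive_poly (derivn n q) y).
move=> hD; have hN : {near y, (fun z => derive1n n w z - (derivn n q).[z]) =1 derive1n n W}.
  by apply: filterS (near_itv_oo yin) => z /IH' ->.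
have [_ e] := near_eq_is_derive hN hD.
by rewrite !derive1E e.
Qed.

Lemma derivn_glob x h (q : {poly R}) n : derivn n (glob x h q) = h ^- n *: glob x h (derivn n q).
Proof.
elim: n => [|n IH]; first by rewrite !derivn0 expr0 invr1 scale1r.
by rewrite !derivnS IH derivZ deriv_glob scalerA exprSr invfM mulrC.
Qed.

End CellError.


(** * Galerkin orthogonality and the error bound *)

Section Galerkin.
Variable R : realType.
Local Notation mu := (@lebesgue_measure R).
Local Notation C := R[i].
Local Notation RC := (map_poly (real_complex R)).
Local Open Scope classical_set_scope.
Implicit Types (a b x y h : R) (w : R -> R) (f u v : R -> C).

Definition nodal h u v (K : nat) : C := u (K%:R * h) - v (K%:R * h).
Definition moments h u v (K j : nat) : C := cmom (K%:R * h) h u j - cmom (K%:R * h) h v j.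

Lemma galerkin_cells M m p L h b (c : C) f u uh : 0 < h -> M.+1%:R * h = L ->
  (forall psi, H10 L psi -> form_a L b c u psi = form_l L f psi) ->
  (forall psi, Vh L M.+1 m p psi -> form_a L b c uh psi = form_l L f psi) ->
  C1_cells M.+1 h u -> C1_cells M.+1 h uh ->
  forall psi, conforming M.+1 (cell_degree M.+1 m p) psi ->
  \sum_(K < M.+1) cellgal (h%:C)%C (b%:C)%C c (nodal h u uh K) (nodal h u uh K.+1)
    (moments h u uh K) (psi K) = 0.
Proof.
move=> h0 <- hu huh nu nuh; apply: galerkin_complex => // Q sQ Q0 Q1 Qc.
(* extended by zero: glue reads the value at the right end from Q' M.+1 *)
pose Q' K := if (K < M.+1)%N then Q K else 0.
have Q'E K : (K < M.+1)%N -> Q' K = Q K by rewrite /Q' => ->.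
pose psi := glue h Q'.
have fpsi : follows M.+1 h psi Q'.
  apply: glue_follows => //; first by move=> K KN; rewrite !Q'E // ?Qc // ltnW.
  by rewrite Q'E //= Q1 /Q' ltnn horner0.
have Vpsi : Vh (M.+1%:R * h) M.+1 m p (fun y => (psi y)%:C)%C.
  apply: Vh_follows fpsi _ _ _ => //; first by move=> K KN; rewrite Q'E ?sQ.
  by rewrite Q'E.
have e : form_a (M.+1%:R * h) b c u (fun y => (psi y)%:C)%C =
         form_a (M.+1%:R * h) b c uh (fun y => (psi y)%:C)%C.
  by rewrite hu ?huh //; case: Vpsi.
rewrite (form_a_cells b c h0 nu fpsi) (form_a_cells b c h0 nuh fpsi) in e.
move/eqP: e; rewrite -subr_eq0 -sumrB => /eqP e.
rewrite -[RHS]e; apply: eq_bigr => K _; rewrite -cellgalB Q'E //.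
by rewrite /nodal -natr1 mulrDl mul1r.
Qed.

Lemma tail0_derivn n (P : {poly C}) d : (size P <= d)%N ->
  tail 0 (derivn n P) <= d%:R ^+ n * tail n P.
Proof.
elim: n P => [|n IH] P sP; first by rewrite derivn0 expr0 mul1r.
rewrite derivSn; apply: (le_trans (IH _ _)).
  by apply: (leq_trans (size_poly _ _)); apply: leq_trans sP; exact: leq_pred.
rewrite exprSr -mulrA ler_wpM2l ?exprn_ge0 //; apply: (le_trans (tail_deriv _ _)).
by rewrite ler_wpM2r ?tail_ge0 // ler_nat.
Qed.

Lemma cell_error_deriv x h u v (q : {poly C}) (TR TI : {poly R}) (B : R) n d : 0 < h ->
  follows_cell x h v q -> (size (RC TR + 'i%C *: RC TI - q)%R <= d)%N ->
  (forall j, (j < n)%N -> forall y, x < y < x + h ->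
     derivable (derive1n j (@complex.Re R \o u)) y 1 /\
     derivable (derive1n j (@complex.Im R \o u)) y 1) ->
  (forall y, x < y < x + h ->
    `|complex.Re (cderive n u y) - h ^- n * (derivn n TR).[(y - x) / h]| <= B /\
    `|complex.Im (cderive n u y) - h ^- n * (derivn n TI).[(y - x) / h]| <= B) ->
  forall y, x < y < x + h -> modulus (cderive n (u \- v) y) <=
    2 * (B + h ^- n * (d%:R ^+ n * tail n (RC TR + 'i%C *: RC TI - q))).
Proof.
move=> h0 vq; set S := RC TR + _ - q => sS du hB y yin.
have oc z : x < z < x + h -> x <= z <= x + h by move=> /andP[/ltW -> /ltW ->].
have eS : S = RC (TR - rep q) + 'i%C *: RC (TI - imp q).
  by rewrite /S {1}[q]poly_ReIm !rmorphB /= scalerBr opprD addrACA.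
have hS t : 0 <= t <= 1 -> `|(derivn n (TR - rep q)).[t]| <= d%:R ^+ n * tail n S /\
    `|(derivn n (TI - imp q)).[t]| <= d%:R ^+ n * tail n S.
  move=> /andP[t0 t1].
  have m0 : modulus (derivn n S).[(t%:C)%C] <= d%:R ^+ n * tail n S.
    apply: le_trans (tail0_derivn n sS); apply: modulus_horner.
    by rewrite modulus_real ger0_norm.
  have eD : (derivn n S).[(t%:C)%C] =
      ((derivn n (TR - rep q)).[t] +i* (derivn n (TI - imp q)).[t])%C.
    by rewrite eS derivnD derivnZ !derivn_map hornerD hornerZ !horner_map /=; simpc.
  move: m0; rewrite eD => m0.
  by split; apply: le_trans m0; [exact: (normr_Re_le (_ +i* _)%C)|exact: (normr_Im_le (_ +i* _)%C)].
have t01 : 0 <= (y - x) / h <= 1.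
  case/andP: (yin) => xy yx; rewrite divr_ge0 ?(ltW h0) ?subr_ge0 ?(ltW xy) //=.
  by rewrite ler_pdivrMr // mul1r; lra.
have [hR hI] := hS _ t01; have [BR BI] := hB y yin.
have eR := @derive1n_subpoly _ x (x + h) (@complex.Re R \o u) (@complex.Re R \o (u \- v))
   (glob x h (rep q)) n (fun j jn z zin => (du j jn z zin).1).
have eI := @derive1n_subpoly _ x (x + h) (@complex.Im R \o u) (@complex.Im R \o (u \- v))
   (glob x h (imp q)) n (fun j jn z zin => (du j jn z zin).2).
have {}eR : complex.Re (cderive n (u \- v) y) =
    complex.Re (cderive n u y) - h ^- n * (derivn n (rep q)).[(y - x) / h].
  rewrite /= eR //; first by rewrite derivn_glob hornerZ horner_glob.
  by move=> z zin; rewrite /= ReD ReN vq ?oc // horner_glob rep_horner.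
have {}eI : complex.Im (cderive n (u \- v) y) =
    complex.Im (cderive n u y) - h ^- n * (derivn n (imp q)).[(y - x) / h].
  rewrite /= eI //; first by rewrite derivn_glob hornerZ horner_glob.
  by move=> z zin; rewrite /= ImD ImN vq ?oc // horner_glob imp_horner.
apply: (le_trans (modulus_le_ReIm _)); rewrite eR eI.
have hn : 0 <= h ^- n by rewrite invr_ge0 exprn_ge0 // ltW.
have one (g t1 t2 : R) : `|g - h ^- n * t1| <= B -> `|t1 - t2| <= d%:R ^+ n * tail n S ->
    `|g - h ^- n * t2| <= B + h ^- n * (d%:R ^+ n * tail n S).
  move=> g1 g2; have -> : g - h ^- n * t2 = (g - h ^- n * t1) + h ^- n * (t1 - t2) by ring.
  apply: (le_trans (ler_normD _ _)); rewrite lerD // normrM ger0_norm //.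
  by rewrite ler_wpM2l.
move: hR hI; rewrite !derivnB !hornerD !hornerN => hR hI.
have := one _ _ _ BR hR; have := one _ _ _ BI hI; lra.
Qed.

Lemma big_maxe_fin n (F : nat -> \bar R) :
  (forall j, (j < n)%N -> exists2 M : R, 0 <= M & F j = M%:E) ->
  exists2 U : R, 0 <= U & (\big[maxe/0%E]_(j < n) F j = U%:E) /\
    forall j, (j < n)%N -> (F j <= U%:E)%E.
Proof.
elim: n F => [|n IH] F hF; first by exists 0 => //; rewrite big_ord0.
have [U U0 [eU hU]] := IH (fun j => F j.+1) (fun j jn => hF j.+1 jn).
have [M M0 eM] := hF 0%N (ltn0Sn n).
exists (Num.max M U); first by rewrite le_max M0.
split.
  rewrite big_ord_recl eM EFin_max; congr maxe; rewrite -eU.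
  by apply: eq_bigr => j _; rewrite lift0.
move=> [_|j jn]; first by rewrite eM lee_fin le_max lexx.
by apply: (le_trans (hU j jn)); rewrite lee_fin le_max lexx orbT.
Qed.

Lemma sqr_Dconst b (c : C) : Dconst b c ^+ 2 = ((b ^+ 2 / 4)%:C)%C + c.
Proof.
have -> : ((b ^+ 2 / 4)%:C)%C = ((b ^+ 2)%:C)%C / 4 :> C.
  by rewrite (rmorphM (real_complex R)) (fmorphV (real_complex R)) (rmorph_nat (real_complex R)).
by rewrite /Dconst expr_div_n sqr_sqrtc; field.
Qed.

Definition kappa b : R := 1 + `|b| + b ^+ 2 / 4.

(** Since D^2 = b^2/4 + c, powers of D control the coefficients, and gamma
    controls D^2; kappa only depends on b. *)
Lemma kappa_bounds b (c : C) : let D := modulus (Dconst b c) in 1 <= D ->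
  [/\ `|b| <= kappa b * D, modulus c <= kappa b * D ^+ 2 &
      D ^+ 2 <= kappa b * bound_const b c].
Proof.
move=> D D1; have b2 : 0 <= b ^+ 2 / 4 by rewrite divr_ge0 ?sqr_ge0.
have b0 := normr_ge0 b; have c0 := modulus_ge0 c.
have eD : D ^+ 2 = modulus (((b ^+ 2 / 4)%:C)%C + c) by rewrite /D -modulusX sqr_Dconst.
have mb : modulus (((b ^+ 2 / 4)%:C)%C : C) = b ^+ 2 / 4 by rewrite modulus_real ger0_norm.
have D2 : 1 <= D ^+ 2 by rewrite expr_ge1 // (le_trans ler01).
have k0 : 1 <= kappa b by rewrite /kappa; lra.
split.
- apply: (@le_trans _ _ (kappa b)); first by rewrite /kappa; lra.
  by rewrite ler_peMr // (le_trans ler01).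
- have : modulus c <= D ^+ 2 + b ^+ 2 / 4.
    have {1}-> : c = (((b ^+ 2 / 4)%:C)%C + c) - ((b ^+ 2 / 4)%:C)%C by ring.
    by apply: (le_trans (modulusB _ _)); rewrite -eD mb.
  move=> /le_trans; apply; rewrite /kappa.
  have := ler_wpM2l b2 D2; have := mulr_ge0 b0 (le_trans ler01 D2); lra.
- rewrite eD; apply: (le_trans (modulusD _ _)); rewrite mb /kappa /bound_const.
  have := mulr_ge0 b2 b0; have := mulr_ge0 b2 c0; have := mulr_ge0 b0 b0.
  have := mulr_ge0 b0 c0; lra.
Qed.

Lemma Wkinf_primitive L k u : Wkinf (k + 1) 0 L u ->
  (forall j, (j <= k)%N ->
     primitive 0 L (derive1n j (@complex.Re R \o u)) (derive1n j.+1 (@complex.Re R \o u)) /\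
     primitive 0 L (derive1n j (@complex.Im R \o u)) (derive1n j.+1 (@complex.Im R \o u))) /\
  (forall j, (j <= k.+1)%N -> itg 0 L (derive1n j (@complex.Re R \o u)) /\
     itg 0 L (derive1n j (@complex.Im R \o u))).
Proof.
rewrite /Wkinf addn1 => -[h1 h2]; split => j jk.
  by have [g1 g2] := abs_cont_primitive (h1 j jk); rewrite !derive1nS; split; [exact: g1|exact: g2].
by have [g1 g2] := h2 j jk; split; apply: Lfun_oo_itg; [exact: g1|exact: g2].
Qed.

Lemma Wkinf_C1_cells L k N h u : 0 < h -> N%:R * h = L -> (0 < k)%N -> H10 L u ->
  Wkinf (k + 1) 0 L u -> C1_cells N h u.
Proof.
move=> h0 eL k0 [cu _ _ _ _] /Wkinf_primitive[ha hi] K KN.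
have L0 : 0 < L by rewrite -eL mulr_gt0 // ltr0n (leq_trans _ KN).
have [cR cI] := abs_cont_continuous L0 cu.
have x0 : 0 <= K%:R * h by rewrite mulr_ge0 // ltW.
have xh : K%:R * h < K%:R * h + h by rewrite ltrDl.
have xL : K%:R * h + h <= L.
  by rewrite -eL -{2}[h]mul1r -mulrDl natr1 ler_pM2r // ler_nat.
have [a0R a0I] := ha 0%N (leq0n _); have [a1R a1I] := ha 1%N k0.
have [i1R i1I] := hi 1%N (ltn0Sn _); have [i2R i2I] := hi 2%N k0.
by split; [exact: (C1_primitive L0 cR a0R i1R a1R i2R)|exact: (C1_primitive L0 cI a0I i1I a1I i2I)].
Qed.

Lemma Wkinf_derivable L k n u : (n <= k)%N -> Wkinf (k + 1) 0 L u ->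
  forall j, (j < n)%N -> forall y, 0 < y < L ->
  derivable (derive1n j (@complex.Re R \o u)) y 1 /\
  derivable (derive1n j (@complex.Im R \o u)) y 1.
Proof.
move=> nk /Wkinf_primitive[ha hi] j jn y yin.
have jk := leq_trans jn nk.
have [aR aI] := ha j (ltnW jk); have [bR bI] := ha j.+1 jk.
have [iR iI] := hi j.+1 (ltnW jk); have [i'R i'I] := hi j.+2 jk.
by split; [have [] := primitive_derivable aR iR yin (primitive_continuous bR i'R yin)
         |have [] := primitive_derivable aI iI yin (primitive_continuous bI i'I yin)].
Qed.

End Galerkin.


(** Since n <= m + p, the power D^(n+m+3) is at most D^(2m+p+3).  The remaining
    factor D^2 of the first term is bounded by kappa gamma, and gamma and
    1/alpha are at least 1. *)
Lemma collect_powers (R : realType) (m p n : nat) (A G h D g al U1 U2 ka Mx t : R) :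
  (n <= m + p)%N -> 0 < h -> 1 <= D -> 0 <= ka -> D ^+ 2 <= ka * g -> 1 <= g ->
  0 < al <= 1 -> 0 <= U1 -> 0 <= U2 -> 0 <= Mx -> 0 <= A -> 0 <= G ->
  t <= A * ((D * h) ^+ n * (Mx * D ^+ 2 * (2 * (U1 * h ^+ m.+1) * D ^+ (m + 3) * h ^+ m))
            + D ^+ 2 * (2 * (U2 * h ^+ (m + p).+1))) ->
  2 * (U2 * h ^+ ((m + p).+1 - n) + h ^- n * (G * t)) <=
  (2 + 4 * (G * A) * (ka + 1)) *
  (D ^+ (2 * m + p + 3) * Mx * (g ^+ 4 / al ^+ 2) * U1 * h ^+ (2 * m + 1)
   + D ^+ 2 * (g ^+ 2 / al) * U2 * h ^+ (m + p - n + 1)).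
Proof.
move=> nk.
have le_pow : (n + (m + 3) <= 2 * m + p + 3)%N by lia.
have e2m : (2 * m + 1 = m.+1 + m)%N by lia.
move=> h0 D1 ka0 hD g1 /andP[al0 al1] U10 U20 Mx0 A0 G0 ht.
have D0 : 0 <= D by lra.
have hn0 : h ^+ n != 0 by rewrite expf_neq0 // gt_eqF.
have hp i : 0 <= h ^+ i by rewrite exprn_ge0 // ltW.
have g0 : 0 <= g by lra.
have iv1 : 1 <= al^-1 by rewrite invf_ge1.
have ga : g <= g ^+ 4 / al ^+ 2.
  rewrite -[leLHS]mulr1; apply: ler_pM => //; first by rewrite -{1}(expr1 g) ler_weXn2l.
  by rewrite -exprVn exprn_ege1.
have gb : 1 <= g ^+ 2 / al.
  by rewrite -[leLHS]mulr1; apply: ler_pM => //; rewrite exprn_ege1.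
have D2 : 1 <= D ^+ 2 by rewrite exprn_ege1.
have -> : (m + p - n + 1 = (m + p).+1 - n)%N by rewrite addn1 subSn.
set P1 := _ * U1 * _; set P2 := _ * U2 * _.
have hv : 0 <= h ^- n by rewrite invr_ge0.
have e1 : U2 * h ^+ ((m + p).+1 - n) <= P2.
  by rewrite /P2 ler_wpM2r // ler_peMl // -[leLHS]mulr1 ler_pM.
have e2 : D ^+ 2 * U2 * h ^+ ((m + p).+1 - n) <= P2.
  rewrite /P2 ler_wpM2r // ler_wpM2r // ler_peMr //; lra.
have P20 : 0 <= P2 by apply: le_trans e1; rewrite mulr_ge0.
have eD : D ^+ n * D ^+ (m + 3) <= D ^+ (2 * m + p + 3).
  by rewrite -exprD ler_weXn2l.
have e3 : (D ^+ n * D ^+ (m + 3)) * D ^+ 2 <= ka * (D ^+ (2 * m + p + 3) * (g ^+ 4 / al ^+ 2)).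
  rewrite [leRHS]mulrCA; apply: ler_pM => //; rewrite ?mulr_ge0 ?exprn_ge0 //.
  by apply: (le_trans hD); rewrite ler_wpM2l.
have e4 : D ^+ n * (Mx * D ^+ 2 * (2 * (U1 * h ^+ m.+1) * D ^+ (m + 3) * h ^+ m)) <= 2 * (ka * P1).
  have -> : D ^+ n * (Mx * D ^+ 2 * (2 * (U1 * h ^+ m.+1) * D ^+ (m + 3) * h ^+ m)) =
     2 * (((D ^+ n * D ^+ (m + 3)) * D ^+ 2) * (Mx * U1 * h ^+ (2 * m + 1))).
    have -> : h ^+ (2 * m + 1) = h ^+ m.+1 * h ^+ m by rewrite e2m exprD.
    by ring.
  rewrite ler_pM2l // /P1; apply: (le_trans (ler_wpM2r _ e3)); first by rewrite !mulr_ge0.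
  by rewrite le_eqVlt; apply/orP; left; apply/eqP; ring.
have P10 : 0 <= P1.
  rewrite /P1; apply: mulr_ge0 => //; apply: mulr_ge0 => //.
  by apply: mulr_ge0 (le_trans g0 ga); rewrite mulr_ge0 ?exprn_ge0.
have e5 : h ^- n * t <= A * (2 * (ka * P1) + 2 * P2).
  apply: (le_trans (ler_wpM2l hv ht)); rewrite mulrCA ler_wpM2l // mulrDr lerD //.
    by rewrite exprMn [D ^+ n * h ^+ n]mulrC -(mulrA (h ^+ n)) mulKf.
  have -> : h ^- n * (D ^+ 2 * (2 * (U2 * h ^+ (m + p).+1))) =
     2 * (D ^+ 2 * U2 * (h ^- n * h ^+ (m + p).+1)) by ring.
  rewrite -{1}(subnK (leqW nk)) exprD [h ^- n * _]mulrCA mulVf // mulr1.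
  by rewrite ler_pM2l.
have e6 : h ^- n * (G * t) <= G * (A * (2 * (ka * P1) + 2 * P2)).
  by rewrite mulrCA ler_wpM2l.
have GA := mulr_ge0 G0 A0.
have f1 := mulr_ge0 GA P10; have f2 := mulr_ge0 GA P20.
have f3 := mulr_ge0 ka0 f2; have f4 := mulr_ge0 ka0 f1.
move: (h ^- n * (G * t)) e6 (U2 * _) e1 f1 f2 f3 f4 => X e6 Y e1 f1 f2 f3 f4.
nra.
Qed.

Lemma Linf_fin_sub (R : realType) (a b x y : R) (f : R -> R[i]) : a <= x -> y <= b ->
  Lp +oo%E a b f -> exists2 M, 0 <= M & Linf_norm x y f = M%:E.
Proof.
move=> ax yb /Linf_fin[M M0 eM].
have /(Linf_normP _ _ _ M0) hM : (Linf_norm a b f <= M%:E)%E by rewrite eM.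
have h : (Linf_norm x y f <= M%:E)%E.
  apply/(Linf_normP _ _ _ M0).
  apply: (@filterS _ _ (ae_filter_ringOfSetsType lebesgue_measure) _ _ _ hM) => z hz /andP[xz zy].
  by apply: hz; rewrite (le_lt_trans ax) //= (lt_le_trans zy).
exists (fine (Linf_norm x y f)); first by apply: fine_ge0; exact: Linf_norm_ge0.
by rewrite fineK // ge0_fin_numE ?Linf_norm_ge0 // (le_lt_trans h) // ltry.
Qed.

Theorem theorem3 (R : realType) (L b : R) (m n p : nat)
    (hL : 0 < L) (hm : (1 <= m)%N) (hn : (n <= m + p)%N) :
  exists C5 : R,
  forall (c : R[i]) (f u uh : R -> R[i]) (N : nat),
  let D := Dconst b c in
  let gamma := bound_const b c in
  let alpha := coer_const c in
  let dy := cell_width L N in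
  let err := u \- uh in
  0 < complex.Re c ->
  1 <= complex.Re D ->
  `|complex.Im D| <= complex.Re D ->
  (0 < N)%N ->
  Lp 1%E 0 L f ->
  H10 L u ->
  (forall psi, H10 L psi -> form_a L b c u psi = form_l L f psi) ->
  Wkinf (m + p + 1) 0 L u ->
  Vh L N m p uh ->
  (forall psi, Vh L N m p psi -> form_a L b c uh psi = form_l L f psi) ->
  (Linf_norm (L - dy) L (cderive n err) <=
   C5%:E *
   ((modulus D ^+ (2 * m + p + 3)
       * Num.max 2 (2 / (modulus D * dy))
       * (gamma ^+ 4 / alpha ^+ 2))%R%:E
      * Linf_norm 0 L (cderive (m + 1) u)
      * (dy ^+ (2 * m + 1))%R%:E
    + (modulus D ^+ 2 * (gamma ^+ 2 / alpha))%R%:E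
      * Wkinf_norm (m + p + 1) (L - dy) L u
      * (dy ^+ (m + p - n + 1))%R%:E))%E.
Proof.
have kpos : (0 < m + p)%N by rewrite addn_gt0 hm.
have ka0 : 0 <= kappa b by rewrite /kappa !addr_ge0 ?divr_ge0 ?sqr_ge0.
have [A A0 hA] := last_cell_bound p n hL ka0 hm.
pose G : R := (m + p).+1%:R ^+ n; have G0 : 0 <= G by exact: exprn_ge0.
exists (2 + 4 * (G * A) * (kappa b + 1)).
move=> c f u uh N D gamma alpha dy err c0 D1 _ N0 _ Hu hu Wu Vuh huh.
have [M eN] : exists M, N = M.+1 by exists N.-1; rewrite prednK.
have Hn0 : (N%:R : R) != 0 by rewrite pnatr_eq0 -lt0n.
have h0 : 0 < dy by rewrite divr_gt0 // ltr0n.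
have eL : M.+1%:R * dy = L by rewrite -eN /dy /cell_width mulrC divfK.
have D1' : 1 <= modulus D by exact: le_trans D1 (Re_le_modulus _).
have [hb hc hD] := kappa_bounds D1'; rewrite -/gamma -/D in hb hc hD.
have g1 : 1 <= gamma by rewrite /gamma /bound_const -addrA lerDl addr_ge0 ?modulus_ge0.
have al : 0 < alpha <= 1 by rewrite /alpha /coer_const lt_min ltr01 c0 ge_min lexx.
pose x K : R := K%:R * dy.
have xS K : x K.+1 = x K + dy by rewrite /x -natr1 mulrDl mul1r.
have x0 K : 0 <= x K by rewrite mulr_ge0 // ltW.
have xL K : (K <= M)%N -> x K + dy <= L by move=> KM; rewrite -xS -eL ler_pM2r // ler_nat.
have eM : x M + dy = L by rewrite -xS.
have eM' : L - dy = x M by rewrite -eM addrK.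
have inL K y : (K <= M)%N -> x K < y < x K + dy -> 0 < y < L.
  by move=> /xL KL /andP[xy yx]; rewrite (le_lt_trans (x0 K)) //= (lt_le_trans yx).
have [hac hLp] := Wu.
have acK K j : (K <= M)%N -> (j <= m + p)%N -> abs_cont `](x K), (x K + dy)[%classic (cderive j u).
  move=> KM jk y z hy hz yz; have jk' : (j < m + p + 1)%N by rewrite addn1.
  apply: (hac j jk') => //; rewrite /= in_itv /=; apply: inL KM _.
    by move: hy; rewrite /= in_itv.
  by move: hz; rewrite /= in_itv.
have [U1 U10 eU1] := Linf_fin (hLp (m + 1)%N (leq_add (leq_addr _ _) (leqnn 1))).
have aU1 : {ae lebesgue_measure, forall y, 0 < y < L -> modulus (cderive m.+1 u y) <= U1}.
  by apply/(Linf_normP _ _ _ U10); rewrite -addn1 eU1.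
have [|U2 U20 [eU2 hU2]] := @big_maxe_fin R (m + p + 1).+1 (fun j => Linf_norm (L - dy) L (cderive j u)).
  move=> j jk; apply: (Linf_fin_sub _ _ (hLp j jk)) => //; by rewrite eM'.
have aU2 : {ae lebesgue_measure, forall y, x M < y < x M + dy -> modulus (cderive (m + p).+1 u y) <= U2}.
  apply/(Linf_normP _ _ _ U20); rewrite eM -eM' -[(m + p).+1]addn1; exact: hU2.
have nu : C1_cells M.+1 dy u by exact: (Wkinf_C1_cells h0 eL kpos Hu Wu).
have locV K : (K <= M)%N -> exists2 q : {poly R[i]}, (size q <= (cell_degree M.+1 m p K).+1)%N &
    follows_cell (x K) dy uh q.
  move=> KM; have KN : (K < N)%N by rewrite eN ltnS.
  by have := Vh_local hL N0 Vuh KN; rewrite -/dy eN.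
have nuh : C1_cells M.+1 dy uh.
  by move=> K KM; have [q _ hq] := locV K KM; exact: C1_follows hq.
have degm K : (m <= cell_degree M.+1 m p K)%N by rewrite /cell_degree; case: ifP; rewrite ?leq_addr.
have degM : cell_degree M.+1 m p M = (m + p)%N by rewrite /cell_degree eqxx orbT.
have cu K : (K <= M)%N -> ({within `[x K, x K + dy], continuous (fun y => complex.Re (u y))} /\
    {within `[x K, x K + dy], continuous (fun y => complex.Im (u y))})%classic.
  move=> KM; have [[w1 [d1 _ _]] [w2 [d2 _ _]]] := nu K KM.
  by split; exact: derivable_oo_LRcontinuous_within.
have near K r (U : R) q : (K <= M)%N -> (r <= m + p)%N -> 0 <= U ->
    {ae lebesgue_measure, forall y, x K < y < x K + dy -> modulus (cderive r.+1 u y) <= U} ->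
    follows_cell (x K) dy uh q ->
    exists TR TI : {poly R}, [/\ (size TR <= r.+1)%N, (size TI <= r.+1)%N,
     near_poly (m + p) (nodal dy u uh K) (nodal dy u uh K.+1) (moments dy u uh K)
       (map_poly (real_complex R) TR + 'i%C *: map_poly (real_complex R) TI - q) (2 * (U * dy ^+ r.+1)) &
     forall j, (j <= r)%N -> forall y, x K < y < x K + dy ->
      `|complex.Re (cderive j u y) - dy ^- j * (derivn j TR).[(y - x K) / dy]| <= U * dy ^+ (r.+1 - j) /\
      `|complex.Im (cderive j u y) - dy ^- j * (derivn j TI).[(y - x K) / dy]| <= U * dy ^+ (r.+1 - j)].
  move=> KM rk U0 hU hq; have [|TR [TI [sR sI hT]]] := taylor_cell h0 U0 _ hU.
    by move=> j jr; apply: acK => //; exact: leq_trans jr rk.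
  exists TR, TI; split => //; have [cR cI] := cu K KM.
  have hT0 := hT 0%N (leq0n _).
  rewrite /nodal -/(x K) -/(x K.+1) xS; apply: cell_near hq => //.
  - by rewrite mulr_ge0 // exprn_ge0 // ltW.
  - by move=> y /hT0[+ _]; rewrite derivn0 expr0 invr1 mul1r subn0.
  - by move=> y /hT0[_]; rewrite derivn0 expr0 invr1 mul1r subn0.
have sizeS (TR TI : {poly R}) (q : {poly R[i]}) d e : (d <= e)%N -> (size TR <= d)%N -> (size TI <= d)%N ->
    (size q <= e)%N ->
    (size (map_poly (real_complex R) TR + 'i%C *: map_poly (real_complex R) TI - q)%R <= e)%N.
  move=> de sR sI sq; apply: (leq_trans (size_polyD _ _)); rewrite geq_max size_polyN sq andbT.
  apply: (leq_trans (size_polyD _ _)); rewrite geq_max size_map_poly (leq_trans sR de) /=.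
  by apply: (leq_trans (size_scale_leq _ _)); rewrite size_map_poly (leq_trans sI de).
have exS K : exists S : {poly R[i]}, (K <= M)%N -> (size S <= (cell_degree M.+1 m p K).+1)%N /\
    near_poly (m + p) (nodal dy u uh K) (nodal dy u uh K.+1) (moments dy u uh K) S (2 * (U1 * dy ^+ m.+1)).
  have [KM|KM] := leqP K M; last by exists 0.
  have [q sq hq] := locV K KM.
  have [|TR [TI [sR sI nr _]]] := near K m U1 q KM (leq_addr _ _) U10 _ hq.
    apply: (@filterS _ _ (ae_filter_ringOfSetsType lebesgue_measure) _ _ _ aU1) => y hy yin.
    by apply: hy; exact: inL yin.
  eexists => _; split; last exact: nr.
  by apply: (sizeS TR TI q m.+1) sq; rewrite ?ltnS ?degm.
(* Taylor polynomials of degree m on all cells, for the estimate at the node *)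
pose S K := projT1 (cid (exS K)).
have hS K : (K <= M)%N -> (size (S K) <= (cell_degree M.+1 m p K).+1)%N /\
    near_poly (m + p) (nodal dy u uh K) (nodal dy u uh K.+1) (moments dy u uh K) (S K) (2 * (U1 * dy ^+ m.+1)).
  by rewrite /S; case: cid.
have [q sq hq] := locV M (leqnn M); rewrite degM in sq.
(* a second one, of degree m + p, on the last cell *)
have [TR [TI [sR sI nr hT]]] := near M (m + p)%N U2 q (leqnn M) (leqnn _) U20 aU2 hq.
set S' := map_poly _ TR + _ - q in nr.
have sS' : (size S' <= (m + p).+1)%N by exact: (sizeS TR TI q (m + p).+1).
have ht := hA M dy b c (modulus D) (nodal dy u uh) (moments dy u uh) S S'
  (2 * (U1 * dy ^+ m.+1)) (2 * (U2 * dy ^+ (m + p).+1)) h0 eL c0 D1' hb hc.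
have {}ht : tail n S' <= A * ((modulus D * dy) ^+ n * (Num.max 2 (2 / (modulus D * dy)) * modulus D ^+ 2 *
     (2 * (U1 * dy ^+ m.+1) * modulus D ^+ (m + 3) * dy ^+ m)) + modulus D ^+ 2 * (2 * (U2 * dy ^+ (m + p).+1))).
  have [_ _ _ u00 u0L] := Hu; have [[_ _ _ v00 v0L] _] := Vuh.
  apply: ht => //.
  - by rewrite mulr_ge0 // mulr_ge0 // exprn_ge0 // ltW.
  - by rewrite mulr_ge0 // mulr_ge0 // exprn_ge0 // ltW.
  - by rewrite /nodal mul0r u00 v00 subrr.
  - by rewrite /nodal eL u0L v0L subrr.
  - by apply: (galerkin_cells h0 eL hu _ nu nuh) => psi; rewrite -eN; exact: huh.
rewrite /Wkinf_norm eU1 eU2 -!EFinM.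
have Mx0 : 0 <= Num.max 2 (2 / (modulus D * dy)) by rewrite le_max ler0n.
have fin := collect_powers hn h0 D1' ka0 hD g1 al U10 U20 Mx0 A0 G0 ht.
apply/Linf_normP.
  apply: le_trans fin; rewrite mulr_ge0 // addr_ge0 //.
    by rewrite mulr_ge0 // exprn_ge0 // ltW.
  by rewrite mulr_ge0 ?invr_ge0 ?exprn_ge0 ?(ltW h0) // mulr_ge0 // tail_ge0.
apply: aeW => y; rewrite eM' -{1}eM => yin; apply: le_trans fin.
apply: (cell_error_deriv h0 hq sS' _ _ yin); last exact: hT.
move=> j jn z zin; apply: (Wkinf_derivable hn Wu jn); exact: inL zin.
Qed.
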